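(* Let $\alpha\in(0,1)$, $T>0$, and let $u:[0,T]\to\mathbb R^d$ be the solution of the Caputo fractional ODE $\mathcal D_c^\alpha u(t)=f(t,u(t))$, $u(0)=u_0$. Assume $f$ is regular enough that for $t\in[0,T]$ $$u(t)=\sum_{m=1}^{M}\beta_m\frac{1}{\Gamma(m\alpha+1)}t^{m\alpha}+\psi(t),$$ where $M=\lfloor1/\alpha\rfloor$, the $\beta_m\in\mathbb R^d$ are constants and $\psi\in C^1([0,T];\mathbb R^d)$. Assume that either $(x-y)\cdot(f(t,x)-f(t,y))\le0$ for all $t\in[0,T]$ and $x,y\in\mathbb R^d$, or $f(t,\cdot)$ is Lipschitz continuous with a Lipschitz constant $L$ independent of $t\in[0,T]$. Let $\{u_n\}$ be the numerical solution given by a $\mathcal{CM}$-preserving scheme with step size $h$, and $t_n=nh$. Then $$\lim_{h\to0}\ \sup_{n:\,nh\le T}\|u(t_n)-u_n\|=0.$$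
   Context: The Caputo derivative is $\mathcal D_c^\alpha u(t)=\frac1{\Gamma(1-\alpha)}\int_0^t\frac{u'(s)}{(t-s)^\alpha}ds$. A real sequence $v=(v_0,v_1,\dots)$ is completely monotone if $((I-E)^jv)_k\ge 0$ for all $j,k\ge 0$, where $(Ev)_k=v_{k+1}$. Convolution: $(u*v)_n=\sum_{j=0}^n u_jv_{n-j}$, with identity $\delta_d=(1,0,0,\dots)$; $\omega^{(-1)}$ is the sequence with $\omega*\omega^{(-1)}=\delta_d$. For $\alpha\in(0,1)$ and step size $h>0$, a real sequence $\omega$ with $\omega_0\ne0$ (independent of $h$) defines the implicit scheme $h^{-\alpha}\sum_{j=0}^n\omega_j(u_{n-j}-u_0)=f(t_n,u_n)$, $n\ge1$, $t_n=nh$, for the Caputo fractional ODE; equivalently, with $a=\omega^{(-1)}$, $u_n=u_0+h^\alpha\sum_{j=0}^{n-1}a_jf(t_{n-j},u_{n-j})$, $n\ge1$. With $F_a(z)=\sum_{n\ge0}a_nz^n$, the scheme is consistent if $h^\alpha F_a(e^{-h})=1+o(1)$ as $h\to0^+$. A scheme is $\mathcal{CM}$-preserving if it is consistent and $a=\omega^{(-1)}$ is completely monotone. *)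

(* Defs.v *)
From HB Require Import structures.
From mathcomp Require Import all_boot all_order all_algebra.
From mathcomp Require Import all_classical all_reals all_analysis.

Set Implicit Arguments.
Unset Strict Implicit.
Unset Printing Implicit Defensive.

Import Order.TTheory GRing.Theory Num.Theory.
Import numFieldNormedType.Exports.

Local Open Scope classical_set_scope.
Local Open Scope ring_scope.

(** * Euclidean structure of R^d *)

Definition dot (R : realType) (d : nat) (x y : 'rV[R]_d) : R :=
  \sum_(i < d) x 0 i * y 0 i.

(* The library norm on ['rV_d] is the sup norm, hence this definition. *)
Definition enorm (R : realType) (d : nat) (x : 'rV[R]_d) : R :=
  Num.sqrt (dot x x).

(** * Gamma function and Caputo derivative *)

(* Meaningful for [0 < x], where the integral converges. *)
Definition Gamma (R : realType) (x : R) : R :=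
  \int[@lebesgue_measure R]_(s in `]0, +oo[) (s `^ (x - 1) * expR (- s)).

Definition caputo_integrand (R : realType) (alpha : R) (g : R -> R) (t s : R)
    : R :=
  derive1 g s / (t - s) `^ alpha.

Definition caputo (R : realType) (alpha : R) (g : R -> R) (t : R) : R :=
  (Gamma (1 - alpha))^-1 *
  \int[@lebesgue_measure R]_(s in `]0, t[) caputo_integrand alpha g t s.

(* [u] is only constrained on [0, T].  The derivability and integrability
   clauses say that the Caputo derivative of each component exists; without
   them [caputo] could take the default value of a divergent integral. *)
Definition caputo_solution (R : realType) (d : nat) (alpha T : R)
    (f : R -> 'rV[R]_d -> 'rV[R]_d) (u0 : 'rV[R]_d) (u : R -> 'rV[R]_d)
    : Prop :=
  [/\ u 0 = u0,
      forall (i : 'I_d) (t : R), 0 < t < T -> derivable (fun s => u s 0 i) t 1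
    & forall (i : 'I_d) (t : R), 0 < t <= T ->
        (@lebesgue_measure R).-integrable `]0, t[
          (EFin \o caputo_integrand alpha (fun s => u s 0 i) t) /\
        caputo alpha (fun s => u s 0 i) t = f t (u t) 0 i].

(* C^1 on the closed interval [0, T], with one-sided derivatives at the ends;
   values of [psi] outside [0, T] are irrelevant. *)
Definition C1_on (R : realType) (d : nat) (T : R) (psi : R -> 'rV[R]_d)
    : Prop :=
  forall i : 'I_d, exists2 dpsi : R -> R,
    {within `[0, T], continuous dpsi} &
    forall t, 0 <= t <= T ->
      (psi s 0 i - psi t 0 i) / (s - t) @[s --> within `[0, T] t^']
        --> dpsi t.

(** * Completely monotone sequences and CM-preserving schemes *)

(* The operator I - E. *)
Definition subshift (R : realType) (v : nat -> R) : nat -> R :=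
  fun k => v k - v k.+1.

Definition completely_monotone (R : realType) (v : nat -> R) : Prop :=
  forall j k : nat, 0 <= iter j (@subshift R) v k.

Definition conv (R : realType) (u v : nat -> R) : nat -> R :=
  fun n => \sum_(j < n.+1) u j * v (n - j)%N.

Definition delta_d (R : realType) : nat -> R := fun n => (n == 0%N)%:R.

(* [v] is the convolution inverse of [w]; it exists and is unique as soon as
   [w 0 != 0]. *)
Definition conv_inverse (R : realType) (w v : nat -> R) : Prop :=
  conv w v =1 @delta_d R.

(* The sum F_a(z) of the generating series, where it converges. *)
Definition gen_fun (R : realType) (a : nat -> R) (z : R) : R :=
  limn (series (fun n => a n * z ^+ n)).

(* A completely monotone [a] is bounded, so the series below converges for
   every [h > 0]. *)
Definition consistent (R : realType) (alpha : R) (a : nat -> R) : Prop :=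
  (h `^ alpha * gen_fun a (expR (- h))) @[h --> 0^'+] --> (1 : R).

Definition CM_preserving (R : realType) (alpha : R) (omega : nat -> R)
    : Prop :=
  omega 0%N != 0 /\
  exists a : nat -> R,
    [/\ conv_inverse omega a, consistent alpha a & completely_monotone a].

(* [v] solves the scheme at all grid points [n h] of [0, T]; since [f] is only
   given on [0, T], nothing is required of [v n] when [n h > T]. *)
Definition numerical_solution (R : realType) (d : nat) (alpha T : R)
    (omega : nat -> R) (f : R -> 'rV[R]_d -> 'rV[R]_d) (u0 : 'rV[R]_d)
    (h : R) (v : nat -> 'rV[R]_d) : Prop :=
  v 0%N = u0 /\
  forall n : nat, (1 <= n)%N -> n%:R * h <= T ->
    h `^ (- alpha) *: (\sum_(j < n.+1) omega j *: (v (n - j)%N - u0))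
      = f (n%:R * h) (v n).

(** * Hypotheses on the right-hand side *)

Definition one_sided_dissipative (R : realType) (d : nat) (T : R)
    (f : R -> 'rV[R]_d -> 'rV[R]_d) : Prop :=
  forall (t : R) (x y : 'rV[R]_d), 0 <= t <= T ->
    dot (x - y) (f t x - f t y) <= 0.

Definition uniformly_lipschitz (R : realType) (d : nat) (T : R)
    (f : R -> 'rV[R]_d -> 'rV[R]_d) : Prop :=
  exists L : R, forall (t : R) (x y : 'rV[R]_d), 0 <= t <= T ->
    enorm (f t x - f t y) <= L * enorm (x - y).

(* For [h > 0] this is the supremum of a finite set, nonempty if [0 <= T]. *)
Definition max_error (R : realType) (d : nat) (T : R) (u : R -> 'rV[R]_d)
    (h : R) (v : nat -> 'rV[R]_d) : R :=
  sup [set enorm (u (n%:R * h) - v n) | n in [set n : nat | n%:R * h <= T]].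

(* Main.v *)
Require Import Defs.
From HB Require Import structures.
From mathcomp Require Import all_boot all_order all_algebra.
From mathcomp Require Import all_classical all_reals all_analysis.
From mathcomp Require Import measurable_realfun.
From mathcomp Require Import zify ring lra.

Set Implicit Arguments.
Unset Strict Implicit.
Unset Printing Implicit Defensive.

Import Order.TTheory GRing.Theory Num.Theory.
Import numFieldNormedType.Exports.

Local Open Scope classical_set_scope.
Local Open Scope ring_scope.

(** The error [e n = u (n h) - U h n] vanishes for [n = 0] and satisfies
    [omega * e = h^alpha (df + r)] for [n >= 1], where [df] is the difference of
    the values of [f] and [r] the local truncation error.  The theorem follows from a sign
    property of [omega], which makes this equation stable, and from a weak
    consistency property, which makes [r] small enough.

    Signs.  A completely monotone [a] is log-convex, because second moments of
    binomial variables are nonnegative ([binomial_second_moment_ge0]).  By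
    Kaluza's theorem ([kaluza]) its convolution inverse [omega] is nonpositive
    except at 0, and the partial sums [W] of [omega] are nonnegative and
    nonincreasing.

    Sizes.  Consistency gives the behaviour of the generating functions of [a]
    and, as [W * a = 1], of [W] at 1.  Hence the sums of [a j] and [W j] over
    [j < n] are at most of order [n^alpha] and [n^(1 - alpha)].  A Tauberian
    theorem ([tauberian]) sharpens this for [W]: its sums differ by
    [o(n^(1 - alpha))] from those of the integrals of the kernel
    [s^(- alpha) / Gamma (1 - alpha)] over the cells [[j, j + 1]].  The Gamma
    function enters only through the generating function of these integrals
    ([Gamma_between]).

    Truncation.  The powers [t^(m alpha)] and the C^1 part of [u] have
    derivatives that are continuous for [t > 0] and dominated by
    [t^(alpha - 1)] ([singular_C1]).  Summation by parts writes the discrete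
    derivative as a sum of increments of [u] weighted by [W].  Away from
    [t = 0] it converges uniformly to the Caputo derivative
    ([truncation_small]): the increments over an initial layer contribute
    little ([head_sum_le], [head_integral_le]), on the others the kernel
    integrals reproduce the Caputo integral ([tail_integral_le]), and the
    cumulative closeness of [W] to these integrals is enough for the rest by
    another summation by parts ([tail_sum_le]).  Near [t = 0] the truncation
    error is merely bounded ([discrete_caputo_bounded], [caputo_bounded]).

    Stability.  Each of the two hypotheses on [f] gives
    [(x - y) . (f t x - f t y) <= L |x - y|^2], with [L = 0] in the
    dissipative case.  Taking the inner product of the error equation with
    [e n], the signs of [omega] give [omega * |e| <= h^alpha (L |e| + |r|)]
    ([energy_inequality]).  Convolving with [a >= 0] yields
    [|e| <= h^alpha a * (L |e| + |r|)].  Since [h^alpha a] has little mass on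
    short intervals, [h^alpha a * |r|] tends to 0 uniformly
    ([weighted_error_small]), and a discrete Gronwall inequality ([gronwall])
    concludes. *)

(* The convolution of sequences, not the convex combination of that name. *)
Local Notation conv := Defs.conv.

(** * Completely monotone sequences and their convolution inverses *)

Lemma iter_subshift_shift (R : realType) (a : nat -> R) (j k : nat) :
  iter j (@subshift R) (fun i => a i.+1) k = iter j (@subshift R) a k.+1.
Proof. by elim: j k => [//|j IH] k; rewrite !iterS /subshift !IH. Qed.

Lemma completely_monotone_shift (R : realType) (a : nat -> R) :
  completely_monotone a -> completely_monotone (fun i => a i.+1).
Proof. by move=> ha j k; rewrite iter_subshift_shift. Qed.

Lemma completely_monotone_subshift (R : realType) (a : nat -> R) :
  completely_monotone a -> completely_monotone (subshift a).
Proof. by move=> ha j k; rewrite -iterSr. Qed.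

Lemma completely_monotone_ge0 (R : realType) (a : nat -> R) (k : nat) :
  completely_monotone a -> 0 <= a k.
Proof. by move=> ha; exact: (ha 0%N k). Qed.

Lemma completely_monotone_noninc (R : realType) (a : nat -> R) (k : nat) :
  completely_monotone a -> a k.+1 <= a k.
Proof. by move=> ha; rewrite -subr_ge0; exact: (ha 1%N k). Qed.

Lemma noninc_seq_le (R : realType) (a : nat -> R) (m n : nat) :
  (forall k, a k.+1 <= a k) -> (m <= n)%N -> a n <= a m.
Proof.
move=> ha /subnK <-; elim: (n - m)%N => [//|k IH].
by rewrite addSn (le_trans (ha _)).
Qed.

(** If [a k] is the [k]-th moment of a measure on [[0, 1]], this is the
    integral of [(N x - s)^2 + N x (1 - x)], the second moment about [s] of a
    binomial variable with parameters [N] and [x].  Conditioning on one coin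
    toss reduces the case [N.+1] to the case [N] for the completely monotone
    sequences [E a] and [(I - E) a]. *)
Lemma binomial_second_moment_ge0 (R : realType) (N : nat) (s : R)
    (a : nat -> R) :
  completely_monotone a ->
  0 <= N%:R ^+ 2 * a 2 - 2 * N%:R * s * a 1 + s ^+ 2 * a 0
       + N%:R * (a 1 - a 2).
Proof.
elim: N s a => [|N IH] s a ha.
  have a0 := completely_monotone_ge0 0 ha.
  by rewrite !expr0n /= !(mulr0, mul0r) subr0 add0r addr0 mulr_ge0 ?sqr_ge0.
have H1 := IH (s - 1) _ (completely_monotone_shift ha).
have H2 := IH s _ (completely_monotone_subshift ha).
rewrite /subshift /= in H1 H2.
have := addr_ge0 H1 H2; congr (0 <= _).
rewrite -natr1; ring.
Qed.

(** The choice [s = N * a 1 / a 0] minimizes the quadratic part of the binomial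
    moment; its term of order [N ^ 2] must be nonnegative. *)
Lemma completely_monotone_log_convex_head (R : realType) (a : nat -> R) :
  completely_monotone a -> 0 < a 0%N -> a 1 ^+ 2 <= a 0 * a 2.
Proof.
move=> ha a0; rewrite leNgt; apply/negP => hlt.
set x := a 1 / a 0%N.
have hN N : 0 <= N.+1%:R * (a 2 - x * a 1) + (a 1 - a 2).
  rewrite -(pmulr_rge0 _ (ltr0Sn R N)).
  have := binomial_second_moment_ge0 N.+1 (N.+1%:R * x) ha.
  congr (0 <= _); rewrite /x; field; exact: lt0r_neq0.
have hneg : 0 < x * a 1 - a 2.
  rewrite subr_gt0 /x mulrAC -expr2 ltr_pdivlMr //; lra.
have [N hN'] : exists N : nat, (a 1 - a 2) / (x * a 1 - a 2) < N%:R.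
  by exists (Num.truncn ((a 1 - a 2) / (x * a 1 - a 2))).+1; exact: truncnS_gt.
have := hN N; rewrite ltr_pdivrMr // in hN'.
have : N%:R * (x * a 1 - a 2) <= N.+1%:R * (x * a 1 - a 2).
  by rewrite ler_wpM2r ?ler_nat// ltW.
lra.
Qed.

Lemma completely_monotone_log_convex (R : realType) (a : nat -> R) (k : nat) :
  completely_monotone a -> 0 < a k -> a k.+1 ^+ 2 <= a k * a k.+2.
Proof.
elim: k a => [|k IH] a ha ak; first exact: completely_monotone_log_convex_head.
exact: (IH _ (completely_monotone_shift ha)).
Qed.

Lemma log_convex_ratio (R : realType) (a : nat -> R) (m n : nat) :
  (forall k, 0 < a k) -> (forall k, a k.+1 ^+ 2 <= a k * a k.+2) ->
  (m <= n)%N -> a m.+1 * a n <= a m * a n.+1.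
Proof.
move=> ap lc mn.
have : {homo (fun k => a k.+1 / a k) : i j / (i <= j)%N >-> i <= j}.
  apply: homo_leq => [x|y x z|k]; [exact: lexx|exact: le_trans|].
  rewrite ler_pdivrMr ?ap// mulrAC ler_pdivlMr ?ap//.
  by rewrite -expr2 mulrC; exact: lc.
move=> /(_ m n mn); rewrite ler_pdivrMr ?ap// mulrAC ler_pdivlMr ?ap//.
by rewrite (mulrC (a n.+1)).
Qed.

Lemma conv_coefE (R : realType) (u v : nat -> R) (m n : nat) : (m <= n)%N ->
  conv u v m = ((\poly_(i < n.+1) u i) * (\poly_(i < n.+1) v i))`_m.
Proof.
move=> mn; rewrite coefM; apply: eq_bigr => i _; rewrite !coef_poly.
have im : (i <= m)%N by rewrite -ltnS.
by rewrite !ltnS (leq_trans im mn) (leq_trans (leq_subr _ _) mn).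
Qed.

Lemma convC (R : realType) (u v : nat -> R) : conv u v =1 conv v u.
Proof. by move=> n; rewrite !(conv_coefE _ _ (leqnn n)) mulrC. Qed.

Lemma convA (R : realType) (u v w : nat -> R) :
  conv u (conv v w) =1 conv (conv u v) w.
Proof.
move=> n; set P := fun x : nat -> R => \poly_(i < n.+1) x i.
have co (x : nat -> R) k : (k <= n)%N -> (P x)`_k = x k.
  by rewrite /P coef_poly ltnS => ->.
transitivity ((P u * (P v * P w))`_n).
  rewrite coefM; apply: eq_bigr => i _.
  by rewrite co ?leq_ord// (conv_coefE _ _ (leq_subr i n)).
rewrite mulrA coefM; apply: eq_bigr => i _.
by rewrite co ?leq_subr// -conv_coefE ?leq_ord.
Qed.

Lemma eq_conv (R : realType) (u u' v v' : nat -> R) :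
  u =1 u' -> v =1 v' -> conv u v =1 conv u' v'.
Proof. by move=> hu hv n; apply: eq_bigr => i _; rewrite hu hv. Qed.

Lemma conv_delta (R : realType) (u : nat -> R) : conv (@delta_d R) u =1 u.
Proof.
move=> n; rewrite /conv big_ord_recl /= subn0 /delta_d eqxx mul1r big1 ?addr0//.
by move=> i _; rewrite /= mul0r.
Qed.

(** The sum of the first [n.+1] terms is the convolution with the constant
    sequence 1, so it commutes with convolution. *)
Definition partial_sum (R : realType) (u : nat -> R) : nat -> R :=
  conv u (fun=> 1).

Lemma partial_sumE (R : realType) (u : nat -> R) (n : nat) :
  partial_sum u n = \sum_(j < n.+1) u j.
Proof. by apply: eq_bigr => i _; rewrite mulr1. Qed.

Lemma partial_sumS (R : realType) (u : nat -> R) (n : nat) :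
  partial_sum u n.+1 = partial_sum u n + u n.+1.
Proof. by rewrite !partial_sumE big_ord_recr. Qed.

Lemma partial_sum0 (R : realType) (u : nat -> R) : partial_sum u 0 = u 0%N.
Proof. by rewrite partial_sumE big_ord1. Qed.

Lemma conv_partial_sum_inverse (R : realType) (w a : nat -> R) :
  conv_inverse w a -> conv (partial_sum w) a =1 (fun=> 1).
Proof.
move=> hwa n; rewrite /partial_sum -convA.
rewrite (eq_conv (u' := w) (v' := conv a (fun=> 1)) _ (convC _ _))//.
by rewrite convA (eq_conv hwa (v' := fun=> 1))// conv_delta.
Qed.

(** Kaluza's theorem.  Comparing the recurrences for [w n] and [w n.+1]
    expresses [w n.+1 * (a 0 * a n)] through the [w j], [1 <= j <= n], with
    coefficients that log-convexity makes nonnegative. *)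
Lemma kaluza (R : realType) (w a : nat -> R) :
  conv_inverse w a -> (forall k, 0 < a k) ->
  (forall k, a k.+1 ^+ 2 <= a k * a k.+2) ->
  forall j, w j.+1 <= 0.
Proof.
move=> hwa ap lc.
have w0 : 0 < w 0%N.
  have := hwa 0%N; rewrite /conv big_ord1 /delta_d eqxx /= => h.
  by rewrite -(pmulr_lgt0 _ (ap 0%N)) h ltr01.
elim/ltn_ind => n IH.
have h n' : \sum_(j < n'.+1) w j.+1 * a (n' - j)%N = - (w 0%N * a n'.+1).
  have := hwa n'.+1; rewrite /conv big_ord_recl subn0 /delta_d /= => /eqP.
  by rewrite addr_eq0 => /eqP ->; rewrite opprK; apply: eq_bigr.
case: n IH => [|n] IH.
  have := h 0%N; rewrite big_ord1 /= => h0.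
  rewrite -(pmulr_lle0 _ (ap 0%N)) h0 oppr_le0 mulr_ge0// ltW//.
have := h n.+1; rewrite big_ord_recr /= subnn => h1.
rewrite -(pmulr_lle0 _ (ap 0%N)) -(pmulr_lle0 _ (ap n.+1)).
have -> : w n.+2 * a 0%N * a n.+1 =
    \sum_(j < n.+1) w j.+1 * (a (n - j)%N * a n.+2 - a (n.+1 - j)%N * a n.+1).
  rewrite (eq_bigr (fun j : 'I_n.+1 => w j.+1 * a (n - j)%N * a n.+2
     - w j.+1 * a (n.+1 - j)%N * a n.+1)); last by move=> j _; ring.
  rewrite sumrB -!mulr_suml (h n).
  move: h1; set S := \sum_(_ < _) _ => h1.
  have -> : w n.+2 * a 0%N = - (w 0%N * a n.+2) - S by rewrite -h1; ring.
  ring.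
apply: sumr_le0 => j _; rewrite mulr_le0_ge0 ?IH// subr_ge0.
have jn : (j <= n)%N by rewrite -ltnS.
rewrite (subSn jn); have := log_convex_ratio ap lc (leq_subr j n).
move=> h2; have h3 := log_convex_ratio ap lc (leq_trans (leq_subr j n) (leqnSn n)).
exact: h3.
Qed.

(** In the recurrence for [w n], replacing every [a k] by the smaller [a n]
    only decreases the size of the negative terms. *)
Lemma partial_sum_inverse_ge0 (R : realType) (w a : nat -> R) :
  conv_inverse w a -> (forall k, 0 < a k) -> (forall k, a k.+1 <= a k) ->
  (forall j, w j.+1 <= 0) -> forall n, 0 <= partial_sum w n.
Proof.
move=> hwa ap noninc hw n.
case: n => [|n].
  rewrite partial_sum0; have := hwa 0%N; rewrite /conv big_ord1 /delta_d eqxx /= => h.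
  by rewrite -(pmulr_lge0 _ (ap 0%N)) h ler01.
rewrite -(pmulr_lge0 _ (ap n.+1)) partial_sumE.
have h0 : 0 = conv w a n.+1 :> R by rewrite hwa.
rewrite [leLHS]h0 /conv mulr_suml; apply: ler_sum => j _.
have [j0|j0] := posnP j; first by rewrite j0 subn0.
rewrite -(prednK j0) ler_wnM2l ?hw//.
exact: noninc_seq_le noninc (leq_subr _ _).
Qed.

(** * Generating functions near 1 *)

Lemma near_right0P (R : realType) (P : R -> Prop) :
  (\forall h \near (0 : R)^'+, P h) <->
  exists2 d : R, 0 < d & forall h, 0 < h < d -> P h.
Proof.
split.
  case=> d /= d0 H; exists d => // h /andP[h0 hd].
  by apply: H => //; rewrite /ball /= sub0r normrN gtr0_norm.
move=> [d d0 H]; exists d => //= h; rewrite /ball /= sub0r normrN => hd h0.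
by apply: H; rewrite h0 -(gtr0_norm h0).
Qed.

Lemma cvg_right0P (R : realType) (f : R -> R) (l : R) :
  f h @[h --> 0^'+] --> l <->
  forall e : R, 0 < e ->
    exists2 d : R, 0 < d & forall h, 0 < h < d -> `|f h - l| <= e.
Proof.
split.
  move=> /cvgrPdist_le H e e0; have /near_right0P[d d0 hd] := H e e0.
  by exists d => // h /hd; rewrite distrC.
move=> H; apply/cvgrPdist_le => e e0; apply/near_right0P.
by have [d d0 hd] := H e e0; exists d => // h /hd; rewrite distrC.
Qed.

Lemma series_ordE (R : realType) (u : nat -> R) (n : nat) :
  series u n = \sum_(j < n) u j.
Proof. by rewrite /series /= big_mkord. Qed.

Lemma is_cvg_gen_fun (R : realType) (a : nat -> R) (C z : R) :
  (forall n, `|a n| <= C) -> 0 <= z < 1 ->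
  cvgn (series (fun n => a n * z ^+ n)).
Proof.
move=> aC /andP[z0 z1]; apply: normed_cvg.
have C0 : 0 <= C by apply: le_trans (aC 0%N).
apply: (@series_le_cvg _ _ (geometric C z)).
- by move=> n /=.
- by move=> n /=; rewrite mulr_ge0 ?exprn_ge0.
- by move=> n /=; rewrite normrM normrX (ger0_norm z0) ler_wpM2r ?exprn_ge0.
- by apply: is_cvg_geometric_series; rewrite ger0_norm.
Qed.

Lemma gen_fun_partial_le (R : realType) (a : nat -> R) (C z : R) (n : nat) :
  (forall k, 0 <= a k <= C) -> 0 <= z < 1 ->
  \sum_(j < n) a j * z ^+ j <= gen_fun a z.
Proof.
move=> aC hz; have /andP[z0 z1] := hz; rewrite -(series_ordE (fun j => a j * z ^+ j)).
apply: nondecreasing_cvgn_le.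
  apply/nondecreasing_seqP => k; rewrite !series_ordE big_ord_recr /= lerDl.
  by rewrite mulr_ge0 ?exprn_ge0//; have /andP[] := aC k.
by apply: (is_cvg_gen_fun (C := C)) hz => k; have /andP[a0 ?] := aC k; rewrite ger0_norm.
Qed.

Lemma gen_fun_le (R : realType) (a : nat -> R) (C z B : R) :
  (forall k, `|a k| <= C) -> 0 <= z < 1 ->
  (forall n, \sum_(j < n) a j * z ^+ j <= B) -> gen_fun a z <= B.
Proof.
move=> aC hz H; apply: limr_le; first exact: is_cvg_gen_fun aC hz.
by apply: nearW => n; rewrite series_ordE.
Qed.

Lemma gen_funB (R : realType) (a b : nat -> R) (C C' z : R) :
  (forall k, `|a k| <= C) -> (forall k, `|b k| <= C') -> 0 <= z < 1 ->
  gen_fun (fun k => a k - b k) z = gen_fun a z - gen_fun b z.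
Proof.
move=> aC bC hz; rewrite /gen_fun -lim_seriesB; last 2 first.
- exact: is_cvg_gen_fun aC hz.
- exact: is_cvg_gen_fun bC hz.
by congr (limn (series _)); apply/funext => n; rewrite /= mulrBl.
Qed.

Lemma gen_fun_one (R : realType) (z : R) : 0 <= z < 1 ->
  gen_fun (fun=> 1) z = (1 - z)^-1.
Proof.
move=> /andP[z0 z1]; apply/cvg_lim => //; rewrite -div1r.
by apply: cvg_geometric_series; rewrite ger0_norm.
Qed.

Lemma is_cvg_gen_fun_ge0 (R : realType) (a : nat -> R) (C z : R) :
  (forall k, 0 <= a k <= C) -> 0 <= z < 1 ->
  cvgn (series (fun n => a n * z ^+ n)).
Proof.
move=> aC; apply: (is_cvg_gen_fun (C := C)) => k.
by have /andP[a0 ?] := aC k; rewrite ger0_norm.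
Qed.

(** The truncated product polynomial has the coefficients of the convolution
    up to degree [n], and smaller ones from there on to degree [2 n]. *)
Lemma conv_sum_sandwich (R : realType) (u v : nat -> R) (z : R) (n : nat) :
  (forall k, 0 <= u k) -> (forall k, 0 <= v k) -> 0 <= z ->
  \sum_(m < n) conv u v m * z ^+ m <=
    (\sum_(i < n) u i * z ^+ i) * (\sum_(i < n) v i * z ^+ i) <=
  \sum_(m < n + n) conv u v m * z ^+ m.
Proof.
move=> u0 v0 z0.
set P := \poly_(i < n) u i; set Q := \poly_(i < n) v i.
have -> : \sum_(i < n) u i * z ^+ i = P.[z] by rewrite horner_poly.
have -> : \sum_(i < n) v i * z ^+ i = Q.[z] by rewrite horner_poly.
have sPQ : (size (P * Q)%R <= n + n)%N.
  rewrite (leq_trans (size_polyMleq _ _))// (leq_trans (leq_pred _))//.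
  by rewrite leq_add// size_poly.
have cP k : 0 <= P`_k <= u k by rewrite coef_poly; case: ifP => _; rewrite ?u0 ?lexx.
have cQ k : 0 <= Q`_k <= v k by rewrite coef_poly; case: ifP => _; rewrite ?v0 ?lexx.
have PQ0 m : 0 <= (P * Q)`_m.
  rewrite coefM; apply: sumr_ge0 => j _.
  by have /andP[? _] := cP j; have /andP[? _] := cQ (m - j)%N; rewrite mulr_ge0.
rewrite -hornerM (horner_coef_wide _ sPQ); apply/andP; split.
  rewrite big_split_ord /= -[leLHS]addr0; apply: lerD; last first.
    by apply: sumr_ge0 => j _; rewrite mulr_ge0 ?exprn_ge0.
  apply: ler_sum => m _; rewrite ler_wpM2r ?exprn_ge0// coefM.
  apply: ler_sum => j _; rewrite !coef_poly.
  by rewrite !ifT ?(leq_ltn_trans (leq_subr _ _)) ?(leq_ltn_trans (leq_ord j)).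
apply: ler_sum => m _; rewrite ler_wpM2r ?exprn_ge0// coefM.
apply: ler_sum => j _.
have /andP[? ?] := cP j; have /andP[? ?] := cQ (m - j)%N.
exact: ler_pM.
Qed.

Lemma gen_fun_conv (R : realType) (u v : nat -> R) (C C' C'' z : R) :
  (forall k, 0 <= u k <= C) -> (forall k, 0 <= v k <= C') ->
  (forall k, 0 <= conv u v k <= C'') -> 0 <= z < 1 ->
  gen_fun (conv u v) z = gen_fun u z * gen_fun v z.
Proof.
move=> uC vC wC hz; have /andP[z0 z1] := hz.
have cu := is_cvg_gen_fun_ge0 uC hz.
have cv := is_cvg_gen_fun_ge0 vC hz.
have cw := is_cvg_gen_fun_ge0 wC hz.
have u0 k : 0 <= u k by have /andP[] := uC k.
have v0 k : 0 <= v k by have /andP[] := vC k.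
have lim_mul : limn (series (fun n => u n * z ^+ n) \* series (fun n => v n * z ^+ n))
    = gen_fun u z * gen_fun v z.
  by apply/cvg_lim => //; exact: cvgM cu cv.
have cm : cvgn (series (fun n => u n * z ^+ n) \* series (fun n => v n * z ^+ n)).
  by apply/cvg_ex; exists (gen_fun u z * gen_fun v z); exact: cvgM cu cv.
have sand n := conv_sum_sandwich n u0 v0 z0.
apply/eqP; rewrite eq_le -lim_mul; apply/andP; split.
  apply: ler_lim => //; apply: nearW => n /=; rewrite !series_ordE.
  by have /andP[] := sand n.
apply: limr_le => //; apply: nearW => n /=; rewrite !series_ordE.
have /andP[_ h] := sand n; apply: (le_trans h).
exact: gen_fun_partial_le wC hz.
Qed.

(** * Upper bounds from the behaviour of the generating function *)

Lemma expRN_lt1 (R : realType) (h : R) : 0 < h -> 0 <= expR (- h) < 1.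
Proof. by move=> h0; rewrite expR_ge0 expR_lt1 oppr_lt0. Qed.

(** At the scale [h = 1 / n] the factors [expR (- j / n)], [j < n], are
    bounded below by [expR (- 1)]. *)
Lemma sum_le_pow_of_laplace (R : realType) (v : nat -> R) (C q l : R) :
  0 < q -> (forall k, 0 <= v k <= C) ->
  h `^ q * gen_fun v (expR (- h)) @[h --> 0^'+] --> l ->
  exists2 K : R, 0 < K & forall n, \sum_(j < n) v j <= K * n%:R `^ q.
Proof.
move=> q0 vC /cvg_right0P /(_ 1 ltr01)[d d0 hd].
have C0 : 0 <= C by have /andP[] := vC 0%N; exact: le_trans.
pose N := (Num.truncn d^-1).+1.
pose K := expR 1 * (`|l| + 1) + C * N%:R.
have K0 : 0 < K.
  by rewrite ltr_pwDl ?mulr_gt0 ?expR_gt0 ?mulr_ge0// ltr_wpDl.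
exists K => // -[|n]; first by rewrite big_ord0 mulr_ge0 ?powR_ge0// ltW.
have n1 : 1 <= n.+1%:R `^ q :> R.
  have e1 : 1 = 1 `^ q :> R by rewrite powR1.
  by rewrite [leLHS]e1 ge0_ler_powR ?nnegrE ?ler0n ?ler1n ?ltW.
have [nN|Nn] := leqP n.+1 N.
  apply: (@le_trans _ _ (C * N%:R)).
    apply: (@le_trans _ _ (\sum_(j < n.+1) C)).
      by apply: ler_sum => j _; have /andP[] := vC j.
    by rewrite sumr_const card_ord -[leLHS]mulr_natr ler_wpM2l ?ler_nat.
  rewrite -[leLHS]mulr1 ler_pM ?mulr_ge0//.
  by rewrite /K lerDr mulr_ge0 ?expR_ge0 ?addr_ge0.
set h := n.+1%:R^-1 : R.
have h0 : 0 < h by rewrite invr_gt0.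
have hd' : 0 < h < d.
  rewrite h0 /= /h -[d]invrK ltf_pV2 ?posrE ?invr_gt0//.
  apply: lt_trans (truncnS_gt _) _; rewrite ltr_nat; exact: Nn.
have hF : h `^ q * gen_fun v (expR (- h)) <= `|l| + 1.
  have := hd _ hd'; rewrite ler_norml => /andP[_]; rewrite lerBlDr => /le_trans; apply.
  by rewrite addrC lerD2r ler_norm.
have hz := expRN_lt1 h0.
have h1 : \sum_(j < n.+1) v j <= expR 1 * gen_fun v (expR (- h)).
  apply: (@le_trans _ _ (expR 1 * \sum_(j < n.+1) v j * expR (- h) ^+ j)); last first.
    by rewrite ler_wpM2l ?expR_ge0//; exact: gen_fun_partial_le vC hz.
  rewrite mulr_sumr; apply: ler_sum => j _.
  have /andP[vj _] := vC j.
  rewrite mulrCA ler_peMr// -expRM_natl -expRD -[leLHS]expR0 ler_expR.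
  rewrite mulrN subr_ge0 /h ler_pdivrMr ?ltr0Sn// mul1r ler_nat ltnW//.
apply: (le_trans h1); rewrite -ler_pdivrMr ?powR_gt0//.
apply: (@le_trans _ _ (expR 1 * (`|l| + 1))); last by rewrite /K lerDl mulr_ge0.
rewrite -mulrA ler_wpM2l ?expR_ge0// (le_trans _ hF)// mulrC ler_wpM2r//.
  apply: le_trans (gen_fun_partial_le 0 vC hz); by rewrite big_ord0.
by rewrite /h -powR_inv1 ?ler0n// -powRrM mulN1r powRN.
Qed.

(** Each of the first [n.+1] terms is at least [v n]. *)
Lemma noninc_le_pow (R : realType) (v : nat -> R) (K q : R) :
  (forall k, v k.+1 <= v k) ->
  (forall n, \sum_(j < n) v j <= K * n%:R `^ q) ->
  forall n, v n <= K * n.+1%:R `^ (q - 1).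
Proof.
move=> vN vK n; rewrite powRB; last by rewrite pnatr_eq0 implybT.
rewrite powRr1 ?ler0n// mulrA ler_pdivlMr ?ltr0Sn// (le_trans _ (vK _))//.
rewrite mulr_natr -[X in _ *+ X]card_ord -sumr_const; apply: ler_sum => j _.
by apply: noninc_seq_le vN _; rewrite -ltnS.
Qed.

(** A zero of [a] would make [a] vanish from there on, and its generating
    function would stay bounded near 1, against consistency. *)
Lemma completely_monotone_gt0 (R : realType) (alpha : R) (a : nat -> R) :
  0 < alpha -> completely_monotone a -> consistent alpha a ->
  forall k, 0 < a k.
Proof.
move=> al0 cm cons k; rewrite lt_neqAle completely_monotone_ge0// andbT eq_sym.
apply/negP => /eqP ak.
have noninc j : a j.+1 <= a j by exact: completely_monotone_noninc.
have az j : (k <= j)%N -> a j = 0.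
  move=> kj; apply/eqP; rewrite eq_le completely_monotone_ge0// andbT -ak.
  exact: noninc_seq_le.
have a0 j := completely_monotone_ge0 j cm.
have aC j : `|a j| <= a 0%N by rewrite ger0_norm//; exact: noninc_seq_le.
set S := \sum_(j < k) a j.
have FS h : 0 < h -> gen_fun a (expR (- h)) <= S.
  move=> h0; have hz := expRN_lt1 h0; have /andP[z0 z1] := hz.
  apply: (gen_fun_le aC) => // n.
  apply: (@le_trans _ _ (\sum_(j < n) a j)).
    by apply: ler_sum => j _; rewrite ler_piMr// exprn_ile1// ltW.
  have [nk|kn] := leqP n k.
    rewrite /S -(subnKC nk) big_split_ord /= lerDl; exact: sumr_ge0.
  rewrite -(subnKC (ltnW kn)) big_split_ord /= gerDl.
  by apply: sumr_le0 => j _; rewrite /= az// leq_addr.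
have : h `^ alpha * S @[h --> (0:R)^'+] --> 0 * S.
  by apply: cvgM; [exact: powR_cvg0|exact: cvg_cst].
rewrite mul0r => /cvg_right0P/(_ (4^-1))[|d d0 hd]; first by rewrite invr_gt0.
have /cvg_right0P/(_ (4^-1))[|e e0 he] := cons; first by rewrite invr_gt0.
pose h := Num.min d e / 2.
have m0 : 0 < Num.min d e by rewrite lt_min d0.
have hm : h < Num.min d e by rewrite /h ltr_pdivrMr// ltr_pMr// ltr1n.
have h0 : 0 < h by rewrite divr_gt0.
have := hd h; rewrite h0 (lt_le_trans hm) ?ge_min ?lexx// => /(_ isT).
have := he h; rewrite h0 (lt_le_trans hm) ?ge_min ?lexx ?orbT// => /(_ isT).
rewrite !ler_norml => /andP[h1 _] /andP[_ h2].
have : h `^ alpha * gen_fun a (expR (- h)) <= h `^ alpha * S.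
  by rewrite ler_wpM2l ?powR_ge0// FS.
lra.
Qed.

(** * A Tauberian theorem *)

Lemma laplace_scale (R : realType) (v : nat -> R) (q l c : R) :
  0 < c -> h `^ q * gen_fun v (expR (- h)) @[h --> 0^'+] --> l ->
  h `^ q * gen_fun v (expR (- (c * h))) @[h --> 0^'+] --> l / c `^ q.
Proof.
move=> c0 /cvg_right0P H; apply/cvg_right0P => e e0.
have cq : 0 < c `^ q by exact: powR_gt0.
have [d d0 hd] := H (e * c `^ q) (mulr_gt0 e0 cq).
exists (d / c); first exact: divr_gt0.
move=> h /andP[h0 hh].
have := hd (c * h); rewrite mulr_gt0//= mulrC -ltr_pdivlMr// => /(_ hh).
rewrite (mulrC h) (powRM _ (ltW c0) (ltW h0)) => {}H.
have -> : h `^ q * gen_fun v (expR (- (c * h))) - l / c `^ q =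
    (c `^ q)^-1 * (c `^ q * h `^ q * gen_fun v (expR (- (c * h))) - l).
  by field; rewrite lt0r_neq0.
rewrite normrM gtr0_norm ?invr_gt0// mulrC ler_pdivrMr//.
Qed.

Lemma horner_mulX_sum (R : realType) (Q : {poly R}) (x : R) :
  (Q * 'X).[x] = \sum_(k < size Q) Q`_k * x ^+ k.+1.
Proof.
rewrite hornerMX horner_coef mulr_suml; apply: eq_bigr => k _.
by rewrite exprSr mulrA.
Qed.

Lemma series_poly_cvg (R : realType) (D : nat -> R) (C z : R) (Q : {poly R}) :
  (forall k, `|D k| <= C) -> 0 <= z < 1 ->
  series (fun j => D j * (Q * 'X).[z ^+ j]) n @[n --> \oo] -->
    \sum_(k < size Q) Q`_k * gen_fun D (z ^+ k.+1).
Proof.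
move=> DC hz; have /andP[z0 z1] := hz.
rewrite (_ : series _ = (fun m => \sum_(j < m) D j *
    (\sum_(k < size Q) Q`_k * (z ^+ j) ^+ k.+1))); last first.
  apply/funext => m; rewrite series_ordE; apply: eq_bigr => j _.
  by rewrite horner_mulX_sum.
elim: (size Q) => [|n IH].
  rewrite big_ord0.
  rewrite (_ : (fun _ => _) = (fun=> 0)); first exact: cvg_cst.
  by apply/funext => m; rewrite big1// => j _; rewrite big_ord0 mulr0.
rewrite big_ord_recr /=.
rewrite (_ : (fun m => _) = (fun m => \sum_(j < m) D j * (\sum_(k < n) Q`_k * (z ^+ j) ^+ k.+1)
   + Q`_n * series (fun j => D j * (z ^+ n.+1) ^+ j) m)); last first.
  apply/funext => m; rewrite series_ordE mulr_sumr -big_split /=.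
  apply: eq_bigr => j _; rewrite big_ord_recr /= mulrDr -!exprM mulnC.
  by congr (_ + _); rewrite mulrCA.
apply: cvgD => //; apply: cvgM; first exact: cvg_cst.
apply: (is_cvg_gen_fun DC).
by rewrite exprn_ge0//= exprn_ilt1.
Qed.

Lemma laplace_poly_cvg0 (R : realType) (D : nat -> R) (q : R) (Q : {poly R}) :
  h `^ q * gen_fun D (expR (- h)) @[h --> 0^'+] --> 0 ->
  h `^ q * (\sum_(k < size Q) Q`_k * gen_fun D (expR (- h) ^+ k.+1))
    @[h --> 0^'+] --> 0.
Proof.
move=> H; elim: (size Q) => [|n IH].
  under eq_fun do rewrite big_ord0 mulr0.
  exact: cvg_cst.
under eq_fun do rewrite big_ord_recr /= mulrDr.
have H1 : h `^ q * (Q`_n * gen_fun D (expR (- h) ^+ n.+1)) @[h --> 0^'+] --> 0.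
  rewrite (_ : (fun h => _) =
    (fun h => Q`_n * (h `^ q * gen_fun D (expR (- (n.+1%:R * h)))))).
    have := cvgM (cvg_cst Q`_n) (laplace_scale (ltr0Sn R n) H).
    by rewrite mul0r mulr0; exact.
  by apply/funext => h; rewrite mulrCA -expRM_natl mulrN.
by have := cvgD IH H1; rewrite addr0; exact.
Qed.

Lemma one_sub_exp_le (R : realType) (y : R) (M : nat) : 0 <= y <= 1 ->
  1 - (1 - y) ^+ M <= M%:R * y.
Proof.
move=> /andP[y0 y1]; elim: M => [|M IH]; first by rewrite subrr mul0r.
have h : 0 <= (1 - y) ^+ M <= 1.
  by rewrite exprn_ge0 ?exprn_ile1 ?subr_ge0 ?gerBl.
rewrite exprS -natr1; nra.
Qed.

Lemma exp_one_sub_le (R : realType) (y : R) (M : nat) : 0 < y <= 1 ->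
  (0 < M)%N -> (1 - y) ^+ M <= (M%:R * y)^-1.
Proof.
move=> /andP[y0 y1] M0.
have My : 0 < M%:R * y by rewrite mulr_gt0// ltr0n.
apply: (@le_trans _ _ (expR (- y) ^+ M)).
  by rewrite lerXn2r ?nnegrE ?subr_ge0 ?expR_ge0//; exact: expR_ge1Dx.
rewrite -expRM_natl mulrN expRN lef_pV2 ?posrE ?expR_gt0//.
by rewrite (le_trans _ (expR_ge1Dx _))// lerDr.
Qed.

(** The polynomial [1 - (1 - x^N)^(2^N)] approximates the indicator function of
    [x > 1/2], since [(1 - y)^M] is at most [1 / (M y)] and at least [1 - M y],
    where [M y = (2 x)^N].  At [x = 2^(- j / n)] both errors are the same
    geometric sequence in the distance from [j] to [n]. *)
Lemma step_poly_error (R : realType) (N n j : nat) (h : R) :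
  0 < h -> n%:R * h = ln 2 ->
  `|(j < n)%N%:R - (1 - (1 - expR (- h) ^+ j ^+ N) ^+ (2 ^ N))|
    <= expR (- (N%:R * h)) ^+ ((n - j) + (j - n)).
Proof.
move=> h0 nh; set x := expR (- h) ^+ j; set y := x ^+ N.
have xE : x = expR (- (j%:R * h)) by rewrite /x -expRM_natl mulrN.
have hy : 0 < y <= 1.
  by rewrite exprn_gt0 ?exprn_ile1 ?exprn_ge0 ?exprn_gt0 ?expR_ge0 ?expR_gt0//
    expR_le1 oppr_le0 ltW.
have /andP[y0 y1] := hy.
have My : (2 ^ N)%:R * y = expR (N%:R * (n%:R - j%:R) * h).
  have -> : (2 ^ N)%:R = expR (n%:R * h) ^+ N :> R.
    by rewrite nh lnK ?posrE// natrX.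
  by rewrite /y xE -exprMn -expRD -expRM_natl -mulrA mulrBl.
have p1 : 0 <= (1 - y) ^+ (2 ^ N) <= 1.
  by rewrite exprn_ge0 ?exprn_ile1 ?subr_ge0 ?gerBl// ltW.
have /andP[p0 p2] := p1.
rewrite -expRM_natl; have [jn|nj] := ltnP j n.
  rewrite (eqP (ltnW jn : (j - n)%N == 0%N)) addn0 subKr ger0_norm//.
  apply: (le_trans (exp_one_sub_le hy _)); first by rewrite expn_gt0.
  rewrite My -expRN ler_expR natrB 1?ltnW// le_eqVlt; apply/orP; left.
  by apply/eqP; ring.
rewrite (eqP (nj : (n - j)%N == 0%N)) add0n sub0r normrN ger0_norm ?subr_ge0//.
apply: (le_trans (one_sub_exp_le _ _)); first by rewrite y1 ltW.
rewrite My ler_expR natrB// le_eqVlt; apply/orP; left.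
by apply/eqP; ring.
Qed.

Lemma geometric_sum_le (R : realType) (r : R) (n : nat) : 0 <= r < 1 ->
  \sum_(j < n) r ^+ j <= (1 - r)^-1.
Proof.
move=> /andP[r0 r1]; rewrite -[leRHS]mul1r ler_pdivlMr ?subr_gt0//.
rewrite mulrC -[1 - r]opprB mulNr -subrX1 opprB lerBlDr lerDl.
exact: exprn_ge0.
Qed.

Lemma two_sided_geometric_sum_le (R : realType) (r : R) (n M : nat) :
  0 <= r < 1 -> (n <= M)%N ->
  \sum_(j < M) r ^+ ((n - j) + (j - n)) <= 2 * (1 - r)^-1.
Proof.
move=> hr nM; have /andP[r0 r1] := hr.
rewrite -(subnKC nM) big_split_ord /= mulr_natl mulr2n; apply: lerD; last first.
  rewrite (eq_bigr (fun j : 'I__ => r ^+ j)); first exact: geometric_sum_le.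
  by move=> j _; rewrite addKn; congr (_ ^+ _); lia.
rewrite (reindex_inj rev_ord_inj) /=.
apply: (le_trans _ (geometric_sum_le n hr)); apply: ler_sum => j _.
have jn := ltn_ord j.
have -> : ((n - (n - j.+1)) + (n - j.+1 - n) = j.+1)%N by lia.
by rewrite exprSr ler_piMr ?exprn_ge0// ltW.
Qed.

Lemma inv_one_sub_expRN_le (R : realType) (x : R) : 0 < x ->
  (1 - expR (- x))^-1 <= 1 + x^-1.
Proof.
move=> x0; have x1 : 0 < 1 + x by rewrite addr_gt0.
have h : expR (- x) <= (1 + x)^-1.
  by rewrite expRN lef_pV2 ?posrE ?expR_gt0// expR_ge1Dx.
have -> : 1 + x^-1 = (1 - (1 + x)^-1)^-1.
  field; rewrite !lt0r_neq0//=; lra.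
rewrite lef_pV2 ?posrE ?subr_gt0 ?expR_lt1 ?oppr_lt0//; last by rewrite invf_lt1// ltrDl.
lra.
Qed.

(** The part [2 * j < n] is far from the threshold, and on the rest [D] has
    size [n `^ (- al)] and is summed against a two-sided geometric sequence. *)
Lemma step_poly_sum_error (R : realType) (D : nat -> R) (C al : R)
    (N n M : nat) (h : R) :
  0 < al < 1 -> (forall j, `|D j| <= C * j.+1%:R `^ (- al)) ->
  (forall n, \sum_(j < n) `|D j| <= C * n%:R `^ (1 - al)) ->
  (0 < N)%N -> (0 < n)%N -> (n <= M)%N ->
  n%:R * h = ln 2 ->
  `|\sum_(j < n) D j -
    \sum_(j < M) D j * (1 - (1 - expR (- h) ^+ j ^+ N) ^+ (2 ^ N))|
  <= n%:R `^ (1 - al) * (C * (4 / n%:R + 6 / (N%:R * ln 2))).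
Proof.
move=> /andP[al0 al1] DC DS N0 n0 nM nh.
have ln2 : 0 < ln 2 :> R by rewrite ln_gt0// ltr1n.
have n0' : 0 < n%:R :> R by rewrite ltr0n.
have N0' : 0 < N%:R :> R by rewrite ltr0n.
have h0 : 0 < h by rewrite -(pmulr_rgt0 _ n0') nh.
have C0 : 0 <= C.
  have := DC 0%N; rewrite powR1 mulr1; exact: le_trans.
set r := expR (- (N%:R * h)).
have Nh : 0 < N%:R * h by rewrite mulr_gt0.
have hr : 0 <= r < 1 by exact: expRN_lt1.
have /andP[r0 r1] := hr.
have nq : n%:R `^ (1 - al) = n%:R * n%:R `^ (- al) :> R.
  by rewrite powRD ?powRr1// pnatr_eq0 (gtn_eqF n0) implybT.
have -> : \sum_(j < n) D j = \sum_(j < M) D j * (j < n)%N%:R.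
  rewrite (big_ord_widen M (fun j => D j))// big_mkcond /=.
  by apply: eq_bigr => j _; case: ifP; rewrite ?mulr1 ?mulr0.
rewrite -sumrB; apply: (le_trans (ler_norm_sum _ _ _)).
apply: (@le_trans _ _ (\sum_(j < M) `|D j| * r ^+ ((n - j) + (j - n)))).
  apply: ler_sum => j _; rewrite -mulrBr normrM ler_wpM2l//.
  exact: step_poly_error.
rewrite (bigID (fun j : 'I_M => (j.*2 < n)%N)) /=.
apply: (@le_trans _ _ (2 / (N%:R * ln 2) * (C * n%:R `^ (1 - al)) +
   (C * (2 * n%:R `^ (- al))) * (2 * (1 + (N%:R * h)^-1)))); last first.
  have -> : h = ln 2 / n%:R by rewrite -nh mulrC mulKf ?lt0r_neq0.
  rewrite nq le_eqVlt; apply/orP; left; apply/eqP; field.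
  by rewrite !lt0r_neq0.
apply: lerD.
  apply: (@le_trans _ _ (2 / (N%:R * ln 2) * \sum_(j < n) `|D j|)); last first.
    by rewrite ler_wpM2l// divr_ge0// mulr_ge0// ltW.
  rewrite (big_ord_widen M (fun j => `|D j|))// mulr_sumr [leRHS]big_mkcond /=.
  rewrite big_mkcond /=; apply: ler_sum => j _.
  have c0 : 0 <= 2 / (N%:R * ln 2) * `|D j|.
    by rewrite mulr_ge0// divr_ge0// mulr_ge0// ltW.
  case: ifPn => jn; last by case: ifP.
  have jn' : (j < n)%N by lia.
  rewrite jn' mulrC ler_wpM2r// -expRM_natl mulrN expRN -invf_div.
  rewrite lef_pV2 ?posrE ?expR_gt0 ?divr_gt0 ?mulr_gt0//.
  apply: (@le_trans _ _ (((n - j) + (j - n))%N%:R * (N%:R * h))); last first.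
    by rewrite (le_trans _ (expR_ge1Dx _))// lerDr.
  rewrite ler_pdivrMr// -nh.
  have hk : n%:R <= ((n - j) + (j - n))%N%:R * 2 :> R.
    by rewrite -natrM ler_nat; lia.
  have := ler_wpM2l (ltW Nh) hk; lra.
apply: (@le_trans _ _ (\sum_(j < M) (C * (2 * n%:R `^ (- al))) * r ^+ ((n - j) + (j - n)))).
  rewrite big_mkcond; apply: ler_sum => j _.
  have c0 : 0 <= C * (2 * n%:R `^ (- al)) * r ^+ (n - j + (j - n)).
    by rewrite !mulr_ge0 ?powR_ge0 ?exprn_ge0.
  case: ifPn => // jn; rewrite ler_wpM2r ?exprn_ge0//.
  apply: (le_trans (DC j)); rewrite ler_wpM2l//.
  have hj : n%:R / 2 <= j.+1%:R :> R.
    by rewrite ler_pdivrMr// -natrM ler_nat; lia.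
  rewrite powRN; apply: (@le_trans _ _ ((n%:R / 2) `^ al)^-1).
    rewrite lef_pV2 ?posrE ?powR_gt0 ?divr_gt0//.
    by apply: ge0_ler_powR; rewrite ?nnegrE ?divr_ge0// ltW.
  rewrite powRM ?ler0n ?invr_ge0// invfM mulrC powRN.
  rewrite ler_wpM2r ?invr_ge0 ?powR_ge0// -powR_inv1// -powRrM mulN1r -powRN opprK.
  by rewrite -[leRHS]powRr1// ler_powR ?ler1n// ltW.
rewrite -mulr_sumr ler_wpM2l ?mulr_ge0 ?powR_ge0//.
apply: (le_trans (two_sided_geometric_sum_le hr nM)).
by rewrite ler_wpM2l//; exact: inv_one_sub_expRN_le.
Qed.

(** Hardy and Littlewood's Tauberian theorem, in Karamata's way: the sum of
    [D j] over [j < n] is compared with the sum of [D j * P (x_j)], where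
    [x_j = 2 ^ (- j / n)] and [P] is a polynomial close to the indicator
    function of [x > 1/2].  As [P] has no constant term, the latter sum is a
    combination of values of the generating function at powers of
    [2 ^ (- 1 / n)], which the hypothesis controls. *)
Lemma tauberian (R : realType) (D : nat -> R) (C al : R) :
  0 < al < 1 -> (forall j, `|D j| <= C * j.+1%:R `^ (- al)) ->
  (forall n, \sum_(j < n) `|D j| <= C * n%:R `^ (1 - al)) ->
  h `^ (1 - al) * gen_fun D (expR (- h)) @[h --> 0^'+] --> 0 ->
  forall e, 0 < e -> exists n0, forall n, (n0 <= n)%N ->
    `|\sum_(j < n) D j| <= e * n%:R `^ (1 - al).
Proof.
move=> hal DC DS Dlap e e0; have /andP[al0 al1] := hal.
have C0 : 0 <= C.
  have := DC 0%N; rewrite powR1 mulr1; exact: le_trans.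
have ln2 : 0 < ln 2 :> R by rewrite ln_gt0// ltr1n.
have DC' j : `|D j| <= C.
  apply: (le_trans (DC j)); rewrite ler_piMr// powRN invf_le1 ?powR_gt0//.
  have e1 : 1 = 1 `^ al :> R by rewrite powR1.
  by rewrite [leLHS]e1 ge0_ler_powR ?nnegrE ?ler0n ?ler1n ?ltW.
(* [N] and [n] make each of the two errors of the polynomial at most [e / 4]. *)
pose N := (Num.truncn (24 * C / (e * ln 2))).+1.
have hN : C * (6 / (N%:R * ln 2)) <= e / 4.
  have : 24 * C / (e * ln 2) < N%:R by exact: truncnS_gt.
  rewrite ltr_pdivrMr ?mulr_gt0// => hN.
  rewrite mulrA ler_pdivrMr ?mulr_gt0 ?ltr0Sn//; lra.
have [Q PQ] : exists Q : {poly R}, 1 - (1 - 'X^N) ^+ (2 ^ N) = Q * 'X.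
  have /factor_theorem[Q ->] : root (1 - (1 - 'X^N) ^+ (2 ^ N) : {poly R}) 0.
    rewrite /root !hornerE expr0n /= subr0 expr1n subrr//.
  by exists Q; rewrite subr0.
have hPQ x : (Q * 'X).[x] = 1 - (1 - x ^+ N) ^+ (2 ^ N).
  by rewrite -PQ !hornerE.
have e4 : 0 < e / 4 * ln 2 `^ (1 - al) by rewrite mulr_gt0 ?divr_gt0 ?powR_gt0.
have /cvg_right0P/(_ _ e4)[d d0 hd] := laplace_poly_cvg0 Q Dlap.
pose n0 := (maxn (Num.truncn (ln 2 / d)).+1 (Num.truncn (16 * C / e)).+1).
exists n0 => n; rewrite geq_max => /andP[n1 n2].
have np : (0 < n)%N by exact: leq_ltn_trans (leq0n _) n1.
have np' : 0 < n%:R :> R by rewrite ltr0n.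
pose h := ln 2 / n%:R : R.
have h0 : 0 < h by rewrite divr_gt0.
have hhd : h < d.
  rewrite /h ltr_pdivrMr// mulrC -ltr_pdivrMr//.
  by apply: lt_le_trans (truncnS_gt _) _; rewrite ler_nat.
have hn : C * (4 / n%:R) <= e / 4.
  have : 16 * C / e <= n%:R.
    by apply: ltW; apply: lt_le_trans (truncnS_gt _) _; rewrite ler_nat.
  rewrite ler_pdivrMr// => hn.
  rewrite mulrA ler_pdivrMr//; lra.
set ell := \sum_(k < size Q) Q`_k * gen_fun D (expR (- h) ^+ k.+1) in hd *.
have hell : `|ell| <= e / 4 * n%:R `^ (1 - al).
  have := hd h; rewrite h0 hhd => /(_ isT); rewrite subr0 normrM.
  rewrite (ger0_norm (powR_ge0 _ _)) /h (powRM _ (ltW ln2)) ?invr_ge0//.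
  have lq : 0 < ln 2 `^ (1 - al) :> R by exact: powR_gt0.
  have nq : 0 < n%:R `^ (1 - al) :> R by exact: powR_gt0.
  have -> : n%:R^-1 `^ (1 - al) = (n%:R `^ (1 - al))^-1 :> R.
    by rewrite -powR_inv1 ?ler0n// -powRrM mulN1r powRN.
  move=> H0; rewrite -ler_pdivrMr// -(ler_pM2r lq); apply: le_trans H0.
  by rewrite le_eqVlt; apply/orP; left; apply/eqP; ring.
have hE : `|\sum_(j < n) D j - ell| <=
    n%:R `^ (1 - al) * (C * (4 / n%:R + 6 / (N%:R * ln 2))).
  have cv := series_poly_cvg (Q := Q) DC' (expRN_lt1 h0).
  have cv' : (fun M => `|\sum_(j < n) D j - series (fun j => D j * (Q * 'X).[expR (- h) ^+ j]) M|)
     @ \oo --> `|\sum_(j < n) D j - ell|.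
    by apply: cvg_norm; apply: cvgB => //; exact: cvg_cst.
  rewrite -(cvg_lim _ cv')//; apply: limr_le.
    by apply/cvg_ex; exists (`|\sum_(j < n) D j - ell|).
  exists n => // M /= nM; rewrite series_ordE.
  under [X in _ - X]eq_bigr do rewrite hPQ.
  by apply: (step_poly_sum_error hal DC DS) => //; rewrite mulrC divfK ?lt0r_neq0.
have : `|\sum_(j < n) D j| <= `|\sum_(j < n) D j - ell| + `|ell|.
  by rewrite -[X in `|X|](subrK ell) ler_normD.
move=> /le_trans; apply; apply: (le_trans (lerD hE hell)).
rewrite mulrC -mulrDl ler_wpM2r ?powR_ge0// mulrDr; lra.
Qed.

(** * Integrals of power functions *)

(** Exhausting [`]a, b[] by compact intervals makes the fundamental theorem
    available for integrands that blow up at the endpoints. *)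
Lemma ge0_FTC2_oo_ereal (R : realType) (f F : R -> R) (a b : R) : a < b ->
  (forall x, a < x < b -> 0 <= f x) ->
  (forall x, a < x < b -> {for x, continuous f}) ->
  (forall x, a < x < b -> is_derive x (1 : R) F (f x)) ->
  F @ a^'+ --> F a -> F @ b^'- --> F b ->
  (\int[@lebesgue_measure R]_(x in `]a, b[) (f x)%:E = (F b - F a)%:E)%E.
Proof.
move=> ab f0 cf dFx Fa Fb.
pose c n : R := (b - a) / n.+3%:R.
have c0 n : 0 < c n by rewrite divr_gt0 ?subr_gt0.
have c3 n : c n * 3 <= b - a.
  rewrite /c mulrAC ler_pdivrMr// ler_wpM2l ?ler_nat// subr_ge0 ltW//.
have c_dec n : c n.+1 <= c n.
  by rewrite /c ler_wpM2l ?subr_ge0 ?ltW// ?ltf_pV2 ?posrE ?ltr_nat// ltW.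
have cl : c n @[n --> \oo] --> (0 : R).
  rewrite -(mulr0 (b - a)); apply: cvgM; first exact: cvg_cst.
  have := @cvg_harmonic R; rewrite -(cvg_shiftn 2) /=.
  by apply: cvg_trans; apply: near_eq_cvg; apply: nearW => n /=; rewrite addn2.
pose S n := `[a + c n, b - c n]%classic.
have Sab n x : S n x -> a < x < b.
  rewrite /S /= in_itv /= => /andP[h1 h2]; have := c0 n => h.
  by apply/andP; split; lra.
have abU : `]a, b[%classic = \bigcup_n S n.
  apply/seteqP; split => x /=; rewrite in_itv /=; last first.
    by move=> [n _ /Sab].
  move=> /andP[ax xb].
  have [n hn] : exists n, c n <= Num.min (x - a) (b - x).
    have m0 : 0 < Num.min (x - a) (b - x) by rewrite lt_min !subr_gt0 ax.
    have /cvgrPdist_le/(_ _ m0)[n _ hn] := cl.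
    exists n; have := hn n (leqnn n); rewrite sub0r normrN ger0_norm//.
    exact: ltW.
  exists n => //; rewrite /S /= in_itv /=; move: hn; rewrite le_min => /andP[h1 h2].
  by apply/andP; split; lra.
have cS n : {within S n, continuous f}.
  apply: continuous_in_subspaceT => x; rewrite inE => /Sab xab.
  exact: cf.
have cF x : a < x < b -> {for x, continuous F}.
  move=> /dFx [h _]; exact/differentiable_continuous/derivable1_diffP.
have IS n : (\int[@lebesgue_measure R]_(x in S n) (f x)%:E =
    (F (b - c n) - F (a + c n))%:E)%E.
  have h3 := c3 n; have h0 := c0 n.
  rewrite EFinB; apply: continuous_FTC2.
  - lra.
  - exact: cS.
  - split.
    + move=> x; rewrite in_itv /= => /andP[h1 h2].
      have [] // := dFx x; apply/andP; split; lra.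
    + apply: cvg_at_right_filter; apply: cF; apply/andP; split; lra.
    + apply: cvg_at_left_filter; apply: cF; apply/andP; split; lra.
  - move=> x; rewrite in_itv /= => /andP[h1 h2].
    have [] // := dFx x; first by apply/andP; split; lra.
    by move=> _; rewrite -derive1E.
have mS n : measurable (S n) by exact: measurable_itv.
have : (\int[@lebesgue_measure R]_(x in S n) (f x)%:E @[n --> \oo] -->
    \int[@lebesgue_measure R]_(x in \bigcup_n S n) (f x)%:E)%E.
  apply: ge0_nondecreasing_set_cvg_integral => //.
  - apply/nondecreasing_seqP => n; rewrite subsetEset => x.
    rewrite /S /= !in_itv /= => /andP[h1 h2]; have := c_dec n => h.
    by apply/andP; split; lra.
  - move=> n; apply/measurable_EFinP.
    by apply: subspace_continuous_measurable_fun => //; exact: cS.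
  - by move=> n x /Sab xab; rewrite lee_fin f0.
rewrite -abU => h1.
have : ((F (b - c n) - F (a + c n))%:E @[n --> \oo] --> (F b - F a)%:E)%E.
  apply: cvg_EFin; first exact: nearW.
  apply: cvgB.
    apply: (proj1 (cvg_at_leftP _ _ _) Fb); split; first by move=> n; rewrite gtrBl.
    by have := cvgB (cvg_cst b) cl; rewrite subr0; exact.
  apply: (proj1 (cvg_at_rightP _ _ _) Fa); split; first by move=> n; rewrite ltrDl.
  by have := cvgD (cvg_cst a) cl; rewrite addr0; exact.
rewrite (funext IS) in h1; move=> h2.
exact: (cvg_unique _ h1 h2).
Qed.

Lemma ge0_FTC2_oo (R : realType) (f F : R -> R) (a b : R) : a < b ->
  (forall x, a < x < b -> 0 <= f x) ->
  (forall x, a < x < b -> {for x, continuous f}) ->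
  (forall x, a < x < b -> is_derive x (1 : R) F (f x)) ->
  F @ a^'+ --> F a -> F @ b^'- --> F b ->
  (@lebesgue_measure R).-integrable `]a, b[ (EFin \o f) /\
  \int[@lebesgue_measure R]_(x in `]a, b[) f x = F b - F a.
Proof.
move=> ab f0 cf dF Fa Fb.
have h := ge0_FTC2_oo_ereal ab f0 cf dF Fa Fb.
split; last by rewrite /Rintegral h.
apply/integrableP; split.
  apply/measurable_EFinP; apply: open_continuous_measurable_fun => //.
  by move=> x; rewrite inE /= in_itv /=; exact: cf.
rewrite [ltLHS](_ : _ = (F b - F a)%:E)%E ?ltry// -h.
apply: eq_integral => x; rewrite inE /= in_itv /= => hx.
by rewrite ger0_norm ?f0.
Qed.

Lemma continuous_powR (R : realType) (p x : R) : 0 < x ->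
  {for x, continuous (fun s => s `^ p)}.
Proof.
move=> x0; have [h _] := is_derive1_powR p x0.
exact/differentiable_continuous/derivable1_diffP.
Qed.

Lemma powR_cvg_right (R : realType) (p a : R) : 0 < p -> 0 <= a ->
  s `^ p @[s --> a^'+] --> a `^ p.
Proof.
move=> p0; rewrite le_eqVlt => /predU1P[<-|a0].
  by rewrite powR0 ?gt_eqF//; exact: powR_cvg0.
by apply: cvg_at_right_filter; exact: continuous_powR.
Qed.

Lemma integral_powR_oo (R : realType) (p a b : R) : 0 < p -> 0 <= a < b ->
  (@lebesgue_measure R).-integrable `]a, b[ (EFin \o (fun s => s `^ (p - 1))) /\
  \int[@lebesgue_measure R]_(s in `]a, b[) (s `^ (p - 1)) =
    (b `^ p - a `^ p) / p.
Proof.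
move=> p0 /andP[a0 ab]; have b0 : 0 < b by exact: le_lt_trans ab.
have pos x : a < x < b -> 0 < x by move=> /andP[ax _]; exact: le_lt_trans ax.
have Fd x : a < x < b ->
    is_derive x (1 : R) (fun s => p^-1 * s `^ p) (x `^ (p - 1)).
  move=> /pos x0; have h := is_derive1_powR p x0.
  have -> : x `^ (p - 1) = p^-1 *: (p * x `^ (p - 1)).
    by rewrite /GRing.scale /= mulKf ?gt_eqF.
  exact: is_deriveZ.
have [] := @ge0_FTC2_oo R (fun s => s `^ (p - 1)) (fun s => p^-1 * s `^ p) a b ab.
- by move=> x _; exact: powR_ge0.
- by move=> x /pos; exact: continuous_powR.
- by apply: cvgM; [exact: cvg_cst|exact: powR_cvg_right].
- apply: cvgM; [exact: cvg_cst|].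
  by apply: cvg_at_left_filter; exact: continuous_powR.
by move=> h1 ->; split => //; rewrite -mulrBr mulrC.
Qed.

Lemma is_derive_kernel (R : realType) (p t x : R) : x < t ->
  is_derive x (1 : R) (fun s => (t - s) `^ p) (- (p * (t - x) `^ (p - 1))).
Proof.
move=> xt; have h := @is_derive1_powR _ p (t - x); rewrite subr_gt0 in h.
have dsub : is_derive x (1 : R) (fun s => t - s) (- 1).
  by rewrite -[X in is_derive _ _ _ X]sub0r; exact: is_deriveB.
have := is_derive1_comp (g := fun s => t - s) (h xt) dsub.
by rewrite mulrN1.
Qed.

Lemma continuous_kernel (R : realType) (p t x : R) : x < t ->
  {for x, continuous (fun s => (t - s) `^ p)}.
Proof.
move=> /(is_derive_kernel p)[h _].
exact/differentiable_continuous/derivable1_diffP.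
Qed.

Lemma integral_kernel_oo (R : realType) (p a b t : R) : 0 < p ->
  a < b <= t ->
  (@lebesgue_measure R).-integrable `]a, b[
    (EFin \o (fun s => (t - s) `^ (p - 1))) /\
  \int[@lebesgue_measure R]_(s in `]a, b[) ((t - s) `^ (p - 1)) =
    ((t - a) `^ p - (t - b) `^ p) / p.
Proof.
move=> p0 /andP[ab bt].
have pos x : a < x < b -> x < t by move=> /andP[_ xb]; exact: lt_le_trans bt.
have Fd x : a < x < b ->
    is_derive x (1 : R) (fun s => - p^-1 * (t - s) `^ p) ((t - x) `^ (p - 1)).
  move=> /pos xt; have h := is_derive_kernel p xt.
  have -> : (t - x) `^ (p - 1) = - p^-1 *: (- (p * (t - x) `^ (p - 1))).
    by rewrite /GRing.scale /= mulrNN mulKf ?gt_eqF.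
  exact: is_deriveZ.
have [] := @ge0_FTC2_oo R (fun s => (t - s) `^ (p - 1)) (fun s => - p^-1 * (t - s) `^ p) a b ab.
- by move=> x _; exact: powR_ge0.
- by move=> x /pos; exact: continuous_kernel.
- apply: cvgM; [exact: cvg_cst|].
  by apply: cvg_at_right_filter; apply: continuous_kernel; exact: lt_le_trans bt.
- apply: cvgM; [exact: cvg_cst|].
  move: bt; rewrite le_eqVlt => /predU1P[<-|bt]; last first.
    by apply: cvg_at_left_filter; exact: continuous_kernel.
  rewrite subrr; apply/cvg_at_leftP => u [ub ul].
  apply: (proj1 (cvg_at_rightP (fun s => s `^ p) 0 (0 `^ p)) _ (fun n => b - u n)).
    exact: powR_cvg_right.
  split; first by move=> n; rewrite subr_gt0.
  by have := cvgB (cvg_cst b) ul; rewrite subrr; exact.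
move=> h1 ->; split => //; rewrite !mulNr opprK addrC -mulrBr mulrC//.
Qed.

(** * Splitting and comparing integrals *)

Lemma Rintegral_oo_split (R : realType) (phi : R -> R) (a b c : R) :
  a <= b -> b <= c ->
  (@lebesgue_measure R).-integrable `]a, c[ (EFin \o phi) ->
  \int[@lebesgue_measure R]_(s in `]a, c[) phi s =
  \int[@lebesgue_measure R]_(s in `]a, b[) phi s +
  \int[@lebesgue_measure R]_(s in `]b, c[) phi s.
Proof.
move=> ab; rewrite le_eqVlt => /predU1P[->|bc] hi.
  by rewrite [X in _ + X](_ : _ = 0) ?addr0// set_itv_ge ?bnd_simp ?lexx// Rintegral_set0.
have hab : (@lebesgue_measure R).-integrable `]a, b[ (EFin \o phi).
  apply: integrableS hi => //; apply: subset_itvl; rewrite bnd_simp; exact: ltW.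
have /(_ _ _)h := @Rintegral_itvB R phi (BRight a) (BLeft c) b hi.
rewrite -(h _ _) ?bnd_simp//.
by rewrite (Rintegral_itv_bndo_bndc hab) addrC subrK.
Qed.

Lemma Rintegral_oo_sum (R : realType) (phi : R -> R) (x : nat -> R) (m : nat) :
  (forall i, x i <= x i.+1) ->
  (@lebesgue_measure R).-integrable `]x 0%N, x m[ (EFin \o phi) ->
  \int[@lebesgue_measure R]_(s in `]x 0%N, x m[) phi s =
  \sum_(i < m) \int[@lebesgue_measure R]_(s in `]x i, x i.+1[) phi s.
Proof.
move=> hx; have mono : {homo x : i j / (i <= j)%N >-> i <= j}.
  by apply: homo_leq => [y|y z w|]; [exact: lexx|exact: le_trans|].
elim: m => [|m IH] hi.
  by rewrite big_ord0 set_itv_ge ?bnd_simp ?ltxx// Rintegral_set0.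
rewrite big_ord_recr /= -IH; first exact: Rintegral_oo_split (mono _ _ _) (hx m) hi.
by apply: integrableS hi => //; apply: subset_itvl; rewrite bnd_simp; exact: hx.
Qed.

Lemma Rintegral_between (R : realType) (phi k : R -> R) (D : set R)
    (c1 c2 : R) :
  measurable D ->
  (@lebesgue_measure R).-integrable D (EFin \o phi) ->
  (@lebesgue_measure R).-integrable D (EFin \o k) ->
  (forall s, D s -> c1 * k s <= phi s <= c2 * k s) ->
  c1 * \int[@lebesgue_measure R]_(s in D) k s <=
    \int[@lebesgue_measure R]_(s in D) phi s <=
  c2 * \int[@lebesgue_measure R]_(s in D) k s.
Proof.
move=> mD hphi hk hb.
have hc c : (@lebesgue_measure R).-integrable D (EFin \o (fun s => c * k s)).
  rewrite (_ : _ \o _ = (fun s => c%:E * (EFin \o k) s)%E); first exact: integrableZl.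
  by apply/funext => s /=; rewrite EFinM.
rewrite -!RintegralZl//; apply/andP; split; apply: le_Rintegral => // s /hb /andP[] //.
Qed.

(** * The weights of the kernel and the Gamma function *)

(** The integral of [s `^ (- al)] over [`]j, j.+1[]. *)
Definition kernel_weight (R : realType) (al : R) (j : nat) : R :=
  (j.+1%:R `^ (1 - al) - j%:R `^ (1 - al)) / (1 - al).

Lemma sum_kernel_weight (R : realType) (al : R) (n : nat) : al < 1 ->
  \sum_(j < n) kernel_weight al j = n%:R `^ (1 - al) / (1 - al).
Proof.
move=> al1; rewrite -mulr_suml; congr (_ / _).
elim: n => [|n IH]; first by rewrite big_ord0 powR0// gt_eqF ?subr_gt0.
by rewrite big_ord_recr /= IH addrC subrK.
Qed.

(** It amounts to [j * j.+1 `^ (p - 1) <= j `^ p]. *)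
Lemma powR_succ_sub_le (R : realType) (p : R) (j : nat) : 0 < p < 1 ->
  j.+1%:R `^ p - j%:R `^ p <= j.+1%:R `^ (p - 1) :> R.
Proof.
move=> /andP[p0 p1].
have -> : j.+1%:R `^ p = j.+1%:R * j.+1%:R `^ (p - 1) :> R.
  by rewrite mulr_powRB1 ?ler0n.
set A := _ `^ (p - 1).
rewrite -[j.+1%:R]natr1 mulrDl mul1r addrAC gerDr subr_le0 /A.
have [->|j0] := posnP j; first by rewrite mul0r powR_ge0.
rewrite -(@mulr_powRB1 _ j%:R) ?ler0n// ler_wpM2l ?ler0n//.
rewrite -[p - 1]opprB !powRN lef_pV2 ?posrE ?powR_gt0 ?ltr0n//.
by apply: ge0_ler_powR; rewrite ?nnegrE ?ler0n ?ler_nat// subr_ge0 ltW.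
Qed.

Lemma kernel_weight_ge0 (R : realType) (al : R) (j : nat) : al < 1 ->
  0 <= kernel_weight al j.
Proof.
move=> al1; rewrite /kernel_weight divr_ge0 ?subr_ge0 ?(ltW al1)//.
by apply: ge0_ler_powR; rewrite ?nnegrE ?ler0n ?ler_nat// subr_ge0 ltW.
Qed.

Lemma kernel_weight_le (R : realType) (al : R) (j : nat) : 0 < al < 1 ->
  kernel_weight al j <= j.+1%:R `^ (- al) / (1 - al).
Proof.
move=> /andP[al0 al1]; rewrite ler_wpM2r ?invr_ge0 ?subr_ge0 ?(ltW al1)//.
rewrite (_ : _ `^ (- al) = j.+1%:R `^ (1 - al - 1)); last by congr (_ `^ _); ring.
by apply: powR_succ_sub_le; rewrite subr_gt0 al1 gtrBl.
Qed.

Lemma kernel_weight_scale (R : realType) (al h : R) (j : nat) : 0 <= h ->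
  h `^ (1 - al) * kernel_weight al j =
  ((j.+1%:R * h) `^ (1 - al) - (j%:R * h) `^ (1 - al)) / (1 - al).
Proof.
move=> h0; rewrite /kernel_weight !powRM ?ler0n//; ring.
Qed.

Lemma kernel_weight_bounded (R : realType) (al : R) (j : nat) : 0 < al < 1 ->
  0 <= kernel_weight al j <= (1 - al)^-1.
Proof.
move=> hal; have /andP[al0 al1] := hal; rewrite kernel_weight_ge0//=.
apply: (le_trans (kernel_weight_le j hal)).
rewrite ler_piMl ?invr_ge0 ?subr_ge0 ?(ltW al1)// powRN invf_le1 ?powR_gt0//.
have e1 : 1 = 1 `^ al :> R by rewrite powR1.
by rewrite [leLHS]e1; apply: ge0_ler_powR; rewrite ?nnegrE ?ler0n ?ler1n// ltW.
Qed.

(** Both bounds come from replacing [expR (- s)] on each cell of length [h]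
    by its values at the endpoints. *)
Lemma Gamma_between (R : realType) (al h : R) : 0 < al < 1 -> 0 < h ->
  expR (- h) * (h `^ (1 - al) * gen_fun (@kernel_weight R al) (expR (- h)))
    <= Gamma (1 - al) <=
  h `^ (1 - al) * gen_fun (@kernel_weight R al) (expR (- h)).
Proof.
move=> hal h0; have /andP[al0 al1] := hal.
set mu := @lebesgue_measure R.
have q0 : 0 < 1 - al by rewrite subr_gt0.
pose f s := s `^ (1 - al - 1) * expR (- s).
pose x n : R := n%:R * h.
have x0 : x 0%N = 0 by rewrite /x mul0r.
have xlt i : x i < x i.+1 by rewrite /x ltr_pM2r// ltr_nat.
have xge i : 0 <= x i by rewrite mulr_ge0// ltW.
have mf D : measurable D -> measurable_fun D f.
  move=> mD; apply: measurable_funTS; apply: measurable_funM.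
    exact: measurable_powR.
  apply: measurableT_comp; first exact: measurable_expR.
  by apply: continuous_measurable_fun; exact: opp_continuous.
have ip a b : 0 <= a < b -> mu.-integrable `]a, b[ (EFin \o (fun s => s `^ (1 - al - 1))).
  by move=> hab; have [] := integral_powR_oo q0 hab.
have iff b : 0 < b -> mu.-integrable `]0, b[ (EFin \o f).
  move=> b0; apply: (le_integrable _ _ _ (ip 0 b _)) => //=; last by rewrite lexx.
    by apply/measurable_EFinP; exact: mf.
  move=> s; rewrite in_itv /= => /andP[s0 sb]; rewrite lee_fin /f normrM.
  rewrite ler_piMr// ger0_norm ?expR_ge0// expR_le1 oppr_le0; exact: ltW.
pose I n := \int[mu]_(s in `]0, x n[) f s.
pose P n := h `^ (1 - al) * \sum_(j < n) kernel_weight al j * expR (- h) ^+ j.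
have i0 n : mu.-integrable `]0, x n[ (EFin \o f).
  case: n => [|n]; last by apply: iff; rewrite mulr_gt0.
  by rewrite x0 set_itv_ge ?bnd_simp ?ltxx//; exact: integrable_set0.
have cell j : expR (- h) * (h `^ (1 - al) * (kernel_weight al j * expR (- h) ^+ j))
    <= \int[mu]_(s in `]x j, x j.+1[) f s <=
    h `^ (1 - al) * (kernel_weight al j * expR (- h) ^+ j).
  have hj : 0 <= x j < x j.+1 by rewrite xge xlt.
  have [i1 i2] := integral_powR_oo q0 hj.
  have ifj : mu.-integrable `]x j, x j.+1[ (EFin \o f).
    apply: (integrableS _ _ _ (i0 j.+1)) => //; apply: subset_itvr.
    by rewrite bnd_simp.
  have e1 : expR (- h) ^+ j = expR (- x j) by rewrite -expRM_natl mulrN.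
  have e2 : expR (- h) * expR (- h) ^+ j = expR (- x j.+1).
    by rewrite -exprS -expRM_natl mulrN.
  have := @Rintegral_between R f (fun s => s `^ (1 - al - 1)) `]x j, x j.+1[%classic
     (expR (- x j.+1)) (expR (- x j)) (measurable_itv _) ifj i1.
  rewrite i2 -kernel_weight_scale ?(ltW h0)// -e1 -e2 => H.
  have {}H := H _; rewrite (_ : expR (- h) * (_ * (_ * _)) =
     expR (- h) * expR (- h) ^+ j * (h `^ (1 - al) * kernel_weight al j)); last by ring.
  rewrite (_ : h `^ (1 - al) * (_ * _) =
     expR (- h) ^+ j * (h `^ (1 - al) * kernel_weight al j)); last by ring.
  apply: H => s /=; rewrite in_itv /= => /andP[s1 s2]; rewrite e2 e1 /f.
  by rewrite ![_ * s `^ _]mulrC !ler_wpM2l ?powR_ge0// ler_expR lerN2 ltW.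
have IE n : I n = \sum_(j < n) \int[mu]_(s in `]x j, x j.+1[) f s.
  rewrite /I -[in LHS]x0; apply: Rintegral_oo_sum; first by move=> i; exact: ltW.
  by rewrite x0.
have IP n : expR (- h) * P n <= I n <= P n.
  rewrite IE /P !mulr_sumr; apply/andP; split; apply: ler_sum => j _.
    by have /andP[] := cell j.
  by have /andP[] := cell j.
have hz := expRN_lt1 h0.
have wb j := kernel_weight_bounded j hal.
have Pl : P n @[n --> \oo] --> h `^ (1 - al) * gen_fun (@kernel_weight R al) (expR (- h)).
  apply: cvgM; first exact: cvg_cst.
  have := is_cvg_gen_fun_ge0 wb hz; rewrite -/(gen_fun _ _).
  rewrite (_ : series _ = (fun n => \sum_(j < n) kernel_weight al j * expR (- h) ^+ j))//.
  by apply/funext => n; rewrite series_ordE.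
have Ind : nondecreasing_seq I.
  apply/nondecreasing_seqP => n; rewrite !IE big_ord_recr /= lerDl.
  by apply: Rintegral_ge0 => s _; rewrite /f mulr_ge0 ?powR_ge0 ?expR_ge0.
have Il : cvgn I.
  apply: nondecreasing_is_cvgn => //.
  exists (h `^ (1 - al) * gen_fun (@kernel_weight R al) (expR (- h))) => _ [n _ <-].
  have /andP[_ /le_trans] := IP n; apply.
  by rewrite ler_wpM2l ?powR_ge0//; exact: gen_fun_partial_le wb hz.
have GI : Gamma (1 - al) = limn I.
  pose S n := `]0, x n[%classic.
  have Ecv : (\int[mu]_(s in S n) (f s)%:E @[n --> \oo] -->
    \int[mu]_(s in \bigcup_n S n) (f s)%:E)%E.
    apply: ge0_nondecreasing_set_cvg_integral => //.
    - apply/nondecreasing_seqP => n; rewrite subsetEset; apply: subset_itvl.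
      by rewrite bnd_simp; exact: ltW.
    - by move=> n; exact: measurable_itv.
    - by move=> n; apply/measurable_EFinP; apply: mf; exact: measurable_itv.
    - by move=> n s _; rewrite lee_fin /f mulr_ge0 ?powR_ge0 ?expR_ge0.
  have UE : \bigcup_n S n = `]0, +oo[%classic.
    apply/seteqP; split => s /=; rewrite in_itv /= ?andbT.
      by move=> [n _]; rewrite /S /= in_itv /= => /andP[].
    move=> s0; exists (Num.truncn (s / h)).+1 => //=; rewrite /S /= in_itv /= s0 /=.
    by rewrite /x -ltr_pdivrMr//; exact: truncnS_gt.
  rewrite UE in Ecv.
  have E1 : (fun n => \int[mu]_(s in S n) (f s)%:E)%E = (fun n => (I n)%:E).
    apply/funext => n; rewrite /I /Rintegral fineK//.
    by have := integrable_fin_num _ (i0 n); apply.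
  rewrite E1 in Ecv.
  have Ecv' : ((I n)%:E @[n --> \oo] --> (limn I)%:E)%E.
    by apply: cvg_EFin; [exact: nearW|].
  by rewrite /Gamma /Rintegral -/mu (cvg_unique _ Ecv Ecv').
rewrite GI; apply/andP; split.
  have L : expR (- h) * P n @[n --> \oo] --> expR (- h) *
      (h `^ (1 - al) * gen_fun (@kernel_weight R al) (expR (- h))).
    by apply: cvgM => //; exact: cvg_cst.
  rewrite -(cvg_lim _ L)//; apply: ler_lim => //.
    by apply/cvg_ex; eexists; exact: L.
  by apply: nearW => n; have /andP[] := IP n.
rewrite -(cvg_lim _ Pl)//; apply: ler_lim => //.
  by apply/cvg_ex; eexists; exact: Pl.
by apply: nearW => n; have /andP[] := IP n.
Qed.

Lemma Gamma_gt0 (R : realType) (al : R) : 0 < al < 1 -> 0 < Gamma (1 - al).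
Proof.
move=> hal; have /andP[al0 al1] := hal.
have /andP[H _] := Gamma_between hal (ltr01 : 0 < 1 :> R).
apply: lt_le_trans H; rewrite powR1 mul1r mulr_gt0 ?expR_gt0//.
have hz := @expRN_lt1 R 1 ltr01.
have := gen_fun_partial_le 1 (fun j => kernel_weight_bounded j hal) hz.
apply: lt_le_trans; rewrite big_ord1 expr0 mulr1 /kernel_weight powR1.
by rewrite powR0 ?subr0 ?divr_gt0 ?subr_gt0// gt_eqF ?subr_gt0.
Qed.

Lemma kernel_weight_laplace (R : realType) (al : R) : 0 < al < 1 ->
  h `^ (1 - al) * gen_fun (@kernel_weight R al) (expR (- h)) @[h --> 0^'+]
    --> Gamma (1 - al).
Proof.
move=> hal; have G0 := Gamma_gt0 hal.
apply/cvg_right0P => e e0.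
have : expR h @[h --> (0:R)^'+] --> expR 0.
  by apply: cvg_at_right_filter; exact: continuous_expR.
rewrite expR0 => /cvg_right0P/(_ (e / Gamma (1 - al)))[|d d0 hd].
  exact: divr_gt0.
exists d => // h hh; have /andP[h0 _] := hh.
have /andP[l u] := Gamma_between hal h0.
set G := h `^ _ * _ in l u *.
rewrite ger0_norm ?subr_ge0//.
have l' : G <= expR h * Gamma (1 - al).
  by rewrite -(ler_pM2l (expR_gt0 (- h))) [leRHS]mulrA -expRD addNr expR0 mul1r.
have := hd h hh; rewrite ger0_norm; last first.
  by rewrite subr_ge0 -[leLHS]expR0 ler_expR ltW.
rewrite ler_pdivlMr// => H; nra.
Qed.

(** * The weights of a CM-preserving scheme *)

Lemma cvg_div_one_sub_expRN (R : realType) :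
  h / (1 - expR (- h)) @[h --> (0 : R)^'+] --> (1 : R).
Proof.
apply/cvg_right0P => e e0; exists e => // h /andP[h0 he].
have p : 0 < 1 - expR (- h) by rewrite subr_gt0 expR_lt1 oppr_lt0.
have l := expR_ge1Dx (- h).
have u := inv_one_sub_expRN_le h0.
have u' : h / (1 - expR (- h)) <= h + 1.
  apply: le_trans (_ : h * (1 + h^-1) <= _); first by rewrite ler_wpM2l ?(ltW h0).
  by rewrite mulrDr mulr1 mulfV ?gt_eqF.
have l' : 1 <= h / (1 - expR (- h)) by rewrite ler_pdivlMr// mul1r; lra.
rewrite ger0_norm ?subr_ge0//; lra.
Qed.

(** The partial sums of [w] convolved with [a] give the constant sequence 1, so
    the generating functions multiply to [1 / (1 - z)]. *)
Lemma partial_sum_inverse_laplace (R : realType) (al : R) (w a : nat -> R)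
    (C C' : R) :
  (forall k, 0 <= a k <= C) -> (forall k, 0 <= partial_sum w k <= C') ->
  conv_inverse w a -> consistent al a ->
  h `^ (1 - al) * gen_fun (partial_sum w) (expR (- h)) @[h --> 0^'+] --> (1 : R).
Proof.
move=> aC wC hwa cons.
have H : h / (1 - expR (- h)) * (h `^ al * gen_fun a (expR (- h)))^-1
    @[h --> (0:R)^'+] --> (1 : R).
  have := cvgM (@cvg_div_one_sub_expRN R) (cvgV (oner_neq0 _) cons).
  by rewrite invr1 mulr1; exact.
apply: cvg_trans H; apply: near_eq_cvg.
have /cvg_right0P/(_ 2^-1)[|d d0 hd] := cons; first by rewrite invr_gt0.
apply/near_right0P; exists d => // h hh; have /andP[h0 _] := hh.
have hz := expRN_lt1 h0.
have := hd h hh; rewrite ler_norml => /andP[hF _].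
have F0 : 0 < h `^ al * gen_fun a (expR (- h)) by lra.
have := gen_fun_conv wC aC _ hz.
rewrite (_ : conv _ _ = (fun=> 1)); last exact/funext/conv_partial_sum_inverse.
move=> /(_ 1)/(_ (fun=> _)); rewrite gen_fun_one// => hprod.
have hq : h = h `^ (1 - al) * h `^ al.
  by rewrite -powRD ?subrK ?powRr1 ?(ltW h0)// gt_eqF ?implybT.
have hal : 0 < h `^ al by exact: powR_gt0.
have Fa : gen_fun a (expR (- h)) != 0.
  by apply/eqP => E; move: F0; rewrite E mulr0 ltxx.
rewrite hprod ?ler01 ?lexx// {1}hq; field.
by rewrite Fa gt_eqF.
Qed.

(** What the rest of the argument uses of a CM-preserving scheme: the signs of
    its coefficients, the sizes of [a] and of the partial sums of [omega], and
    the closeness of the latter to the kernel weights, in the sense of their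
    cumulative sums. *)
Record good_weights (R : realType) (alpha T : R) (w a : nat -> R) (C : R) :
    Prop := GoodWeights {
  gw_inverse : conv_inverse w a;
  gw_consistent : consistent alpha a;
  gw_C : 0 <= C;
  gw_a_ge0 : forall k, 0 <= a k;
  gw_a_noninc : forall k, a k.+1 <= a k;
  gw_a_sum : forall n, \sum_(j < n) a j <= C * n%:R `^ alpha;
  gw_w_le0 : forall j, w j.+1 <= 0;
  gw_W_ge0 : forall n, 0 <= partial_sum w n;
  gw_W_le : forall n, partial_sum w n <= C * n.+1%:R `^ (- alpha);
  gw_W_sum : forall n, \sum_(j < n) partial_sum w j <= C * n%:R `^ (1 - alpha);
  gw_kernel : forall e, 0 < e -> exists2 d, 0 < d &
    forall h (n : nat), 0 < h < d -> n%:R * h <= T ->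
    h `^ (1 - alpha) *
      `|\sum_(j < n) (partial_sum w j - kernel_weight alpha j / Gamma (1 - alpha))|
    <= e }.

(** The finitely many [n] that the asymptotic bound does not cover are
    controlled by the factor [h `^ q]. *)
Lemma scaled_small_o (R : realType) (D : nat -> R) (q T C : R) :
  0 < q -> 0 < T -> (forall n, `|\sum_(j < n) D j| <= C * n%:R `^ q) ->
  (forall e, 0 < e -> exists n0, forall n, (n0 <= n)%N ->
    `|\sum_(j < n) D j| <= e * n%:R `^ q) ->
  forall e, 0 < e -> exists2 d, 0 < d &
    forall h (n : nat), 0 < h < d -> n%:R * h <= T ->
    h `^ q * `|\sum_(j < n) D j| <= e.
Proof.
move=> q0 T0 DC Do e e0.
have Tq : 0 < T `^ q by exact: powR_gt0.
have [n0 hn0] := Do (e / T `^ q) (divr_gt0 e0 Tq).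
have C0 : 0 <= C by have := DC 1%N; rewrite powR1 mulr1; exact: le_trans.
have K0 : 0 < C * n0%:R `^ q + 1 by rewrite ltr_wpDl// mulr_ge0 ?powR_ge0.
have /cvg_right0P/(_ _ (divr_gt0 e0 K0))[d d0 hd] := powR_cvg0 q0.
exists d => // h n hh nT; have /andP[h0 _] := hh.
have hq0 : 0 <= h `^ q by exact: powR_ge0.
have [nn|nn] := leqP n0 n.
  apply: (@le_trans _ _ (h `^ q * (e / T `^ q * n%:R `^ q))).
    by rewrite ler_wpM2l// hn0.
  rewrite mulrCA [h `^ q * _]mulrC -powRM ?ler0n ?(ltW h0)// -[leRHS](divfK (lt0r_neq0 Tq)).
  rewrite ler_wpM2l ?divr_ge0 ?(ltW e0) ?(ltW Tq)//.
  by apply: ge0_ler_powR; rewrite ?nnegrE ?mulr_ge0 ?(ltW h0) ?(ltW T0) ?(ltW q0).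
have := hd h hh; rewrite subr0 ger0_norm// ler_pdivlMr// => /(le_trans _); apply.
rewrite ler_wpM2l// (le_trans (DC n))// ler_wpDr// ler_wpM2l//.
by apply: ge0_ler_powR; rewrite ?nnegrE ?ler0n ?ler_nat ?(ltW q0)// ltnW.
Qed.

Lemma CM_preserving_good_weights (R : realType) (alpha T : R)
    (w : nat -> R) : 0 < alpha < 1 -> 0 < T -> CM_preserving alpha w ->
  exists a C, good_weights alpha T w a C.
Proof.
move=> hal T0 [_ [a [hwa cons cm]]]; have /andP[al0 al1] := hal.
have q0 : 0 < 1 - alpha by rewrite subr_gt0.
have ap := completely_monotone_gt0 al0 cm cons.
have a_noninc k : a k.+1 <= a k by exact: completely_monotone_noninc.
have lc k : a k.+1 ^+ 2 <= a k * a k.+2 by exact: completely_monotone_log_convex.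
have wle := kaluza hwa ap lc.
have W0 := partial_sum_inverse_ge0 hwa ap a_noninc wle.
have W_noninc k : partial_sum w k.+1 <= partial_sum w k.
  by rewrite partial_sumS gerDl.
have aC k : 0 <= a k <= a 0%N by rewrite ltW//=; exact: noninc_seq_le.
have WC k : 0 <= partial_sum w k <= partial_sum w 0.
  by rewrite W0 /=; exact: noninc_seq_le.
have Wlap := partial_sum_inverse_laplace aC WC hwa cons.
have [Ca Ca0 hCa] := sum_le_pow_of_laplace al0 aC cons.
have [CW CW0 hCW] := sum_le_pow_of_laplace q0 WC Wlap.
have hW1 := noninc_le_pow W_noninc hCW.
have G0 := Gamma_gt0 hal.
pose D j := partial_sum w j - kernel_weight alpha j / Gamma (1 - alpha).
pose CK := (1 - alpha)^-1 / Gamma (1 - alpha).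
have CK0 : 0 < CK by rewrite divr_gt0 ?invr_gt0.
have Dn j : `|D j| <= partial_sum w j + kernel_weight alpha j / Gamma (1 - alpha).
  rewrite (le_trans (ler_normB _ _))// ger0_norm ?W0// ger0_norm//.
  by rewrite divr_ge0 ?(ltW G0) ?kernel_weight_ge0.
have D1 j : `|D j| <= (CW + CK) * j.+1%:R `^ (- alpha).
  apply: (le_trans (Dn j)); rewrite mulrDl lerD//.
    have := hW1 j; rewrite (_ : 1 - alpha - 1 = - alpha)//; ring.
  rewrite /CK [leRHS]mulrAC ler_wpM2r ?invr_ge0 ?(ltW G0)// [leRHS]mulrC.
  exact: kernel_weight_le.
have D2 n : \sum_(j < n) `|D j| <= (CW + CK) * n%:R `^ (1 - alpha).
  apply: (le_trans (ler_sum _ (fun (i : 'I_n) _ => Dn i))).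
  rewrite big_split /= mulrDl; apply: lerD; first exact: hCW.
  rewrite -mulr_suml sum_kernel_weight// /CK.
  by rewrite le_eqVlt; apply/orP; left; apply/eqP; ring.
have Dlap : h `^ (1 - alpha) * gen_fun D (expR (- h)) @[h --> 0^'+] --> 0.
  have H : h `^ (1 - alpha) * gen_fun (partial_sum w) (expR (- h)) -
      h `^ (1 - alpha) * gen_fun (@kernel_weight R alpha) (expR (- h)) *
      (Gamma (1 - alpha))^-1 @[h --> 0^'+] --> (0 : R).
    have := cvgB Wlap (cvgM (kernel_weight_laplace hal) (cvg_cst (Gamma (1 - alpha))^-1)).
    by rewrite mulfV ?gt_eqF// subrr; exact.
  apply/cvg_right0P => e e0; have /cvg_right0P/(_ e e0)[d d0 hd] := H.
  exists d => // h hh; have /andP[h0 _] := hh; have hdh := hd h hh.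
  have hz := expRN_lt1 h0.
  have kwb k : `|kernel_weight alpha k / Gamma (1 - alpha)| <= CK.
    have /andP[k0 k1] := kernel_weight_bounded k hal.
    by rewrite ger0_norm ?ler_wpM2r ?invr_ge0 ?(ltW G0)// divr_ge0 ?(ltW G0).
  have Wb k : `|partial_sum w k| <= partial_sum w 0.
    by have /andP[? ?] := WC k; rewrite ger0_norm.
  rewrite /D (gen_funB Wb kwb hz) /=.
  have -> : gen_fun (fun k => kernel_weight alpha k / Gamma (1 - alpha)) (expR (- h))
      = gen_fun (@kernel_weight R alpha) (expR (- h)) / Gamma (1 - alpha).
    apply/cvg_lim => //.
    have H2 : series (fun n => kernel_weight alpha n * expR (- h) ^+ n) n *
        (Gamma (1 - alpha))^-1 @[n --> \oo] -->
        gen_fun (@kernel_weight R alpha) (expR (- h)) / Gamma (1 - alpha).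
      apply: cvgM; last exact: cvg_cst.
      exact: is_cvg_gen_fun_ge0 (fun k => kernel_weight_bounded k hal) hz.
    rewrite (_ : series _ = (fun n : nat =>
      series (fun n => kernel_weight alpha n * expR (- h) ^+ n) n *
        (Gamma (1 - alpha))^-1))//.
    apply/funext => n /=; rewrite !series_ordE mulr_suml; apply: eq_bigr => j _.
    by rewrite mulrAC.
  by rewrite mulrBr mulrA.
exists a, (Ca + CW); split => //.
- by rewrite addr_ge0 ?(ltW Ca0) ?(ltW CW0).
- by move=> k; exact: ltW.
- move=> n; apply: (le_trans (hCa n)).
  by rewrite ler_wpM2r ?powR_ge0// lerDl ltW.
- move=> n; have := hW1 n; rewrite (_ : 1 - alpha - 1 = - alpha); last by ring.
  by move=> /le_trans; apply; rewrite ler_wpM2r ?powR_ge0// lerDr ltW.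
- move=> n; apply: (le_trans (hCW n)).
  by rewrite ler_wpM2r ?powR_ge0// lerDr ltW.
- apply: (scaled_small_o (D := D) q0 T0 (C := CW + CK)).
    by move=> n; apply: le_trans (D2 n); exact: ler_norm_sum.
  exact: tauberian hal D1 D2 Dlap.
Qed.

(** * Functions with an integrable singularity of the derivative at 0 *)

(** Solutions are of class C^1 away from 0 only; near 0 the derivative is
    dominated by that of [t `^ al]. *)
Record singular_C1 (R : realType) (al T : R) (w g : R -> R) (C : R) : Prop :=
  SingularC1 {
  sc_C : 0 <= C;
  sc_cont : {within `[0, T], continuous w};
  sc_der : forall t, 0 < t < T -> is_derive t (1 : R) w (g t);
  sc_gcont : forall t, 0 < t <= T -> forall e, 0 < e ->
    exists2 d, 0 < d & forall s, 0 < s <= T -> `|s - t| < d ->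
      `|g s - g t| <= e;
  sc_g : forall t, 0 < t <= T -> `|g t| <= C * t `^ (al - 1) }.

Lemma singular_C1_MVT (R : realType) (al T C : R) (w g : R -> R) (a b : R) :
  singular_C1 al T w g C -> 0 <= a -> a < b -> b <= T ->
  exists2 c, a < c < b & w b - w a = g c * (b - a).
Proof.
move=> sc a0 ab bT.
have [||c] := @MVT _ w g a b ab.
- move=> x; rewrite in_itv /= => /andP[ax xb]; apply: (sc_der sc).
  by rewrite (le_lt_trans a0 ax) (lt_le_trans xb bT).
- apply: continuous_subspaceW (sc_cont sc).
  by apply: subset_itv; rewrite bnd_simp.
by rewrite in_itv /= => hc ->; exists c.
Qed.

(** The derivative bound makes [C / al * t `^ al] plus or minus [w]
    nondecreasing. *)
Lemma singular_C1_increment (R : realType) (al T C : R) (w g : R -> R)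
    (a b : R) :
  0 < al -> singular_C1 al T w g C -> 0 <= a -> a <= b -> b <= T ->
  `|w b - w a| <= C / al * (b `^ al - a `^ al).
Proof.
move=> al0 sc a0; rewrite le_eqVlt => /predU1P[<-|ab] bT.
  by rewrite !subrr normr0 mulr0.
have key (sgn : R) : `|sgn| = 1 ->
    sgn * (w b - w a) <= C / al * (b `^ al - a `^ al).
  move=> s1.
  pose F x := (C / al) * x `^ al - sgn * w x.
  have dF x : x \in `]a, b[ -> is_derive x (1 : R) F (C * x `^ (al - 1) - sgn * g x).
    rewrite in_itv /= => /andP[ax xb].
    have x0 : 0 < x by exact: le_lt_trans ax.
    have h1 := is_derive1_powR al x0.
    have h2 : is_derive x (1 : R) w (g x).
      by apply: (sc_der sc); rewrite x0 (lt_le_trans xb bT).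
    have -> : C * x `^ (al - 1) - sgn * g x =
        (C / al) *: (al * x `^ (al - 1)) - sgn *: g x.
      by rewrite /GRing.scale /= mulrA divfK ?gt_eqF.
    apply: is_deriveB.
  have cF : {within `[a, b], continuous F}.
    have cw : {within `[a, b], continuous w}.
      apply: continuous_subspaceW (sc_cont sc).
      by apply: subset_itv; rewrite bnd_simp.
    have cp : {within `[a, b], continuous (fun x => x `^ al)}.
      apply/continuous_within_itvP => //; split.
      - move=> x; rewrite in_itv /= => /andP[ax _].
        by apply: continuous_powR; exact: le_lt_trans ax.
      - exact: powR_cvg_right.
      - by apply: cvg_at_left_filter; apply: continuous_powR; exact: le_lt_trans ab.
    move=> x; apply: cvgB; apply: cvgM; [exact: cvg_cst|exact: cp|exact: cvg_cst|exact: cw].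
  have [c hc] := MVT ab dF cF.
  rewrite in_itv /= in hc; have /andP[ac cb] := hc.
  have cT : 0 < c <= T by rewrite (le_lt_trans a0 ac) (le_trans (ltW cb) bT).
  have gc := sc_g sc cT.
  have : sgn * g c <= C * c `^ (al - 1).
    by apply: le_trans gc; rewrite -[leRHS]mul1r -s1 -normrM ler_norm.
  rewrite -subr_ge0 => p E.
  have : 0 <= F b - F a by rewrite E mulr_ge0// subr_ge0 ltW.
  rewrite /F; lra.
rewrite ler_norml; apply/andP; split.
  have := key (-1); rewrite normrN1 mulN1r => /(_ erefl); lra.
by have := key 1; rewrite normr1 mul1r => /(_ erefl).
Qed.

(** Heine's theorem, by extraction of a convergent subsequence. *)
Lemma singular_C1_unif (R : realType) (al T C : R) (w g : R -> R) (eta e : R) :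
  singular_C1 al T w g C -> 0 < eta -> 0 < e ->
  exists2 d, 0 < d & forall s t, eta <= s <= T -> eta <= t <= T ->
    `|s - t| < d -> `|g s - g t| <= e.
Proof.
move=> sc eta0 e0; apply: contrapT => hno.
have P n : exists st : R * R, [/\ eta <= st.1 <= T, eta <= st.2 <= T,
    `|st.1 - st.2| < n.+1%:R^-1 & e < `|g st.1 - g st.2|].
  apply: contrapT => h; apply: hno; exists n.+1%:R^-1; first by rewrite invr_gt0.
  move=> s t hs ht st; rewrite leNgt; apply/negP => H.
  by apply: h; exists (s, t).
have [st hst] := choice P.
have bs : bounded_fun (fun n => (st n).1).
  exists T; split; first exact: num_real.
  move=> x Tx n _ /=; have [/andP[h1 h2] _ _ _] := hst n.
  by rewrite ger0_norm ?(le_trans h2) ?(ltW Tx)// (le_trans (ltW eta0)).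
have [f incf cf] := bolzano_weierstrass bs.
have fge n : (n <= f n)%N.
  elim: n => // n IH; apply: (leq_ltn_trans IH).
  by rewrite ltnNge [X in ~~ X](incf n.+1 n); exact: (negbT (ltnn n)).
have hl : 0 < limn ((fun n => (st n).1) \o f) <= T.
  apply/andP; split.
    apply: (lt_le_trans eta0); apply: limr_ge => //; apply: nearW => n /=.
    by have [/andP[]] := hst (f n).
  by apply: limr_le => //; apply: nearW => n /=; have [/andP[]] := hst (f n).
set l := limn _ in cf hl.
have e2 : 0 < e / 2 by rewrite divr_gt0.
have [d d0 hd] := sc_gcont sc hl e2.
have d2 : 0 < d / 2 by rewrite divr_gt0.
have /cvgrPdist_lt/(_ _ d2)[N _ hN] := cf.
pose n := maxn N (Num.truncn (2 / d)).+1.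
have hn : n.+1%:R^-1 < d / 2.
  rewrite -[d / 2]invf_div ltf_pV2 ?posrE ?divr_gt0//.
  by apply: lt_le_trans (truncnS_gt _) _; rewrite ler_nat (leq_trans _ (leqnSn n))// leq_maxr.
have h1 := hN n (leq_maxl _ _); rewrite /= distrC in h1.
have [/andP[a1 a2] /andP[b1 b2] hs] := hst (f n).
rewrite ltNge => /negP; apply.
have h2 : `|(st (f n)).1 - (st (f n)).2| < d / 2.
  apply: (lt_trans hs); apply: le_lt_trans hn.
  by rewrite lef_pV2 ?posrE ?ltr0Sn// ler_nat ltnS.
have h3 : `|(st (f n)).2 - l| < d.
  have -> : (st (f n)).2 - l = ((st (f n)).1 - l) - ((st (f n)).1 - (st (f n)).2) by ring.
  by apply: (le_lt_trans (ler_normB _ _)); rewrite [ltRHS](splitr d) ltrD.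
have h4 : `|(st (f n)).1 - l| < d by apply: (lt_trans h1); lra.
have k1 := hd _ (introT andP (conj (lt_le_trans eta0 a1) a2)) h4.
have k2 := hd _ (introT andP (conj (lt_le_trans eta0 b1) b2)) h3.
have -> : g (st (f n)).1 - g (st (f n)).2 =
  (g (st (f n)).1 - g l) - (g (st (f n)).2 - g l) by ring.
by apply: (le_trans (ler_normB _ _)); rewrite (splitr e) lerD.
Qed.

(** * The local truncation error *)

Lemma abel_summation (R : comPzRingType) (D y : nat -> R) (m : nat) :
  \sum_(j < m.+1) D j * y j = (\sum_(j < m.+1) D j) * y m +
    \sum_(j < m) (\sum_(i < j.+1) D i) * (y j - y j.+1).
Proof.
elim: m => [|m IH]; first by rewrite !big_ord1 big_ord0 addr0.
rewrite big_ord_recr /= IH [in RHS]big_ord_recr /= [in X in _ = _ + X]big_ord_recr /=.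
ring.
Qed.

Lemma abel_bound (R : realType) (D y : nat -> R) (m : nat) (sigma G B : R) :
  0 <= sigma -> 0 <= G -> 0 <= B ->
  (forall l, (l <= m)%N -> `|\sum_(j < l) D j| <= sigma) ->
  (forall j, (j < m)%N -> `|y j| <= G) ->
  (forall j, (j.+1 < m)%N -> `|y j - y j.+1| <= B) ->
  `|\sum_(j < m) D j * y j| <= sigma * (G + m%:R * B).
Proof.
move=> s0 G0 B0; case: m => [|m] hD hy hB.
  by rewrite big_ord0 normr0 mul0r addr0 mulr_ge0.
rewrite abel_summation (le_trans (ler_normD _ _))// mulrDr lerD//.
  by rewrite normrM ler_pM ?normr_ge0 ?hD ?hy.
apply: (le_trans (ler_norm_sum _ _ _)).
apply: (@le_trans _ _ (\sum_(j < m) sigma * B)).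
  apply: ler_sum => j _; have jm := ltn_ord j; rewrite normrM ler_pM ?normr_ge0//.
    by apply: hD; exact: leqW.
  by apply: hB; rewrite ltnS.
rewrite sumr_const card_ord -[leLHS]mulr_natl mulrCA ler_wpM2l// ler_wpM2r//.
by rewrite ler_nat.
Qed.

(** The cells are counted backwards from the [n]-th node, to match the index of
    the weights in a convolution. *)
Definition increment (R : realType) (w : R -> R) (h : R) (n j : nat) : R :=
  w ((n - j)%N%:R * h) - w ((n - j.+1)%N%:R * h).

Lemma increment_MVT (R : realType) (al T C : R) (w g : R -> R) (h : R)
    (n j : nat) :
  singular_C1 al T w g C -> 0 < h -> n%:R * h <= T -> (j < n)%N ->
  exists2 c, (n - j.+1)%N%:R * h < c < (n - j)%N%:R * h &
    increment w h n j = h * g c.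
Proof.
move=> sc h0 nT jn.
have [|||c hc E] := @singular_C1_MVT R al T C w g ((n - j.+1)%N%:R * h)
  ((n - j)%N%:R * h) sc.
- by rewrite mulr_ge0// ltW.
- by rewrite ltr_pM2r// ltr_nat; lia.
- by apply: le_trans nT; rewrite ler_pM2r// ler_nat leq_subr.
exists c => //; rewrite /increment E -mulrBl.
have -> : (n - j)%N = (n - j.+1).+1 by lia.
by rewrite -natr1 addrAC subrr add0r mul1r mulrC.
Qed.

(** The increments near [t = 0], at positions [j >= m], meet weights of size
    [(m h) `^ (- al)]. *)
Lemma head_sum_le (R : realType) (al T C K : R) (W : nat -> R) (w g : R -> R)
    (h : R) (m k : nat) :
  0 < al -> 0 <= K -> singular_C1 al T w g C -> 0 < h ->
  (m + k)%:R * h <= T -> (0 < m)%N ->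
  (forall j, 0 <= W j <= K * j.+1%:R `^ (- al)) ->
  `|h `^ (- al) * \sum_(j < k) W (m + j)%N * increment w h (m + k) (m + j)|
    <= K * C / al * ((k%:R * h) / (m%:R * h)) `^ al.
Proof.
move=> al0 K0 sc h0 nT m0 WK; have C0 := sc_C sc.
have mp : 0 < m%:R :> R by rewrite ltr0n.
have h1 (j : nat) : (j < k)%N -> `|W (m + j)%N * increment w h (m + k) (m + j)| <=
   K * m%:R `^ (- al) * (C / al * (((k - j)%N%:R * h) `^ al - ((k - j.+1)%N%:R * h) `^ al)).
  move=> jk; rewrite normrM ler_pM ?normr_ge0//.
    have /andP[W0 W1] := WK (m + j)%N; rewrite ger0_norm// (le_trans W1)// ler_wpM2l//.
    rewrite !powRN lef_pV2 ?posrE ?powR_gt0 ?ltr0n//.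
    apply: ge0_ler_powR; rewrite ?nnegrE ?ler0n ?ler_nat ?(ltW al0)//; lia.
  rewrite /increment.
  have -> : (m + k - (m + j) = k - j)%N by lia.
  have -> : (m + k - (m + j).+1 = k - j.+1)%N by lia.
  apply: (singular_C1_increment al0 sc).
  - by rewrite mulr_ge0// ltW.
  - by rewrite ler_pM2r// ler_nat; lia.
  - by apply: le_trans nT; rewrite ler_pM2r// ler_nat; lia.
rewrite normrM ger0_norm ?powR_ge0//.
apply: (@le_trans _ _ (h `^ (- al) * (K * m%:R `^ (- al) * (C / al * (k%:R * h) `^ al)))).
  rewrite ler_wpM2l ?powR_ge0// (le_trans (ler_norm_sum _ _ _))//.
  apply: (le_trans (ler_sum _ (fun (j : 'I_k) _ => h1 j (ltn_ord j)))).
  rewrite -!mulr_sumr ler_wpM2l ?mulr_ge0 ?powR_ge0// ler_wpM2l ?divr_ge0 ?(ltW al0)//.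
  rewrite (eq_bigr (fun j : 'I_k => (fun i => - ((k - i)%N%:R * h) `^ al) j.+1 -
     (fun i => - ((k - i)%N%:R * h) `^ al) j)); last by move=> j _; rewrite /= opprK addrC.
  rewrite -(big_mkord xpredT (fun j => (fun i => - ((k - i)%N%:R * h) `^ al) j.+1 -
     (fun i => - ((k - i)%N%:R * h) `^ al) j)) telescope_sumr//.
  by rewrite subnn subn0 mul0r powR0 ?gt_eqF// oppr0 add0r opprK.
have -> : (k%:R * h / (m%:R * h)) `^ al =
    (k%:R * h) `^ al * (h `^ (- al) * m%:R `^ (- al)).
  have mh : 0 <= m%:R * h by rewrite mulr_ge0// ltW.
  rewrite powRM ?invr_ge0 ?(mulr_ge0 _ (ltW h0))//; congr (_ * _).
  rewrite -[(m%:R * h)^-1]powR_inv1// -powRrM mulN1r powRM ?(ltW h0) ?(ltW mp)//.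
  by rewrite mulrC.
rewrite le_eqVlt; apply/orP; left; apply/eqP; ring.
Qed.

(** The exponent has the form [p - 1] in which the integrals of powers are
    stated. *)
Lemma caputo_integrandE (R : realType) (al T C t s : R) (w g : R -> R) :
  singular_C1 al T w g C -> t <= T -> 0 < s < t ->
  caputo_integrand al w t s = g s * (t - s) `^ (1 - al - 1).
Proof.
move=> sc tT /andP[s0 st]; rewrite /caputo_integrand.
have [_ h] := sc_der sc (introT andP (conj s0 (lt_le_trans st tT))).
by rewrite derive1E h -powRN; congr (_ * _ `^ _); ring.
Qed.

(** On [`]0, b[] the kernel is at most [(t - b) `^ (- al)], and [g] is
    integrable. *)
Lemma head_integral_le (R : realType) (al T C t b : R) (w g : R -> R) :
  0 < al < 1 -> singular_C1 al T w g C -> 0 < b -> b < t -> t <= T ->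
  (@lebesgue_measure R).-integrable `]0, t[ (EFin \o caputo_integrand al w t) ->
  `|\int[@lebesgue_measure R]_(s in `]0, b[) caputo_integrand al w t s|
    <= C / al * (b / (t - b)) `^ al.
Proof.
move=> /andP[al0 al1] sc b0 bt tT hi; have C0 := sc_C sc.
have tb : 0 < t - b by rewrite subr_gt0.
have hib : (@lebesgue_measure R).-integrable `]0, b[ (EFin \o caputo_integrand al w t).
  by apply: integrableS hi => //; apply: subset_itvl; rewrite bnd_simp ltW.
have [i1 i2] := integral_powR_oo al0 (introT andP (conj (lexx (0 : R)) b0)).
pose M := C * (t - b) `^ (- al).
have M0 : 0 <= M by rewrite mulr_ge0 ?powR_ge0.
have bd s : 0 < s < b -> `|caputo_integrand al w t s| <= M * s `^ (al - 1).
  move=> /andP[s0 sb].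
  rewrite (caputo_integrandE sc tT) ?s0 ?(lt_trans sb bt)// normrM.
  have hs := sc_g sc (introT andP (conj s0 (ltW (lt_le_trans (lt_trans sb bt) tT)))).
  rewrite /M mulrAC ler_pM ?normr_ge0// ger0_norm ?powR_ge0//.
  rewrite (_ : 1 - al - 1 = - al); last by ring.
  rewrite !powRN lef_pV2 ?posrE ?powR_gt0 ?subr_gt0 ?(lt_trans sb bt)//.
  apply: ge0_ler_powR; rewrite ?nnegrE ?(ltW al0) ?(ltW tb)// ?lerD2l ?lerN2 ?(ltW sb)//.
  by rewrite subr_ge0 ltW// (lt_trans sb bt).
have := @Rintegral_between R (caputo_integrand al w t) (fun s => s `^ (al - 1))
  `]0, b[%classic (- M) M (measurable_itv _) hib i1.
rewrite i2 powR0 ?gt_eqF// subr0 => H.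
have /andP[h1 h2] : - M * (b `^ al / al) <=
    \int[@lebesgue_measure R]_(s in `]0, b[) caputo_integrand al w t s <=
    M * (b `^ al / al).
  apply: H => s /=; rewrite in_itv /= => /bd.
  by rewrite ler_norml mulNr.
have -> : C / al * (b / (t - b)) `^ al = M * (b `^ al / al).
  rewrite /M powRM ?invr_ge0 ?(ltW b0) ?(ltW tb)//.
  rewrite -[(t - b)^-1]powR_inv1 ?(ltW tb)// -powRrM mulN1r; ring.
by rewrite ler_norml -mulNr h1.
Qed.

Lemma cell_integral_le (R : realType) (al T C t a b c e : R) (w g : R -> R) :
  al < 1 -> singular_C1 al T w g C -> 0 <= a -> a < c < b -> b <= t ->
  t <= T ->
  (@lebesgue_measure R).-integrable `]0, t[ (EFin \o caputo_integrand al w t) ->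
  (forall s, a < s < b -> `|g s - g c| <= e) ->
  `|g c * (((t - a) `^ (1 - al) - (t - b) `^ (1 - al)) / (1 - al)) -
    \int[@lebesgue_measure R]_(s in `]a, b[) caputo_integrand al w t s|
    <= e * (((t - a) `^ (1 - al) - (t - b) `^ (1 - al)) / (1 - al)).
Proof.
move=> al1 sc a0 /andP[ac cb] bt tT hi osc.
set K := _ / (1 - al).
have q0 : 0 < 1 - al by rewrite subr_gt0.
have hib : (@lebesgue_measure R).-integrable `]a, b[ (EFin \o caputo_integrand al w t).
  by apply: integrableS hi => //; apply: subset_itv; rewrite bnd_simp.
have ab : a < b <= t by rewrite (lt_trans ac cb).
have [i1 i2] := integral_kernel_oo q0 ab.
have := @Rintegral_between R (caputo_integrand al w t)
  (fun s => (t - s) `^ (1 - al - 1)) `]a, b[%classic (g c - e) (g c + e)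
  (measurable_itv _) hib i1.
rewrite i2 -/K => H.
have /andP[h1 h2] : (g c - e) * K <=
    \int[@lebesgue_measure R]_(s in `]a, b[) caputo_integrand al w t s <=
    (g c + e) * K.
  apply: H => s /=; rewrite in_itv /= => hs; have /andP[s1 s2] := hs.
  rewrite (caputo_integrandE sc tT); last first.
    by rewrite (le_lt_trans a0 s1) (lt_le_trans s2 bt).
  have := osc s hs; rewrite ler_norml => /andP[l1 l2].
  by rewrite !ler_wpM2r ?powR_ge0//; lra.
rewrite ler_norml; apply/andP; split; lra.
Qed.

(** On a cell where [g] is almost constant, the kernel weight is the exact
    integral of the kernel. *)
Lemma tail_integral_le (R : realType) (al T C h e d : R) (w g : R -> R)
    (m k : nat) :
  0 < al < 1 -> singular_C1 al T w g C -> 0 < h -> h <= d ->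
  (m + k)%:R * h <= T -> 0 <= e ->
  (@lebesgue_measure R).-integrable `]0, ((m + k)%:R * h)[
    (EFin \o caputo_integrand al w ((m + k)%:R * h)) ->
  (forall s s', k%:R * h <= s <= T -> k%:R * h <= s' <= T ->
     `|s - s'| < d -> `|g s - g s'| <= e) ->
  `|h `^ (- al) * \sum_(j < m) kernel_weight al j * increment w h (m + k) j -
    \int[@lebesgue_measure R]_(s in `]k%:R * h, ((m + k)%:R * h)[)
      caputo_integrand al w ((m + k)%:R * h) s|
  <= e * (T `^ (1 - al) / (1 - al)).
Proof.
move=> /andP[al0 al1] sc h0 hd nT e0 hi osc; have q0 : 0 < 1 - al by rewrite subr_gt0.
set t := (m + k)%:R * h in nT hi *.
have hh : h `^ (- al) * h = h `^ (1 - al).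
  by rewrite powRD ?powRr1 ?(ltW h0) ?gt_eqF ?implybT// mulrC.
have kh0 : 0 <= k%:R * h by rewrite mulr_ge0// ltW.
have split_int : \int[@lebesgue_measure R]_(s in `]k%:R * h, t[) caputo_integrand al w t s =
    \sum_(j < m) \int[@lebesgue_measure R]_(s in
      `]((m + k - j.+1)%N%:R * h), ((m + k - j)%N%:R * h)[) caputo_integrand al w t s.
  pose x i : R := (k + i)%N%:R * h.
  have -> : k%:R * h = x 0%N by rewrite /x addn0.
  have tx : t = x m by rewrite /x addnC.
  rewrite {1}tx (@Rintegral_oo_sum R (caputo_integrand al w t) x m); first last.
  - rewrite -tx /x addn0; apply: integrableS hi => //; apply: subset_itvr.
    by rewrite bnd_simp.
  - by move=> i; rewrite /x ler_pM2r// ler_nat leq_add2l.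
  rewrite (reindex_inj rev_ord_inj) /=; apply: eq_bigr => j _.
  have jm := ltn_ord j; rewrite /x.
  have -> : (k + (m - j.+1) = m + k - j.+1)%N by clear -jm; lia.
  by have -> : (k + (m - j.+1).+1 = m + k - j)%N by clear -jm; lia.
rewrite split_int mulr_sumr -sumrB (le_trans (ler_norm_sum _ _ _))//.
apply: (@le_trans _ _ (\sum_(j < m) e * (h `^ (1 - al) * kernel_weight al j))).
  apply: ler_sum => j _; have jm := ltn_ord j.
  have jn : (j < m + k)%N by rewrite ltn_addr.
  have [c hc ->] := increment_MVT sc h0 nT jn.
  have := @cell_integral_le R al T C t ((m + k - j.+1)%N%:R * h) ((m + k - j)%N%:R * h)
     c e w g al1 sc.
  have -> : t - (m + k - j.+1)%N%:R * h = j.+1%:R * h.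
    by rewrite /t -mulrBl -natrB ?leq_subr// subKn.
  have -> : t - (m + k - j)%N%:R * h = j%:R * h.
    by rewrite /t -mulrBl -natrB ?leq_subr// subKn// ltnW.
  rewrite -kernel_weight_scale ?(ltW h0)// => H.
  have -> : h `^ (- al) * (kernel_weight al j * (h * g c)) =
     g c * (h `^ (1 - al) * kernel_weight al j) by rewrite -hh; ring.
  have tn : (m + k - j)%N%:R * h <= t by rewrite ler_pM2r// ler_nat leq_subr.
  have lo : k%:R * h <= (m + k - j.+1)%N%:R * h.
    by rewrite ler_pM2r// ler_nat; clear -jm; lia.
  have len : (m + k - j)%N%:R * h = (m + k - j.+1)%N%:R * h + h.
    have -> : (m + k - j)%N = (m + k - j.+1).+1 by clear -jm; lia.
    by rewrite -natr1 mulrDl mul1r.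
  apply: H => //; first by rewrite mulr_ge0// ltW.
  move=> s /andP[s1 s2]; have /andP[c1 c2] := hc; apply: osc.
  - by rewrite (le_trans lo (ltW s1)) (le_trans (ltW s2) (le_trans tn nT)).
  - by rewrite (le_trans lo (ltW c1)) (le_trans (ltW c2) (le_trans tn nT)).
  - by rewrite ltr_norml; apply/andP; split; lra.
rewrite -!mulr_sumr ler_wpM2l// sum_kernel_weight// mulrA ler_wpM2r ?invr_ge0 ?(ltW q0)//.
rewrite -powRM ?(ltW h0)//; apply: ge0_ler_powR; rewrite ?nnegrE ?(ltW q0)//.
- by rewrite mulr_ge0// ltW.
- by apply: le_trans nT; rewrite mulr_ge0// ltW.
- by rewrite mulrC (le_trans _ nT)// ler_pM2r// ler_nat leq_addr.
Qed.

(** The increments are compared with [h] times the difference quotients of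
    [w] of step [dl], whose variation along the grid is small enough for
    summation by parts to transfer the cumulative bound [sigma] on [D]. *)
Lemma tail_sum_le (R : realType) (al T C h e dl eta G sigma S : R)
    (D : nat -> R) (w g : R -> R) (m k : nat) :
  0 < al < 1 -> singular_C1 al T w g C -> 0 < h -> h <= dl ->
  (m + k)%:R * h <= T -> 0 <= e -> 0 < eta -> eta + dl <= k%:R * h ->
  0 <= G -> 0 <= sigma ->
  (forall s, eta <= s <= T -> `|g s| <= G) ->
  (forall s s', eta <= s <= T -> eta <= s' <= T ->
     `|s - s'| < 2 * dl -> `|g s - g s'| <= e) ->
  (forall l, (l <= m)%N -> h `^ (1 - al) * `|\sum_(j < l) D j| <= sigma) ->
  (\sum_(j < m) `|D j| <= S * m%:R `^ (1 - al)) -> 0 <= S ->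
  `|h `^ (- al) * \sum_(j < m) D j * increment w h (m + k) j|
  <= S * T `^ (1 - al) * e + sigma * (G + 2 * T * G / dl).
Proof.
move=> /andP[al0 al1] sc h0 hdl nT e0 eta0 ketadl G0 sigma0 gG osc hD hS S0.
have q0 : 0 < 1 - al by rewrite subr_gt0.
have dl0 : 0 < dl by exact: lt_le_trans hdl.
have hh : h `^ (- al) * h = h `^ (1 - al).
  by rewrite powRD ?powRr1 ?(ltW h0) ?gt_eqF ?implybT// mulrC.
have hq : 0 < h `^ (1 - al) by exact: powR_gt0.
have mhT : m%:R * h <= T.
  by apply: le_trans nT; rewrite ler_pM2r// ler_nat leq_addr.
pose tt j : R := (m + k - j)%N%:R * h.
pose y j := (w (tt j) - w (tt j - dl)) / dl.
have tj j : (j <= m)%N -> eta + dl <= tt j <= T.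
  move=> jm; apply/andP; split.
    by apply: (le_trans ketadl); rewrite ler_pM2r// ler_nat; clear -jm; lia.
  by apply: le_trans nT; rewrite ler_pM2r// ler_nat leq_subr.
have tS j : (j < m)%N -> tt j = tt j.+1 + h.
  move=> jm; rewrite /tt (_ : (m + k - j)%N = (m + k - j.+1).+1); last by clear -jm; lia.
  by rewrite -natr1 mulrDl mul1r.
have yE j : (j <= m)%N -> exists2 c, tt j - dl < c < tt j & y j = g c.
  move=> /tj /andP[t1 t2].
  have [|||c hc E] := @singular_C1_MVT R al T C w g (tt j - dl) (tt j) sc; [lra|lra|lra|].
  by exists c => //; rewrite /y E opprB addrC subrK mulfK ?gt_eqF.
have lip a b : eta <= a -> a < b -> b <= T -> `|w b - w a| <= G * (b - a).
  move=> ea ab bT.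
  have [|||c /andP[c1 c2] ->] := @singular_C1_MVT R al T C w g a b sc => //.
    exact: le_trans (ltW eta0) ea.
  rewrite normrM (gtr0_norm (_ : 0 < b - a)) ?subr_gt0// ler_wpM2r ?subr_ge0 ?(ltW ab)//.
  by apply: gG; rewrite (le_trans ea (ltW c1)) (le_trans (ltW c2) bT).
have hdiff j : (j < m)%N -> `|increment w h (m + k) j - h * y j| <= h * e.
  move=> jm; have jn : (j < m + k)%N by rewrite ltn_addr.
  have [c /andP[c1 c2] ->] := increment_MVT sc h0 nT jn.
  have [c' /andP[c3 c4] ->] := yE j (ltnW jm).
  rewrite -mulrBr normrM (gtr0_norm h0) ler_pM2l//.
  have /andP[t1 t2] := tj j (ltnW jm); have /andP[t3 t4] := tj _ jm.
  have E := tS j jm; rewrite -/(tt j) -/(tt j.+1) in c1 c2.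
  apply: osc; rewrite ?ltr_norml; apply/andP; split;
    by move: t1 t2 t3 t4 E c1 c2 c3 c4 h0 hdl dl0; clear; lra.
have -> : h `^ (- al) * \sum_(j < m) D j * increment w h (m + k) j =
    h `^ (- al) * (\sum_(j < m) D j * (increment w h (m + k) j - h * y j)) +
    h `^ (1 - al) * \sum_(j < m) D j * y j.
  rewrite -hh -mulrA -mulrDr; congr (_ * _); rewrite mulr_sumr -big_split /=.
  by apply: eq_bigr => j _; ring.
apply: (le_trans (ler_normD _ _)); apply: lerD.
  rewrite normrM ger0_norm ?powR_ge0//.
  apply: (@le_trans _ _ (h `^ (- al) * ((S * m%:R `^ (1 - al)) * (h * e)))).
    rewrite ler_wpM2l ?powR_ge0// (le_trans (ler_norm_sum _ _ _))//.
    apply: (@le_trans _ _ (\sum_(j < m) `|D j| * (h * e))).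
      by apply: ler_sum => j _; rewrite normrM ler_wpM2l// hdiff.
    by rewrite -mulr_suml ler_wpM2r// mulr_ge0// ltW.
  have -> : h `^ (- al) * (S * m%:R `^ (1 - al) * (h * e)) =
    S * (m%:R `^ (1 - al) * h `^ (1 - al)) * e by rewrite -hh; ring.
  rewrite -powRM ?(ltW h0)// ler_wpM2r// ler_wpM2l//.
  apply: ge0_ler_powR; rewrite ?nnegrE ?(ltW q0)// ?mulr_ge0 ?(ltW h0)//.
  by apply: le_trans mhT; rewrite mulr_ge0// ltW.
rewrite normrM (gtr0_norm hq).
have := @abel_bound R D y m (sigma / h `^ (1 - al)) G (2 * G * h / dl).
have dli : 0 <= dl^-1 by rewrite invr_ge0 ltW.
have B0 : 0 <= 2 * G * h / dl by rewrite !mulr_ge0// ltW.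
rewrite divr_ge0 ?(ltW hq)// G0 B0 => /(_ isT isT isT) H.
rewrite -ler_pdivlMl//; apply: (le_trans (H _ _ _)).
- by move=> l lm; rewrite ler_pdivlMr// mulrC hD.
- move=> j jm; have [c /andP[c1 c2] ->] := yE j (ltnW jm); apply: gG.
  have /andP[t1 t2] := tj j (ltnW jm).
  by apply/andP; split; move: t1 t2 c1 c2; clear; lra.
- move=> j jm; have jm' := ltnW jm.
  have /andP[t1 t2] := tj j (ltnW jm'); have /andP[t3 t4] := tj _ jm'.
  have E := tS j jm'.
  have -> : y j - y j.+1 = ((w (tt j) - w (tt j.+1)) - (w (tt j - dl) - w (tt j.+1 - dl))) / dl.
    by rewrite /y -mulrBl; congr (_ / _); ring.
  rewrite normrM (ger0_norm dli) ler_wpM2r// (le_trans (ler_normB _ _))//.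
  have l1 : `|w (tt j) - w (tt j.+1)| <= G * h.
    have a1 : eta <= tt j.+1 by move: t3 dl0; clear; lra.
    have a2 : tt j.+1 < tt j by rewrite E ltrDl.
    apply: (le_trans (lip _ _ a1 a2 t2)).
    by rewrite E addrAC subrr add0r.
  have l2 : `|w (tt j - dl) - w (tt j.+1 - dl)| <= G * h.
    have a1 : eta <= tt j.+1 - dl by rewrite lerBrDr.
    have a2 : tt j.+1 - dl < tt j - dl by rewrite E ltrD2r ltrDl.
    have a3 : tt j - dl <= T by rewrite lerBlDr (le_trans t2)// lerDl ltW.
    apply: (le_trans (lip _ _ a1 a2 a3)).
    by rewrite E le_eqVlt; apply/orP; left; apply/eqP; ring.
  lra.
rewrite mulrAC [leRHS]mulrC ler_wpM2r ?invr_ge0 ?(ltW hq)//.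
rewrite ler_wpM2l// lerD2l.
have -> : m%:R * (2 * G * h / dl) = 2 * (m%:R * h) * G / dl by ring.
by rewrite ler_wpM2r ?invr_ge0 ?(ltW dl0)// ler_wpM2r// ler_wpM2l.
Qed.

(** This is [h `^ (- al)] times the convolution of [om] with the values of
    [w - w 0] on the grid, after summation by parts. *)
Definition discrete_caputo (R : realType) (al : R) (om : nat -> R)
    (w : R -> R) (h : R) (n : nat) : R :=
  h `^ (- al) * \sum_(j < n) partial_sum om j * increment w h n j.

Definition caputo_integrable (R : realType) (al T : R) (w : R -> R) : Prop :=
  forall t, 0 < t <= T -> (@lebesgue_measure R).-integrable `]0, t[
    (EFin \o caputo_integrand al w t).

(** The grid is cut at [k h], just after the length [eta] of an initial layer.
    The layer contributes a multiple of [(eta / eps) `^ al], to the sum as well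
    as to the integral; [eta] is fixed first.  Then comes the oscillation [e1]
    of [g] beyond the layer, which fixes the step [dl] of the difference
    quotients; only then does the closeness of the weights fix [h]. *)
Lemma truncation_small (R : realType) (al T Cw C : R) (om a : nat -> R)
    (w g : R -> R) :
  0 < al < 1 -> 0 < T -> good_weights al T om a Cw ->
  singular_C1 al T w g C -> caputo_integrable al T w ->
  forall eps e, 0 < eps -> 0 < e -> exists2 d, 0 < d &
    forall h (n : nat), 0 < h < d -> eps <= n%:R * h <= T ->
      `|discrete_caputo al om w h n - caputo al w (n%:R * h)| <= e.
Proof.
move=> hal T0 gw sc hint eps e eps0 e0; have /andP[al0 al1] := hal.
have q0 : 0 < 1 - al by rewrite subr_gt0.
have C0 := sc_C sc; have Cw0 := gw_C gw; have Ga0 := Gamma_gt0 hal.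
set Ga := Gamma (1 - al) in Ga0.
have Tq : 0 < T `^ (1 - al) by exact: powR_gt0.
have e4 : 0 < e / 4 by rewrite divr_gt0.
(* [Kc], [Ke] and [Ks] collect the constants that multiply the three
   contributions; adding 1 keeps them positive. *)
pose Kc := Cw * C / al + Ga^-1 * (C / al) + 1.
have Kc0 : 0 < Kc.
  by rewrite ltr_wpDl// addr_ge0 ?mulr_ge0 ?invr_ge0 ?(ltW al0) ?(ltW Ga0).
have /cvg_right0P/(_ _ (divr_gt0 e4 Kc0))[r0 r00 hr0] := powR_cvg0 al0.
pose eta := Num.min (eps / 4) (r0 * eps / 8).
have eta0 : 0 < eta by rewrite lt_min !divr_gt0 ?mulr_gt0.
have eta1 : eta <= eps / 4 by rewrite ge_min lexx.
have eta2 : eta <= r0 * eps / 8 by rewrite ge_min lexx orbT.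
pose S := Cw + (1 - al)^-1 / Ga.
have S0 : 0 <= S by rewrite addr_ge0 ?divr_ge0 ?invr_ge0 ?(ltW q0) ?(ltW Ga0).
pose Ke := S * T `^ (1 - al) + Ga^-1 * (T `^ (1 - al) / (1 - al)) + 1.
have Ke0 : 0 < Ke.
  by rewrite ltr_wpDl// addr_ge0 ?mulr_ge0 ?invr_ge0 ?(ltW q0) ?(ltW Ga0) ?(ltW Tq).
pose e1 := e / 4 / Ke.
have e10 : 0 < e1 by rewrite divr_gt0.
have eta20 : 0 < eta / 2 by rewrite divr_gt0.
have [d1 d10 hd1] := singular_C1_unif sc eta20 e10.
pose dl := Num.min (eta / 2) (d1 / 2).
have dl0 : 0 < dl by rewrite lt_min !divr_gt0.
have dl1 : dl <= eta / 2 by rewrite ge_min lexx.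
have dl2 : dl <= d1 / 2 by rewrite ge_min lexx orbT.
pose G := C * (eta / 2) `^ (al - 1).
have G0 : 0 <= G by rewrite mulr_ge0 ?powR_ge0.
have gG s : eta / 2 <= s <= T -> `|g s| <= G.
  move=> /andP[s1 s2]; have s0 : 0 < s by exact: lt_le_trans s1.
  apply: (le_trans (sc_g sc (introT andP (conj s0 s2)))).
  rewrite ler_wpM2l// -[al - 1]opprB !powRN lef_pV2 ?posrE ?powR_gt0//.
  by apply: ge0_ler_powR; rewrite ?nnegrE ?(ltW q0) ?(ltW eta20) ?(ltW s0)//.
clearbody G.
pose Ks := G + 2 * T * G / dl + 1.
have Ks0 : 0 < Ks.
  by rewrite ltr_wpDl// addr_ge0// !mulr_ge0 ?invr_ge0 ?(ltW T0) ?(ltW dl0).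
have [d2 d20 hd2] := gw_kernel gw (divr_gt0 e4 Ks0).
exists (Num.min d2 dl); first by rewrite lt_min d20.
move=> h n /andP[h0]; rewrite lt_min => /andP[hd2' hdl] /andP[nl nT].
pose k := (Num.truncn (eta / h)).+1.
have kh1 : eta < k%:R * h by rewrite -ltr_pdivrMr//; exact: truncnS_gt.
have kh2 : k%:R * h <= 2 * eta.
  have : (Num.truncn (eta / h))%:R <= eta / h.
    by rewrite truncn_le divr_ge0 ?(ltW eta0) ?(ltW h0).
  rewrite ler_pdivlMr// => H; rewrite /k -natr1 mulrDl mul1r; lra.
have kn : (k < n)%N.
  rewrite -(ltr_nat R) -(ltr_pM2r h0); lra.
pose m := (n - k)%N.
have nE : n = (m + k)%N by rewrite subnK// ltnW.
have m0 : (0 < m)%N by rewrite subn_gt0.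
have mhE : m%:R * h = n%:R * h - k%:R * h.
  by rewrite -mulrBl -natrB// ltnW.
have mh0 : eps / 2 <= m%:R * h by lra.
have kh0 : 0 < k%:R * h by exact: lt_trans kh1.
have rho : (k%:R * h / (m%:R * h)) `^ al <= e / 4 / Kc.
  have mh00 : 0 < m%:R * h by apply: lt_le_trans mh0; rewrite divr_gt0.
  have hr : 0 < k%:R * h / (m%:R * h) < r0.
    rewrite divr_gt0//= ltr_pdivrMr//.
    have h1 : r0 * (eps / 2) <= r0 * (m%:R * h) by rewrite ler_pM2l.
    have h2 : 0 < r0 * eps by rewrite mulr_gt0.
    lra.
  have := hr0 _ hr; rewrite subr0 ger0_norm ?powR_ge0//.
have t0 : 0 < n%:R * h by exact: lt_le_trans nl.
have hi := hint _ (introT andP (conj t0 nT)).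
have bt : k%:R * h < n%:R * h by rewrite ltr_pM2r// ltr_nat.
have hIhead := head_integral_le hal sc kh0 bt nT hi.
rewrite -mhE in hIhead.
have hi' := hi; have nT' := nT; rewrite nE in hi' nT'.
have osc1 s s' : k%:R * h <= s <= T -> k%:R * h <= s' <= T ->
    `|s - s'| < d1 -> `|g s - g s'| <= e1.
  have etak : eta / 2 <= k%:R * h by move: eta0 kh1; clear; lra.
  by move=> /andP[p1 p2] /andP[p3 p4]; apply: hd1; rewrite ?(le_trans etak).
have hd1' : h <= d1 by move: hdl dl2 d10; clear; lra.
have hItail := tail_integral_le hal sc h0 hd1' nT' (ltW e10) hi' osc1.
have hW j : 0 <= partial_sum om j <= Cw * j.+1%:R `^ (- al).
  by rewrite (gw_W_ge0 gw) (gw_W_le gw).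
have hShead := head_sum_le al0 Cw0 sc h0 nT' m0 hW.
pose D j := partial_sum om j - kernel_weight al j / Ga.
have DS : \sum_(j < m) `|D j| <= S * m%:R `^ (1 - al).
  apply: (@le_trans _ _ (\sum_(j < m) (partial_sum om j + kernel_weight al j / Ga))).
    apply: ler_sum => j _; rewrite (le_trans (ler_normB _ _))//.
    rewrite ger0_norm ?(gw_W_ge0 gw)// ger0_norm//.
    by rewrite divr_ge0 ?(ltW Ga0) ?kernel_weight_ge0.
  rewrite big_split /= mulrDl; apply: lerD; first exact: (gw_W_sum gw).
  rewrite -mulr_suml sum_kernel_weight//.
  by rewrite le_eqVlt; apply/orP; left; apply/eqP; ring.
have hStail : `|h `^ (- al) * \sum_(j < m) D j * increment w h (m + k) j|
    <= S * T `^ (1 - al) * e1 + e / 4 / Ks * (G + 2 * T * G / dl).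
  apply: (tail_sum_le hal sc h0 (ltW hdl) nT' (ltW e10) eta20) => //.
  - by move: dl1 kh1; clear; lra.
  - exact: ltW (divr_gt0 e4 Ks0).
  - move=> s s' hs hs' hss; apply: hd1 => //; apply: lt_le_trans hss _.
    by move: dl2; clear; lra.
  - move=> l lm; apply: hd2; first by rewrite h0.
    apply: le_trans nT'; rewrite ler_pM2r// ler_nat.
    exact: leq_trans lm (leq_addr _ _).
have kmE : discrete_caputo al om w h n - caputo al w (n%:R * h) =
  h `^ (- al) * (\sum_(j < m) D j * increment w h (m + k) j) +
  Ga^-1 * (h `^ (- al) * (\sum_(j < m) kernel_weight al j * increment w h (m + k) j) -
    \int[@lebesgue_measure R]_(s in `]k%:R * h, ((m + k)%:R * h)[)
      caputo_integrand al w ((m + k)%:R * h) s) +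
  (h `^ (- al) * (\sum_(j < k) partial_sum om (m + j)%N * increment w h (m + k) (m + j)) -
   Ga^-1 * \int[@lebesgue_measure R]_(s in `]0, (k%:R * h)[)
      caputo_integrand al w (n%:R * h) s).
  rewrite /caputo (Rintegral_oo_split (ltW kh0) (ltW bt) hi) -/Ga {1 2 3}nE.
  rewrite /discrete_caputo big_split_ord /=.
  have -> : \sum_(i < m) partial_sum om i * increment w h (m + k) i =
     \sum_(j < m) D j * increment w h (m + k) j +
     Ga^-1 * \sum_(j < m) kernel_weight al j * increment w h (m + k) j.
    rewrite mulr_sumr -big_split /=; apply: eq_bigr => j _; rewrite /D; ring.
  rewrite -nE; ring.
rewrite kmE.
have b1 : S * T `^ (1 - al) * e1 + Ga^-1 * (e1 * (T `^ (1 - al) / (1 - al))) <= e / 4.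
  rewrite [leRHS](_ : _ = e1 * Ke); last by rewrite /e1 divfK ?gt_eqF.
  by rewrite /Ke mulrDr mulr1 -subr_ge0 (_ : _ - _ = e1); [exact: ltW|ring].
have b2 : e / 4 / Ks * (G + 2 * T * G / dl) <= e / 4.
  rewrite -[leRHS](divfK (lt0r_neq0 Ks0)); apply: ler_wpM2l.
    exact: ltW (divr_gt0 e4 Ks0).
  by rewrite /Ks lerDl.
have b3 : (Cw * C / al + Ga^-1 * (C / al)) * (k%:R * h / (m%:R * h)) `^ al <= e / 4.
  rewrite -[leRHS](divfK (lt0r_neq0 Kc0)) [leLHS]mulrC.
  apply: ler_pM => //; first exact: powR_ge0.
    by rewrite addr_ge0 ?mulr_ge0 ?invr_ge0 ?(ltW al0) ?(ltW Ga0).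
  by rewrite /Kc lerDl.
have n1 : `|Ga^-1 * (h `^ (- al) * (\sum_(j < m) kernel_weight al j * increment w h (m + k) j) -
    \int[@lebesgue_measure R]_(s in `]k%:R * h, ((m + k)%:R * h)[)
      caputo_integrand al w ((m + k)%:R * h) s)| <= Ga^-1 * (e1 * (T `^ (1 - al) / (1 - al))).
  by rewrite normrM gtr0_norm ?invr_gt0// ler_wpM2l ?invr_ge0 ?(ltW Ga0).
have n2 : `|Ga^-1 * \int[@lebesgue_measure R]_(s in `]0, (k%:R * h)[)
      caputo_integrand al w (n%:R * h) s| <= Ga^-1 * (C / al) * (k%:R * h / (m%:R * h)) `^ al.
  by rewrite normrM gtr0_norm ?invr_gt0// -mulrA ler_wpM2l ?invr_ge0 ?(ltW Ga0).
rewrite mulrDl in b3.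
apply: (le_trans (ler_normD _ _)).
apply: (le_trans (lerD (ler_normD _ _) (ler_normB _ _))).
move: e0 b1 b2 b3 (lerD (lerD hStail n1) (lerD hShead n2)); clear; lra.
Qed.

(** Let [t = n h].  For the cells in the half nearer to 0 the weights are of
    order [n `^ (- al)]; for the others the increments are of order
    [h * t `^ (al - 1)], and the weights sum to order [n `^ (1 - al)]. *)
Lemma discrete_caputo_bounded (R : realType) (al T Cw C : R) (om a : nat -> R)
    (w g : R -> R) (h : R) (n : nat) :
  0 < al < 1 -> good_weights al T om a Cw -> singular_C1 al T w g C ->
  0 < h -> (0 < n)%N -> n%:R * h <= T ->
  `|discrete_caputo al om w h n| <= 3 * (Cw * C / al).
Proof.
move=> hal gw sc h0 n0 nT; have /andP[al0 al1] := hal.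
have C0 := sc_C sc; have Cw0 := gw_C gw.
have q0 : 0 < 1 - al by rewrite subr_gt0.
(* [m] is rounded up so as to be positive even if [n = 1]. *)
pose m := uphalf n; pose k := n./2.
have nE : n = (m + k)%N by rewrite /m /k; clear; lia.
have m0 : (0 < m)%N by rewrite /m; clear -n0; lia.
have km : (k <= m)%N by rewrite /m /k; clear; lia.
have n0' : 0 < n%:R :> R by rewrite ltr0n.
have m0' : 0 < m%:R :> R by rewrite ltr0n.
have hW j : 0 <= partial_sum om j <= Cw * j.+1%:R `^ (- al).
  by rewrite (gw_W_ge0 gw) (gw_W_le gw).
have nT' := nT; rewrite nE in nT'.
have H1 := head_sum_le al0 Cw0 sc h0 nT' m0 hW.
have r1 : (k%:R * h / (m%:R * h)) `^ al <= 1.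
  have e1 : 1 = 1 `^ al :> R by rewrite powR1.
  rewrite [leRHS]e1; apply: ge0_ler_powR; rewrite ?nnegrE ?(ltW al0)//.
    by rewrite divr_ge0 ?mulr_ge0 ?(ltW h0).
  by rewrite ler_pdivrMr ?mulr_gt0// mul1r ler_pM2r// ler_nat.
have H2 : `|h `^ (- al) * \sum_(j < m) partial_sum om j * increment w h (m + k) j|
    <= 2 * (Cw * C / al).
  rewrite normrM ger0_norm ?powR_ge0//.
  have inc j : (j < m)%N -> `|increment w h (m + k) j| <=
      C / al * (h `^ al * (2 * n%:R `^ (al - 1))).
    move=> jm; rewrite /increment.
    have sp : (m + k - j.+1)%N%:R * h <= (m + k - j)%N%:R * h.
      by rewrite ler_pM2r// ler_nat; clear; lia.
    have s0 : 0 <= (m + k - j.+1)%N%:R * h by rewrite mulr_ge0// ltW.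
    have sT : (m + k - j)%N%:R * h <= T.
      by apply: le_trans nT'; rewrite ler_pM2r// ler_nat leq_subr.
    apply: (le_trans (singular_C1_increment al0 sc s0 sp sT)).
    rewrite ler_wpM2l ?divr_ge0 ?(ltW al0)//.
    rewrite !powRM ?ler0n ?(ltW h0)// -mulrBl mulrC ler_wpM2l ?powR_ge0//.
    have iE : (m + k - j = (m + k - j.+1).+1)%N by clear -jm; lia.
    rewrite iE; apply: (le_trans (powR_succ_sub_le _ hal)); rewrite -iE.
    have hi : n%:R / 2 <= (m + k - j)%N%:R :> R.
      by rewrite ler_pdivrMr// -natrM ler_nat {1}nE; clear -jm km; lia.
    rewrite -[al - 1]opprB !powRN.
    apply: (@le_trans _ _ ((n%:R / 2) `^ (1 - al))^-1).
      have hi0 : 0 < n%:R / 2 :> R by rewrite divr_gt0.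
      rewrite lef_pV2 ?posrE ?powR_gt0//; last exact: lt_le_trans hi.
      by apply: ge0_ler_powR; rewrite ?nnegrE ?(ltW q0) ?(ltW hi0).
    rewrite powRM ?ler0n ?invr_ge0// invfM mulrC.
    rewrite ler_wpM2r ?invr_ge0 ?powR_ge0// -powR_inv1// -powRrM mulN1r -powRN opprK.
    by rewrite -[leRHS]powRr1// ler_powR ?ler1n// gerBl ltW.
  apply: (@le_trans _ _ (h `^ (- al) * ((Cw * n%:R `^ (1 - al)) *
      (C / al * (h `^ al * (2 * n%:R `^ (al - 1))))))).
    rewrite ler_wpM2l ?powR_ge0// (le_trans (ler_norm_sum _ _ _))//.
    apply: (@le_trans _ _ (\sum_(j < m) partial_sum om j *
        (C / al * (h `^ al * (2 * n%:R `^ (al - 1)))))).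
      apply: ler_sum => j _; rewrite normrM ger0_norm ?(gw_W_ge0 gw)//.
      by rewrite ler_wpM2l ?(gw_W_ge0 gw)// inc.
    rewrite -mulr_suml ler_wpM2r//.
      by rewrite mulr_ge0 ?divr_ge0 ?(ltW al0)// mulr_ge0 ?powR_ge0// mulr_ge0 ?powR_ge0.
    apply: (le_trans (gw_W_sum gw m)); rewrite ler_wpM2l//.
    by apply: ge0_ler_powR; rewrite ?nnegrE ?(ltW q0)// ler_nat /m; clear; lia.
  have E1 : h `^ (- al) * h `^ al = 1 by rewrite powRN mulVf ?gt_eqF ?powR_gt0.
  have E2 : n%:R `^ (1 - al) * n%:R `^ (al - 1) = 1 :> R.
    by rewrite -[al - 1]opprB powRN mulfV ?gt_eqF ?powR_gt0.
  rewrite (_ : h `^ (- al) * _ = h `^ (- al) * h `^ al *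
    (n%:R `^ (1 - al) * n%:R `^ (al - 1)) * (2 * (Cw * C / al))); last by ring.
  by rewrite E1 E2 !mul1r.
rewrite {1}nE /discrete_caputo big_split_ord /= mulrDr.
apply: (le_trans (ler_normD _ _)); apply: (le_trans (lerD H2 H1)).
have K0 : 0 <= Cw * C / al by rewrite divr_ge0 ?mulr_ge0 ?(ltW al0).
have := ler_wpM2l K0 r1; lra.
Qed.

(** The bound on the discrete derivatives passes to the limit. *)
Lemma caputo_bounded (R : realType) (al T Cw C t : R) (om a : nat -> R)
    (w g : R -> R) :
  0 < al < 1 -> 0 < T -> good_weights al T om a Cw ->
  singular_C1 al T w g C -> caputo_integrable al T w -> 0 < t <= T ->
  `|caputo al w t| <= 3 * (Cw * C / al).
Proof.
move=> hal T0 gw sc hint /andP[t0 tT]; apply/ler_addgt0Pr => e e0.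
have [d d0 hd] := truncation_small hal T0 gw sc hint t0 e0.
pose n := (Num.truncn (t / d)).+1.
have n0 : 0 < n%:R :> R by rewrite ltr0n.
pose h := t / n%:R.
have h0 : 0 < h by rewrite divr_gt0.
have hlt : h < d by rewrite ltr_pdivrMr// mulrC -ltr_pdivrMr//; exact: truncnS_gt.
have nh : n%:R * h = t by rewrite mulrC divfK ?gt_eqF.
have := hd h n; rewrite h0 hlt nh lexx tT => /(_ isT isT) H.
have := @discrete_caputo_bounded _ al T Cw C om a w g h n hal gw sc h0.
rewrite nh => /(_ isT tT) H2.
rewrite -[caputo al w t](subKr (discrete_caputo al om w h n)).
by rewrite (le_trans (ler_normB _ _))// lerD.
Qed.

(** * Stability of the scheme *)

Lemma sum_ord_split (R : nmodType) (F : nat -> R) (n m k : nat) :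
  n = (m + k)%N ->
  \sum_(j < n) F j = \sum_(j < m) F j + \sum_(j < k) F (m + j)%N.
Proof. by move=> ->; rewrite big_split_ord. Qed.

(** The mass of [h `^ al * a] on intervals of length [eps] is at most of order
    [eps `^ al], so errors that are bounded everywhere and small away from
    [t = 0] have small convolutions with it. *)
Lemma weighted_error_small (R : realType) (al T Cw B : R) (om a : nat -> R)
    (r : R -> nat -> R) :
  0 < al -> 0 < T -> good_weights al T om a Cw ->
  (forall h (n : nat), 0 < h -> (0 < n)%N -> n%:R * h <= T -> 0 <= r h n <= B) ->
  (forall eps e, 0 < eps -> 0 < e -> exists2 d, 0 < d &
    forall h (n : nat), 0 < h < d -> eps <= n%:R * h <= T -> r h n <= e) ->
  forall e, 0 < e -> exists2 d, 0 < d &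
    forall h (n : nat), 0 < h < d -> n%:R * h <= T ->
      h `^ al * \sum_(j < n) a j * r h (n - j)%N <= e.
Proof.
move=> al0 T0 gw rB rsmall e e0; have Cw0 := gw_C gw.
have Tal : 0 < T `^ al by exact: powR_gt0.
have e2 : 0 < e / 2 by rewrite divr_gt0.
have K10 : 0 < `|B| * Cw + 1 by rewrite ltr_wpDl// mulr_ge0.
have K20 : 0 < Cw * T `^ al + 1 by rewrite ltr_wpDl// mulr_ge0// ltW.
have /cvg_right0P/(_ _ (divr_gt0 e2 K10))[d0 d00 hd0] := powR_cvg0 al0.
pose eps := d0 / 2.
have eps0 : 0 < eps by rewrite divr_gt0.
have epsal : `|B| * Cw * eps `^ al <= e / 2.
  have he : 0 < eps < d0 by rewrite eps0 /eps ltr_pdivrMr// ltr_pMr// ltr1n.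
  have := hd0 _ he; rewrite subr0 ger0_norm ?powR_ge0// ler_pdivlMr//.
  by rewrite mulrDr mulr1 mulrC => H; have := powR_ge0 eps al; lra.
have [d dp hd] := rsmall eps (e / 2 / (Cw * T `^ al + 1)) eps0 (divr_gt0 e2 K20).
exists d => // h n hh nT; have /andP[h0 _] := hh.
set e1 := e / 2 / _ in hd.
have e10 : 0 < e1 by rewrite divr_gt0.
have rabs h' (i : nat) : 0 < h' -> (0 < i)%N -> i%:R * h' <= T -> r h' i <= `|B|.
  move=> p1 p2 p3; have /andP[_ h2] := rB h' i p1 p2 p3.
  exact: le_trans h2 (ler_norm _).
have step i : (i <= n)%N -> i%:R * h <= T.
  by move=> hi; apply: le_trans nT; rewrite ler_pM2r// ler_nat.
have hTn : h `^ al * (\sum_(j < n) a j) <= Cw * T `^ al.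
  apply: (@le_trans _ _ (h `^ al * (Cw * n%:R `^ al))).
    by rewrite ler_wpM2l ?powR_ge0// (gw_a_sum gw).
  rewrite mulrCA ler_wpM2l// mulrC -powRM ?(ltW h0)//.
  by apply: ge0_ler_powR; rewrite ?nnegrE ?(ltW al0) ?mulr_ge0 ?(ltW h0) ?(ltW T0).
pose k := Num.truncn (eps / h).
have kh : k%:R * h <= eps.
  rewrite -ler_pdivlMr// /k truncn_le divr_ge0 ?(ltW eps0) ?(ltW h0)//.
have kh' i : (k < i)%N -> eps <= i%:R * h.
  move=> ki; rewrite -ler_pdivrMr//; apply: ltW.
  by apply: lt_le_trans (truncnS_gt _) _; rewrite ler_nat.
have hk : h `^ al * (`|B| * \sum_(j < k) a j) <= e / 2.
  apply: le_trans epsal.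
  apply: (@le_trans _ _ (h `^ al * (`|B| * (Cw * k%:R `^ al)))).
    by rewrite ler_wpM2l ?powR_ge0// ler_wpM2l// (gw_a_sum gw).
  have -> : h `^ al * (`|B| * (Cw * k%:R `^ al)) = `|B| * Cw * (k%:R * h) `^ al.
    by rewrite powRM ?(ltW h0)//; ring.
  rewrite ler_wpM2l ?mulr_ge0//.
  by apply: ge0_ler_powR => //; rewrite ?nnegrE ?(ltW al0) ?(ltW eps0)// mulr_ge0// ltW.
have smallpart m : (m <= n)%N -> h `^ al * (\sum_(j < m) a j * e1) <= e / 2.
  move=> mn; rewrite -mulr_suml mulrA.
  apply: (@le_trans _ _ (h `^ al * (\sum_(j < n) a j) * e1)).
    rewrite ler_wpM2r ?(ltW e10)// ler_wpM2l ?powR_ge0//.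
    rewrite -(subnKC mn) big_split_ord /= lerDl.
    by apply: sumr_ge0 => j _; exact: (gw_a_ge0 gw).
  apply: (@le_trans _ _ ((Cw * T `^ al + 1) * e1)).
    by rewrite ler_wpM2r ?(ltW e10)// (le_trans hTn)// lerDl.
  by rewrite /e1 mulrC divfK ?gt_eqF.
have [kn|nk] := leqP k n.
  pose m := (n - k)%N; have nE : n = (m + k)%N by rewrite subnK.
  rewrite (sum_ord_split (fun j => a j * r h (n - j)%N) nE) mulrDr (splitr e) lerD//.
    apply: le_trans (smallpart m (leq_subr _ _)).
    rewrite ler_wpM2l ?powR_ge0//; apply: ler_sum => j _.
    rewrite ler_wpM2l ?(gw_a_ge0 gw)//; apply: hd => //.
    rewrite step ?leq_subr// andbT; apply: kh'.
    by rewrite ltn_subRL addnC -ltn_subRL; exact: ltn_ord.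
  apply: le_trans hk; rewrite ler_wpM2l ?powR_ge0// mulr_sumr.
  apply: ler_sum => j _; have jk := ltn_ord j.
  have jn : (0 < n - (m + j))%N by rewrite subn_gt0 nE ltn_add2l.
  rewrite mulrC; apply: ler_pM.
  - by have /andP[] := rB h _ h0 jn (step _ (leq_subr _ _)).
  - exact: (gw_a_ge0 gw).
  - by apply: rabs => //; apply: step; exact: leq_subr.
  - by apply: noninc_seq_le (gw_a_noninc gw) _; exact: leq_addl.
apply: (@le_trans _ _ (e / 2)); last by rewrite ler_pdivrMr// ler_peMr ?(ltW e0)// ler1n.
apply: le_trans hk; rewrite ler_wpM2l ?powR_ge0// mulr_sumr.
rewrite -(subnKC (ltnW nk)) big_split_ord /= -[leLHS]addr0 lerD//; last first.
  by apply: sumr_ge0 => j _; rewrite mulr_ge0 ?(gw_a_ge0 gw).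
apply: ler_sum => j _; rewrite mulrC ler_wpM2r ?(gw_a_ge0 gw)//.
have jn := ltn_ord j; apply: rabs => //; first by rewrite subn_gt0.
by apply: step; exact: leq_subr.
Qed.

(** Nonnegativity of [a] turns the differential form of the inequality into
    its integral form. *)
Lemma conv_inverse_le (R : realType) (w a E rho : nat -> R) (n : nat) :
  conv_inverse w a -> (forall k, 0 <= a k) -> E 0%N = 0 ->
  (forall i, (0 < i <= n)%N -> conv w E i <= rho i) ->
  E n <= \sum_(j < n) a j * rho (n - j)%N.
Proof.
move=> hwa a0 E0 H.
have -> : E n = conv a (conv w E) n.
  rewrite convA (eq_conv (u' := @delta_d R) (v' := E))// ?conv_delta//.
  by move=> i; rewrite convC hwa.
rewrite {1}/conv big_ord_recr /= subnn {2}/conv big_ord1 E0 !mulr0 addr0.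
apply: ler_sum => j _; rewrite ler_wpM2l// H// subn_gt0 ltn_ord leq_subr//.
Qed.

(** A discrete Gronwall inequality: in the norm weighted by
    [expR (- lam * n h)], convolution with [A * a] is a contraction of factor
    1/2. *)
Lemma gronwall (R : realType) (a E : nat -> R) (A delta lam h : R) (N : nat) :
  0 <= A -> 0 < h -> 0 <= lam -> 0 <= delta -> (forall k, 0 <= a k) ->
  (forall n, A * \sum_(j < n) a j * expR (- (lam * h)) ^+ j <= 2^-1) ->
  E 0%N = 0 ->
  (forall n, (n <= N)%N ->
     E n <= delta + A * \sum_(j < n) a j * E (n - j)%N) ->
  forall n, (n <= N)%N -> E n <= 2 * delta * expR (lam * h) ^+ n.
Proof.
move=> A0 h0 lam0 del0 a0 hA E0 hE; elim/ltn_ind => n IH nN.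
set x := expR (lam * h).
have x0 : 0 < x by exact: expR_gt0.
have x1 : 1 <= x by rewrite -[leLHS]expR0 ler_expR mulr_ge0// ltW.
have xi : expR (- (lam * h)) = x^-1 by rewrite expRN.
case: n IH nN => [|n] IH nN; first by rewrite E0 expr0 mulr1 mulr_ge0.
have xn : 1 <= x ^+ n.+1 by exact: exprn_ege1.
have := hE _ nN; rewrite big_ord_recl subn0 => H1.
have := hA n.+1; rewrite big_ord_recl expr0 mulr1 => H2.
set X := 2 * delta * x ^+ n.+1.
have H3 : \sum_(i < n) a (bump 0 i) * E (n.+1 - bump 0 i)%N <=
    (\sum_(i < n) a (bump 0 i) * expR (- (lam * h)) ^+ (bump 0 i)) * X.
  rewrite mulr_suml; apply: ler_sum => i _; have ni := ltn_ord i.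
  rewrite -mulrA ler_wpM2l// /bump /= add1n subSS.
  apply: (le_trans (IH _ _ _)); first by rewrite ltnS leq_subr.
    by apply: leq_trans (leq_subr _ _) (ltnW nN).
  rewrite -/x xi /X mulrCA ler_wpM2l ?mulr_ge0//.
  rewrite (_ : n.+1 = (i.+1 + (n - i))%N); last by rewrite addSn subnKC// ltnW.
  by rewrite exprD mulrA -exprMn mulVf ?gt_eqF// expr1n mul1r.
have X0 : 0 <= X by rewrite /X !mulr_ge0// exprn_ge0// ltW.
have dX : 2 * delta <= X by rewrite /X ler_peMr// mulr_ge0.
move: H1 H2 H3; rewrite /=.
set s1 := \sum_(i < n) a (bump 0 i) * E _; set s2 := \sum_(i < n) _.
move=> H1 H2 H3; rewrite leNgt; apply/negP => H4.
have H5 : A * s1 <= A * s2 * X by rewrite -mulrA ler_wpM2l.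
have H6 : A * a 0%N * E n.+1 <= 2^-1 * E n.+1 - A * s2 * X.
  have s20 : 0 <= A * s2.
    by rewrite mulr_ge0//; apply: sumr_ge0 => i _; rewrite mulr_ge0// exprn_ge0// expR_ge0.
  have H7 : (A * a 0%N + A * s2) * E n.+1 <= 2^-1 * E n.+1.
    by rewrite ler_wpM2r ?(le_trans X0 (ltW H4))// -mulrDr.
  have H8 : A * s2 * X <= A * s2 * E n.+1 by rewrite ler_wpM2l// ltW.
  lra.
lra.
Qed.

(** * Regularity of the components of the solution *)

Lemma is_derive_of_quotient (R : realType) (f : R -> R) (t l : R) :
  (forall e, 0 < e -> exists2 d, 0 < d & forall s, s != t -> `|s - t| < d ->
     `|(f s - f t) / (s - t) - l| <= e) ->
  is_derive t (1 : R) f l.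
Proof.
move=> H.
have cv : (h^-1 *: ((f \o shift t) (h *: (1 : R)) - f t)) @[h --> (0 : R)^'] --> l.
  apply/cvgrPdist_le => e e0; have [d d0 hd] := H e e0.
  rewrite /dnbhs near_withinE; apply/nbhs_ballP; exists d => //= h.
  rewrite /ball /= sub0r normrN => hd' h0.
  have := hd (h + t); rewrite addrK distrC.
  rewrite -subr_eq0 addrK => /(_ h0 hd').
  by rewrite /GRing.scale /= mulr1 mulrC.
apply: DeriveDef; first by apply/cvg_ex; exists l.
by apply/cvg_lim.
Qed.

Lemma continuous_eps (R : realType) (f : R -> R) (t e : R) :
  {for t, continuous f} -> 0 < e ->
  exists2 d, 0 < d & forall s, `|s - t| < d -> `|f s - f t| <= e.
Proof.
move=> cf e0.
have /nbhs_ballP[d d0 H] : \forall s \near t, `|f t - f s| <= e.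
  exact: (cvgrPdist_le _ _).1 cf e e0.
by exists d => // s hs; rewrite distrC; apply: H; rewrite /ball /= distrC.
Qed.

Lemma within_eps (R : realType) (A : set R) (f : R -> R) :
  {within A, continuous f} <->
  forall t, A t -> forall e, 0 < e -> exists2 d, 0 < d &
    forall s, A s -> `|s - t| < d -> `|f s - f t| <= e.
Proof.
split.
  move=> /subspace_continuousP cf t At e e0.
  have := (cvgrPdist_le _ _).1 (cf t At) e e0; rewrite near_withinE => h.
  have /nbhs_ballP[d d0 H] : nbhs t (fun s => A s -> `|f t - f s| <= e) by exact: h.
  exists d => // s As hs; rewrite distrC.
  by apply: H => //; rewrite /ball /= distrC.
move=> H; apply/subspace_continuousP => t At; apply/cvgrPdist_le => e e0.
have [d d0 hd] := H t At e e0; rewrite near_withinE; apply/nbhs_ballP.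
by exists d => //= s; rewrite /ball /= distrC => hs As; rewrite distrC; exact: hd.
Qed.

Lemma singular_C1_powR (R : realType) (al p T : R) :
  0 < al <= p -> 0 < T ->
  singular_C1 al T (fun t => t `^ p) (fun t => p * t `^ (p - 1))
    (p * T `^ (p - al)).
Proof.
move=> /andP[al0 alp] T0; have p0 : 0 < p by exact: lt_le_trans alp.
split.
- by rewrite mulr_ge0 ?powR_ge0// ltW.
- apply/continuous_within_itvP => //; split.
  + by move=> x; rewrite in_itv /= => /andP[x0 _]; exact: continuous_powR.
  + exact: powR_cvg_right.
  + by apply: cvg_at_left_filter; exact: continuous_powR.
- by move=> t /andP[t0 _]; exact: is_derive1_powR.
- move=> t /andP[t0 _] e e0.
  have [d d0 hd] := continuous_eps (continuous_powR (p := p - 1) t0) (divr_gt0 e0 p0).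
  exists d => // s _ /hd; rewrite -mulrBr normrM gtr0_norm// ler_pdivlMr//.
  by rewrite mulrC.
- move=> t /andP[t0 tT]; rewrite ger0_norm ?mulr_ge0 ?powR_ge0 ?(ltW p0)//.
  rewrite -mulrA ler_wpM2l ?(ltW p0)//.
  have -> : p - 1 = (p - al) + (al - 1) by ring.
  rewrite powRD; last by rewrite (gt_eqF t0) implybT.
  rewrite ler_wpM2r ?powR_ge0//.
  by apply: ge0_ler_powR; rewrite ?nnegrE ?subr_ge0 ?(ltW t0) ?(ltW T0).
Qed.

Lemma singular_C1D (R : realType) (al T C C' : R) (w w' g g' : R -> R) :
  singular_C1 al T w g C -> singular_C1 al T w' g' C' ->
  singular_C1 al T (fun t => w t + w' t) (fun t => g t + g' t) (C + C').
Proof.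
move=> [C0 c d gc gb] [C0' c' d' gc' gb']; split.
- exact: addr_ge0.
- by move=> x; apply: cvgD; [exact: c|exact: c'].
- by move=> t ht; have h1 := d t ht; have h2 := d' t ht; exact: is_deriveD.
- move=> t ht e e0; have e2 : 0 < e / 2 by rewrite divr_gt0.
  have [d1 d10 h1] := gc t ht _ e2; have [d2 d20 h2] := gc' t ht _ e2.
  exists (Num.min d1 d2); first by rewrite lt_min d10.
  move=> s hs; rewrite lt_min => /andP[s1 s2].
  have -> : g s + g' s - (g t + g' t) = (g s - g t) + (g' s - g' t) by ring.
  by rewrite (le_trans (ler_normD _ _))// (splitr e) lerD ?h1 ?h2.
- move=> t ht; rewrite mulrDl (le_trans (ler_normD _ _))// lerD//.
    exact: gb.
  exact: gb'.
Qed.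

Lemma singular_C1Z (R : realType) (al T C c : R) (w g : R -> R) :
  singular_C1 al T w g C ->
  singular_C1 al T (fun t => c * w t) (fun t => c * g t) (`|c| * C).
Proof.
move=> [C0 cw d gc gb]; split.
- by rewrite mulr_ge0.
- by move=> x; apply: cvgM; [exact: cvg_cst|exact: cw].
- move=> t ht; have h1 := d t ht; exact: is_deriveZ.
- move=> t ht e e0; have c1 : 0 < `|c| + 1 by rewrite ltr_wpDl.
  have [d1 d10 h1] := gc t ht _ (divr_gt0 e0 c1); exists d1 => // s hs /(h1 s hs).
  rewrite ler_pdivlMr// -mulrBr normrM => H; apply: le_trans H.
  by rewrite mulrC ler_wpM2l// lerDl.
- by move=> t ht; rewrite normrM -mulrA ler_wpM2l// gb.
Qed.

Lemma eq_singular_C1 (R : realType) (al T C : R) (w w' g : R -> R) :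
  (forall t, 0 <= t <= T -> w t = w' t) ->
  singular_C1 al T w g C -> singular_C1 al T w' g C.
Proof.
move=> ww [C0 c d gc gb]; split => //.
- apply/within_eps => t; rewrite /= in_itv /= => ht e e0.
  have [d0 d00 h] := (within_eps _ _).1 c t ht e e0; exists d0 => // s.
  by rewrite /= in_itv /= => hs; rewrite -!ww//; exact: h.
- move=> t ht; apply: near_eq_is_derive (d t ht).
  have : nbhs t `]0, T[%classic.
    by apply: open_nbhs_nbhs; split; [exact: interval_open|rewrite /= in_itv].
  apply: filterS => s; rewrite /= in_itv /= => /andP[s0 sT].
  by apply: ww; rewrite !ltW.
Qed.

(** Only the bound on the derivative needs an argument: [df] is bounded, and
    [t `^ (al - 1)] is bounded below on [`]0, T]]. *)
Lemma singular_C1_of_C1 (R : realType) (al T : R) (f df : R -> R) :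
  0 < al < 1 -> 0 < T -> {within `[0, T], continuous df} ->
  (forall t, 0 <= t <= T ->
    (f s - f t) / (s - t) @[s --> within `[0, T] t^'] --> df t) ->
  exists C, singular_C1 al T f df C.
Proof.
move=> /andP[al0 al1] T0 cdf hq.
have q t : 0 <= t <= T -> forall e, 0 < e -> exists2 d, 0 < d &
    forall s, 0 <= s <= T -> s != t -> `|s - t| < d ->
      `|(f s - f t) / (s - t) - df t| <= e.
  move=> ht e e0; have := (cvgrPdist_le _ _).1 (hq t ht) e e0.
  rewrite near_withinE /dnbhs near_withinE => h.
  have /nbhs_ballP[d d0 H] : nbhs t (fun s => s != t -> `[0, T]%classic s ->
      `|df t - (f s - f t) / (s - t)| <= e) by exact: h.
  exists d => // s hs st hd; rewrite distrC; apply: H => //.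
    by rewrite /ball /= distrC.
have cn : {within `[0, T], continuous (fun t => `|df t|)}.
  by move=> x; apply: cvg_norm; exact: cdf.
have [c hc hmax] := EVT_max (ltW T0) cn.
have bd t : 0 <= t <= T -> `|df t| <= `|df c| by move=> ht; apply: hmax; rewrite in_itv.
exists (`|df c| * T `^ (1 - al)); split.
- by rewrite mulr_ge0 ?powR_ge0.
- apply/within_eps => t; rewrite /= in_itv /= => ht e e0.
  have [d d0 hd] := q t ht 1 ltr01.
  have k0 : 0 < `|df t| + 1 by rewrite ltr_wpDl.
  exists (Num.min d (e / (`|df t| + 1))); first by rewrite lt_min d0 divr_gt0.
  move=> s; rewrite /= in_itv /= lt_min => hs /andP[s1 s2].
  have [->|st] := eqVneq s t; first by rewrite subrr normr0 ltW.
  have st0 : s - t != 0 by rewrite subr_eq0.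
  have h1 := hd s hs st s1.
  have h2 : `|(f s - f t) / (s - t)| <= `|df t| + 1.
    rewrite -[X in `|X|](subrK (df t)) addrC.
    by rewrite (le_trans (ler_normD _ _))// lerD2l.
  rewrite -[f s - f t](divfK st0) normrM.
  apply: (@le_trans _ _ ((`|df t| + 1) * (e / (`|df t| + 1)))).
    by rewrite ler_pM// ltW.
  by rewrite mulrC divfK ?gt_eqF.
- move=> t /andP[t0 tT]; apply: is_derive_of_quotient => e e0.
  have ht : 0 <= t <= T by rewrite !ltW.
  have [d d0 hd] := q t ht e e0.
  exists (Num.min d (Num.min t (T - t))).
    by rewrite !lt_min d0 t0 subr_gt0.
  move=> s st; rewrite !lt_min => /and3P[s1 s2 s3]; apply: hd => //.
  move: s2 s3; rewrite !ltr_norml => /andP[? ?] /andP[? ?].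
  by apply/andP; split; lra.
- move=> t /andP[t0 tT] e e0.
  have At s : 0 < s <= T -> `[0, T]%classic s.
    by move=> /andP[s0 sT]; rewrite /= in_itv /= sT ltW.
  have [d d0 hd] := (within_eps _ _).1 cdf t (At t (introT andP (conj t0 tT))) e e0.
  by exists d => // s hs; apply: hd; exact: At.
- move=> t /andP[t0 tT]; apply: (le_trans (bd t _)); first by rewrite ltW.
  rewrite -mulrA ler_peMr// -[al - 1]opprB powRN ler_pdivlMr ?powR_gt0// mul1r.
  by apply: ge0_ler_powR; rewrite ?nnegrE ?subr_ge0 ?(ltW al1) ?(ltW t0) ?(ltW T0).
Qed.

Lemma singular_C1_expansion (R : realType) (al T : R) (w f df : R -> R)
    (c : nat -> R) (M : nat) :
  0 < al < 1 -> 0 < T -> {within `[0, T], continuous df} ->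
  (forall t, 0 <= t <= T ->
    (f s - f t) / (s - t) @[s --> within `[0, T] t^'] --> df t) ->
  (forall t, 0 <= t <= T ->
    w t = \sum_(1 <= m < M.+1) c m * t `^ (m%:R * al) + f t) ->
  exists g C, singular_C1 al T w g C.
Proof.
move=> hal T0 cdf hq hw; have /andP[al0 al1] := hal.
suff [g [C H]] : exists g C, singular_C1 al T
    (fun t => \sum_(1 <= m < M.+1) c m * t `^ (m%:R * al) + f t) g C.
  by exists g, C; apply: eq_singular_C1 H => t ht; rewrite hw.
clear hw; elim: M => [|M [g [C IH]]].
  have [C HC] := singular_C1_of_C1 hal T0 cdf hq; exists df, C.
  by apply: eq_singular_C1 HC => t _; rewrite big_nil add0r.
have hp : 0 < al <= M.+1%:R * al by rewrite al0 ler_peMl ?(ltW al0)// ler1n.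
eexists; eexists; apply: eq_singular_C1 (singular_C1D IH
  (singular_C1Z (c M.+1) (singular_C1_powR hp T0))) => t _.
by rewrite [in RHS]big_nat_recr//= addrAC.
Qed.

(** * The energy inequality *)

Lemma dotC (R : realType) (d : nat) (x y : 'rV[R]_d) : dot x y = dot y x.
Proof. by apply: eq_bigr => i _; rewrite mulrC. Qed.

Lemma dotDr (R : realType) (d : nat) (x y z : 'rV[R]_d) :
  dot x (y + z) = dot x y + dot x z.
Proof. by rewrite -big_split /=; apply: eq_bigr => i _; rewrite mxE mulrDr. Qed.

Lemma dotZr (R : realType) (d : nat) (a : R) (x y : 'rV[R]_d) :
  dot x (a *: y) = a * dot x y.
Proof. by rewrite mulr_sumr; apply: eq_bigr => i _; rewrite mxE mulrCA. Qed.

Lemma dot_sumr (R : realType) (d n : nat) (x : 'rV[R]_d)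
    (F : 'I_n -> 'rV[R]_d) :
  dot x (\sum_(j < n) F j) = \sum_(j < n) dot x (F j).
Proof.
rewrite exchange_big /=; apply: eq_bigr => i _.
by rewrite summxE mulr_sumr.
Qed.

Lemma dot_ge0 (R : realType) (d : nat) (x : 'rV[R]_d) : 0 <= dot x x.
Proof. by apply: sumr_ge0 => i _; rewrite -expr2 sqr_ge0. Qed.

Lemma enorm_ge0 (R : realType) (d : nat) (x : 'rV[R]_d) : 0 <= enorm x.
Proof. exact: sqrtr_ge0. Qed.

Lemma sqr_enorm (R : realType) (d : nat) (x : 'rV[R]_d) :
  enorm x ^+ 2 = dot x x.
Proof. by rewrite sqr_sqrtr// dot_ge0. Qed.

(** Cauchy-Schwarz, from the nonnegativity of the squared norm of
    [(y . y) x - (x . y) y]. *)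
Lemma dot_le_enorm (R : realType) (d : nat) (x y : 'rV[R]_d) :
  dot x y <= enorm x * enorm y.
Proof.
have [xy|xy] := leP (dot x y) 0; first by rewrite (le_trans xy)// mulr_ge0 ?enorm_ge0.
rewrite -ler_sqr ?nnegrE ?(ltW xy) ?mulr_ge0 ?enorm_ge0// exprMn !sqr_enorm.
have := dot_ge0 y; rewrite le_eqVlt => /predU1P[y0|y0].
  have yi i : y 0 i = 0.
    apply/eqP; rewrite -sqrf_eq0 expr2; apply/eqP.
    by apply: (psumr_eq0P _ (esym y0)) => // j _; rewrite -expr2 sqr_ge0.
  move: xy; rewrite /dot big1 ?ltxx// => i _; by rewrite yi mulr0.
have := dot_ge0 (dot y y *: x + (- dot x y) *: y).
rewrite dotDr !dotZr ![dot (_ + _) _]dotC !dotDr !dotZr [dot y x]dotC => H.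
rewrite -subr_ge0 -(pmulr_rge0 _ y0); move: H; congr (0 <= _); ring.
Qed.

Lemma coord_le_enorm (R : realType) (d : nat) (x : 'rV[R]_d) (i : 'I_d) :
  `|x 0 i| <= enorm x.
Proof.
rewrite -sqrtr_sqr ler_wsqrtr// /dot (bigD1 i)//= -expr2 lerDl.
by apply: sumr_ge0 => j _; rewrite -expr2 sqr_ge0.
Qed.

Lemma dot_le_enorm_sum (R : realType) (d : nat) (x r : 'rV[R]_d) :
  dot x r <= enorm x * \sum_(i < d) `|r 0 i|.
Proof.
rewrite mulr_sumr; apply: ler_sum => i _; apply: (le_trans (ler_norm _)).
by rewrite normrM ler_wpM2r// coord_le_enorm.
Qed.

Definition one_sided_lipschitz (R : realType) (d : nat) (T L : R)
    (f : R -> 'rV[R]_d -> 'rV[R]_d) : Prop :=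
  forall (t : R) (x y : 'rV[R]_d), 0 <= t <= T ->
    dot (x - y) (f t x - f t y) <= L * enorm (x - y) ^+ 2.

(** A dissipative [f] has the constant 0; for a Lipschitz one this is the
    Cauchy-Schwarz inequality. *)
Lemma one_sided_lipschitz_of (R : realType) (d : nat) (T : R)
    (f : R -> 'rV[R]_d -> 'rV[R]_d) :
  one_sided_dissipative T f \/ uniformly_lipschitz T f ->
  exists2 L, 0 <= L & one_sided_lipschitz T L f.
Proof.
move=> [H|[L H]].
  by exists 0 => // t x y ht; rewrite mul0r; exact: H.
exists `|L| => // t x y ht; apply: (le_trans (dot_le_enorm _ _)).
rewrite mulrC expr2 mulrA ler_wpM2r ?enorm_ge0//.
by apply: (le_trans (H t x y ht)); rewrite ler_wpM2r ?enorm_ge0 ?ler_norm.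
Qed.

(** Take the inner product of the equation with [e n].  For [1 <= j], as
    [w j <= 0], Cauchy-Schwarz bounds [w j * dot (e n) (e (n - j))] from below
    by [w j * enorm (e n) * enorm (e (n - j))]; then cancel [enorm (e n)]. *)
Lemma energy_inequality (R : realType) (d : nat) (w : nat -> R)
    (e : nat -> 'rV[R]_d) (n : nat) (A L : R) (F r : 'rV[R]_d) :
  (forall j, w j.+1 <= 0) -> 0 <= A -> 0 <= L ->
  \sum_(j < n.+1) w j *: e (n - j)%N = A *: (F + r) ->
  dot (e n) F <= L * enorm (e n) ^+ 2 ->
  conv w (fun k => enorm (e k)) n <=
    A * (L * enorm (e n) + \sum_(i < d) `|r 0 i|).
Proof.
move=> w0 A0 L0 eq dF.
have rs0 : 0 <= \sum_(i < d) `|r 0 i| by apply: sumr_ge0.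
have := enorm_ge0 (e n); rewrite le_eqVlt => /predU1P[n0|n0].
  apply: (@le_trans _ _ 0); last by rewrite mulr_ge0// addr_ge0// mulr_ge0// -n0.
  rewrite /conv big_ord_recl subn0 -n0 mulr0 add0r; apply: sumr_le0 => j _.
  by rewrite lift0 mulr_le0_ge0 ?enorm_ge0.
rewrite -(ler_pM2l n0).
apply: (@le_trans _ _ (dot (e n) (\sum_(j < n.+1) w j *: e (n - j)%N))).
  rewrite dot_sumr /conv mulr_sumr; apply: ler_sum => -[[|j] jn] _; rewrite dotZr mulrCA /=.
    by rewrite subn0 -expr2 sqr_enorm.
  by rewrite ler_wnM2l// dot_le_enorm.
rewrite eq dotZr mulrCA ler_wpM2l// dotDr mulrDr lerD//.
  by apply: (le_trans dF); rewrite expr2 mulrCA.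
exact: dot_le_enorm_sum.
Qed.

(** * Convergence *)

Lemma discrete_caputoE (R : realType) (al h : R) (om : nat -> R) (w : R -> R)
    (n : nat) : 0 < h ->
  \sum_(j < n.+1) om j * (w ((n - j)%N%:R * h) - w 0) =
  h `^ al * discrete_caputo al om w h n.
Proof.
move=> h0; rewrite (abel_summation om (fun j => w ((n - j)%N%:R * h) - w 0)) subnn mul0r subrr mulr0 add0r.
rewrite /discrete_caputo mulrA powRN mulfV ?gt_eqF ?powR_gt0// mul1r.
apply: eq_bigr => j _; rewrite partial_sumE /increment; congr (_ * _); ring.
Qed.

Lemma component_regularity (R : realType) (d : nat) (alpha T : R)
    (u psi : R -> 'rV[R]_d) (beta : nat -> 'rV[R]_d) (c : nat -> R) (M : nat)
    (i : 'I_d) :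
  0 < alpha < 1 -> 0 < T -> C1_on T psi ->
  (forall t, 0 <= t <= T ->
    u t = \sum_(1 <= m < M.+1) (c m * t `^ (m%:R * alpha)) *: beta m + psi t) ->
  exists g C, singular_C1 alpha T (fun t => u t 0 i) g C.
Proof.
move=> hal T0 /(_ i)[dpsi cd hq] hu.
apply: (@singular_C1_expansion _ _ _ _ (fun t => psi t 0 i) dpsi
  (fun m => c m * beta m 0 i) M hal T0 cd hq) => t ht.
rewrite hu// mxE summxE; congr (_ + _).
by apply: eq_bigr => m _; rewrite mxE mulrAC.
Qed.

(** The l^1 norm over the components, so that componentwise bounds add up. *)
Definition truncation_sum (R : realType) (d : nat) (al : R) (om : nat -> R)
    (u : R -> 'rV[R]_d) (h : R) (n : nat) : R :=
  \sum_(i < d) `|discrete_caputo al om (fun t => u t 0 i) h n -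
    caputo al (fun t => u t 0 i) (n%:R * h)|.

Lemma truncation_sum_weighted_small (R : realType) (d : nat) (al T Cw : R)
    (om a : nat -> R) (u : R -> 'rV[R]_d) :
  0 < al < 1 -> 0 < T -> good_weights al T om a Cw ->
  (forall i : 'I_d, exists g C, singular_C1 al T (fun t => u t 0 i) g C) ->
  (forall i : 'I_d, caputo_integrable al T (fun t => u t 0 i)) ->
  forall e, 0 < e -> exists2 dl, 0 < dl &
    forall h (n : nat), 0 < h < dl -> n%:R * h <= T ->
      h `^ al * \sum_(j < n) a j * truncation_sum al om u h (n - j)%N <= e.
Proof.
move=> hal T0 gw hsc hint; have /andP[al0 al1] := hal.
have hB (i : 'I_d) : exists B, forall h (n : nat), 0 < h -> (0 < n)%N ->
    n%:R * h <= T ->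
    `|discrete_caputo al om (fun t => u t 0 i) h n -
      caputo al (fun t => u t 0 i) (n%:R * h)| <= B.
  have [g [C sc]] := hsc i.
  exists (3 * (Cw * C / al) + 3 * (Cw * C / al)) => h n h0 n0 nT.
  rewrite (le_trans (ler_normB _ _))// lerD//.
    exact: discrete_caputo_bounded hal gw sc h0 n0 nT.
  apply: (caputo_bounded hal T0 gw sc) => //.
  by rewrite nT mulr_gt0// ltr0n.
have [B HB] := choice hB.
apply: (weighted_error_small (B := \sum_(i < d) B i) al0 T0 gw).
  move=> h n h0 n0 nT; rewrite sumr_ge0//=; apply: ler_sum => i _; exact: HB.
move=> eps e eps0 e0.
have e'0 : 0 < e / d.+1%:R by rewrite divr_gt0.
have : \forall h \near (0 : R)^'+, forall i : 'I_d, forall n : nat,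
    eps <= n%:R * h <= T ->
    `|discrete_caputo al om (fun t => u t 0 i) h n -
      caputo al (fun t => u t 0 i) (n%:R * h)| <= e / d.+1%:R.
  apply: filter_forall => i; apply/near_right0P.
  have [g [C sc]] := hsc i.
  have [dl dl0 H] := truncation_small hal T0 gw sc (hint i) eps0 e'0.
  by exists dl => // h hh n; exact: H.
move=> /near_right0P[dl dl0 H]; exists dl => // h n hh hn.
apply: (@le_trans _ _ (\sum_(i < d) e / d.+1%:R)).
  by apply: ler_sum => i _; exact: H.
rewrite sumr_const card_ord -[leLHS]mulr_natr mulrAC ler_pdivrMr//.
by rewrite ler_pM2l// ler_nat.
Qed.

(** The rate [lam] for which convolution with [L * h `^ al * a] contracts by
    1/2 in the weighted norm of the Gronwall inequality; it exists since
    [h `^ al * gen_fun a (expR (- lam * h))] tends to [lam `^ (- al)]. *)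
Lemma contraction_rate (R : realType) (al L C : R) (a : nat -> R) :
  0 < al -> 0 <= L -> (forall k, 0 <= a k <= C) -> consistent al a ->
  exists2 lam, 0 < lam & exists2 dl, 0 < dl & forall h, 0 < h < dl ->
    forall n, L * h `^ al * \sum_(j < n) a j * expR (- (lam * h)) ^+ j <= 2^-1.
Proof.
move=> al0 L0 aC cons.
have L1 : 0 < 4 * L + 1 by rewrite ltr_wpDl// mulr_ge0.
(* [L * lam `^ (- al)] is below 1/4. *)
pose lam := (4 * L + 1) `^ al^-1.
have lam0 : 0 < lam by exact: powR_gt0.
have lamE : lam `^ al = 4 * L + 1.
  by rewrite /lam -powRrM mulVf ?gt_eqF// powRr1// ltW.
exists lam => //.
have e0 : 0 < (4 * (L + 1))^-1 by rewrite invr_gt0 mulr_gt0// ltr_wpDl.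
have /cvg_right0P/(_ _ e0)[dl dl0 H] := laplace_scale lam0 cons.
exists dl => // h hh n; have /andP[h0 _] := hh.
have hz : 0 <= expR (- (lam * h)) < 1 by apply: expRN_lt1; rewrite mulr_gt0.
have := H h hh; rewrite lamE ler_norml div1r => /andP[_ H1].
rewrite -mulrA.
apply: (@le_trans _ _ (L * ((4 * L + 1)^-1 + (4 * (L + 1))^-1))).
  rewrite ler_wpM2l//.
  apply: (@le_trans _ _ (h `^ al * gen_fun a (expR (- (lam * h))))).
    by rewrite ler_wpM2l ?powR_ge0//; exact: gen_fun_partial_le aC hz.
  by rewrite -lerBlDl.
have k1 : L * (4 * L + 1)^-1 <= 4^-1 by rewrite ler_pdivrMr//; lra.
have k2 : L * (4 * (L + 1))^-1 <= 4^-1.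
  by rewrite ler_pdivrMr ?mulr_gt0 ?ltr_wpDl//; lra.
rewrite mulrDr; lra.
Qed.

Theorem theorem5p2 (R : realType) (d : nat) (alpha T : R)
    (f : R -> 'rV[R]_d -> 'rV[R]_d) (u0 : 'rV[R]_d) (u : R -> 'rV[R]_d)
    (beta : nat -> 'rV[R]_d) (psi : R -> 'rV[R]_d)
    (omega : nat -> R) (U : R -> nat -> 'rV[R]_d)
    (halpha : 0 < alpha < 1) (hT : 0 < T)
    (hu : caputo_solution alpha T f u0 u)
    (hpsi : C1_on T psi)
    (hdec : forall t : R, 0 <= t <= T ->
      u t = \sum_(1 <= m < (Num.truncn alpha^-1).+1)
              ((Gamma (m%:R * alpha + 1))^-1 * t `^ (m%:R * alpha)) *: beta m
            + psi t)
    (hf : one_sided_dissipative T f \/ uniformly_lipschitz T f)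
    (homega : CM_preserving alpha omega)
    (hU : \forall h \near 0^'+, numerical_solution alpha T omega f u0 h (U h)) :
  max_error T u h (U h) @[h --> 0^'+] --> (0 : R).
Proof.
have /andP[al0 al1] := halpha.
have [a [Cw gw]] := CM_preserving_good_weights halpha hT homega.
have [L L0 hL] := one_sided_lipschitz_of hf.
have hsc i := component_regularity i halpha hT hpsi hdec.
have [hu0 _ hcap] := hu.
have hint (i : 'I_d) : caputo_integrable alpha T (fun t => u t 0 i).
  by move=> t ht; have [] := hcap i t ht.
have aC k : 0 <= a k <= a 0%N.
  by rewrite (gw_a_ge0 gw)/=; apply: noninc_seq_le (gw_a_noninc gw) _.
have [lam lam0 [d1 d10 hlam]] := contraction_rate al0 L0 aC (gw_consistent gw).
have [d3 d30 hnum] := (near_right0P _).1 hU.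
apply/cvg_right0P => e e0.
(* The Gronwall bound [2 * delta * expR (lam * T)] becomes [e]. *)
pose delta := e / (2 * expR (lam * T)).
have delta0 : 0 < delta by rewrite divr_gt0// mulr_gt0// expR_gt0.
have [d2 d20 hdel] := truncation_sum_weighted_small halpha hT gw hsc hint delta0.
exists (Num.min d1 (Num.min d2 d3)); first by rewrite !lt_min d10 d20.
move=> h /andP[h0]; rewrite !lt_min => /and3P[h1 h2 h3].
have hq : 0 < h `^ alpha by exact: powR_gt0.
have [U0 hscheme] := hnum h (introT andP (conj h0 h3)).
pose err n := u (n%:R * h) - U h n.
have err0 : enorm (err 0%N) = 0.
  by rewrite /err mul0r hu0 U0 subrr /enorm /dot big1 ?sqrtr0// => i _; rewrite mxE mul0r.
have step n : (0 < n)%N -> n%:R * h <= T ->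
    conv omega (fun k => enorm (err k)) n <=
    h `^ alpha * (L * enorm (err n) + truncation_sum alpha omega u h n).
  move=> n0 nT.
  have ht : 0 <= n%:R * h <= T by rewrite nT mulr_ge0// ltW.
  have ht' : 0 < n%:R * h <= T by rewrite nT mulr_gt0// ltr0n.
  pose r : 'rV[R]_d := \row_i (discrete_caputo alpha omega (fun t => u t 0 i) h n -
    caputo alpha (fun t => u t 0 i) (n%:R * h)).
  have -> : truncation_sum alpha omega u h n = \sum_(i < d) `|r 0 i|.
    by apply: eq_bigr => i _; rewrite mxE.
  apply: (energy_inequality (F := f (n%:R * h) (u (n%:R * h)) - f (n%:R * h) (U h n))
    (gw_w_le0 gw) (ltW hq) L0) => //; last exact: hL.
  have S1 : \sum_(j < n.+1) omega j *: (U h (n - j)%N - u0) =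
      h `^ alpha *: f (n%:R * h) (U h n).
    by rewrite -hscheme// scalerA powRN mulfV ?gt_eqF// scale1r.
  have -> : \sum_(j < n.+1) omega j *: err (n - j)%N =
      \sum_(j < n.+1) omega j *: (u ((n - j)%N%:R * h) - u 0) -
      \sum_(j < n.+1) omega j *: (U h (n - j)%N - u0).
    rewrite -sumrB; apply: eq_bigr => j _; rewrite -scalerBr hu0; congr (_ *: _).
    by rewrite opprB addrA subrK.
  rewrite S1; apply/rowP => i.
  have hc := (hcap i _ ht').2.
  rewrite !mxE summxE hc.
  under eq_bigr do rewrite !mxE.
  rewrite (discrete_caputoE alpha omega (fun t => u t 0 i) n h0); ring.
have bound n : n%:R * h <= T -> enorm (err n) <= e.
  move=> nT.
  have sub i : (i <= n)%N -> i%:R * h <= T.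
    by move=> ni; apply: le_trans nT; rewrite ler_pM2r// ler_nat.
  have G : enorm (err n) <= 2 * delta * expR (lam * h) ^+ n.
    apply: (@gronwall _ a (fun k => enorm (err k)) (L * h `^ alpha) delta lam h n) => //.
    - by rewrite mulr_ge0// ltW.
    - exact: ltW.
    - exact: ltW.
    - exact: gw_a_ge0 gw.
    - by move=> k; apply: hlam; rewrite h0.
    - move=> m mn.
      have := @conv_inverse_le R omega a (fun k => enorm (err k))
        (fun k => h `^ alpha * (L * enorm (err k) + truncation_sum alpha omega u h k))
        m (gw_inverse gw) (gw_a_ge0 gw) err0.
      move=> /(_ _)/le_trans; apply.
        by move=> i /andP[i0 im]; apply: step => //; apply: sub; exact: leq_trans im mn.
      rewrite (eq_bigr (fun j : 'I_m =>
        h `^ alpha * (a j * truncation_sum alpha omega u h (m - j)%N) +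
        L * h `^ alpha * (a j * enorm (err (m - j)%N)))); last by move=> j _; ring.
      rewrite big_split /= -!mulr_sumr lerD2r; apply: hdel; first by rewrite h0.
      exact: sub.
  apply: (le_trans G); rewrite -expRM_natl.
  apply: (@le_trans _ _ (2 * delta * expR (lam * T))).
    have dd0 : 0 <= 2 * delta by rewrite pmulr_rge0// ltW.
    by rewrite ler_wpM2l// ler_expR mulrCA ler_wpM2l ?(ltW lam0).
  by rewrite /delta le_eqVlt; apply/orP; left; apply/eqP; field; rewrite gt_eqF// expR_gt0.
rewrite subr0 /max_error.
set S := [set _ | _ in _].
have S0 : S (enorm (err 0%N)) by exists 0%N => //=; rewrite mul0r ltW.
have ubS : ubound S e by move=> _ [n /= nT <-]; exact: bound.
have hsup : has_sup S by split; [exists (enorm (err 0%N))|exists e].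
rewrite ger0_norm.
  by apply: ge_sup => //; exists (enorm (err 0%N)).
by rewrite -err0; apply: ub_le_sup => //; exists e.
Qed.
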